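(* Let $(S,M)$ be a marked surface, $T$ a tagged triangulation of $(S,M)$ satisfying (A1), and $\delta$ a tagged arc of $(S,M)$ with $\overline{\delta}\notin T$ and satisfying (A2). There are bijections between the following sets: (1) perfect matchings of angles in $T_{\delta}$; (2) perfect matchings of $G_{\delta}$; (3) perfect matchings of the bipartite graph $B_{\delta}$; (4) minimal cuts of the quiver with potential $(\overline{Q}_{\delta},\overline{W}_{\delta})$.
   Context: Surface setting. A marked surface $(S,M)$: $S$ is a connected compact oriented Riemann surface with possibly empty boundary, $M\subset S$ a non-empty finite set with at least one point on each boundary component; punctures are the points of $M$ in the interior. Excluded: a monogon with at most one puncture, an unpunctured digon or triangle, a sphere with at most three punctures. Ordinary arcs, ideal triangulations, tagged arcs and tagged triangulations are in the sense of Fomin–Shapiro–Thurston; if $S$ is closed with exactly one puncture, all tagged arcs are plain. $\overline\delta$ is the plain arc underlying $\delta$. For a plain arc $\gamma$ with endpoints $p,q$ (two distinguished ends if $p=q$), $\gamma^{(p)}$ is $\gamma$ notched at $p$, $\gamma^{(pq)}$ is $\gamma$ notched at both ends. (A1) $T$ consists of plain and 1-notched arcs, and for each puncture at most one 1-notched arc of $T$ has its notched end there. (A2) No 1-notched arc of $T$ has its notched end at a puncture where $\delta$ is notched. $T^0$ is the ideal triangulation obtained from $T$ by replacing every 1-notched arc (plain at $o$, notched at $r$) by the loop at $o$ around it cutting out a monogon containing only the puncture $r$. Polygon $T_\delta$. Let $\gamma=\overline\delta$, oriented from $q$ to $p$; $\tau_1,\dots,\tau_n$ the arcs of $T^0$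 crossed by $\gamma$ in order, $\triangle_0,\dots,\triangle_n$ the triangles passed through. $T_\gamma$ is the triangulated $(n+3)$-gon obtained from copies of $\triangle_0,\dots,\triangle_n$ (a self-folded triangle is cut open along its radius) by gluing the copies of $\triangle_{i-1},\triangle_i$ along $\tau_i$. $T_{\gamma^{(p)}}$ is obtained from $T_\gamma$ by gluing on copies of triangles, one for each corner at $p$ of a triangle of $T^0$ other than the corner through which $\gamma$ reaches $p$, cyclically around $p$ as in the surface, so that $p$ becomes an interior vertex of a triangulated polygon. $T_{\gamma^{(q)}}$ is defined likewise, and $T_{\gamma^{(pq)}}$ by doing this at both ends. Gluing edges are diagonals, the other edges boundary segments. $\zeta_1,\dots,\zeta_m$ are the diagonals at $p$ in $T_{\gamma^{(p)}}$, in counterclockwise order around $p$, with $\tau_n,\zeta_1,\zeta_m$ in one triangle. (1) A perfect matching of angles in $T_\delta$ is a set $A$ of angles of triangles of $T_\delta$ such that each vertex incident to at least one diagonal is the vertex of exactly one angle in $A$ and each triangle has exactly one angle in $A$. (2) Snake graph: for a polygon such as $T_\gamma$ with successive diagonals $\tau_1,\dots,\tau_n$ and triangles $\triangle_0,\dots,\triangle_n$, let tile $i$ be the 4-cycle bounding $\triangle_{i-1}\cup\triangle_i$; glue disjoint tiles $i$ and $i+1$ along the side of $\triangle_i$ different from $\tau_i,\tau_{i+1}$, matching endpoints. The result is $G_\gamma$. A perfect matching of a graph is a set of edges covering each vertex exactly once. If $\delta=\gamma$, perfect matchings of $G_\delta$ are those of the graph $G_\gamma$. Let $\ell_p$ be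 the curve from $q$ following $\gamma$, going once around $p$ and returning along $\gamma$; it crosses $\tau_1,\dots,\tau_n,\zeta_1,\dots,\zeta_m,\tau_n,\dots,\tau_1$, and $T_{\ell_p}$, $G_{\ell_p}$ are built from it as for a plain arc. The first $n$ and the last $n$ tiles form subgraphs $G^1_{\ell_p},G^2_{\ell_p}$, each canonically isomorphic to $G_\gamma$; $H^i_{\ell_p}$ is $G^i_{\ell_p}$ with the vertex $p$ and its two incident edges $\zeta_1,\zeta_m$ removed. A perfect matching of $G_{\gamma^{(p)}}$ means a perfect matching $P$ of $G_{\ell_p}$ that is $\gamma$-symmetric: $P|_{H^1_{\ell_p}}$ and $P|_{H^2_{\ell_p}}$ correspond under the canonical isomorphism. For such $P$, $\operatorname{res}(P)$ is the unique perfect matching of $G_\gamma$ whose edges other than $\zeta_1,\zeta_m$ are $P|_{H^1_{\ell_p}}$. With $\ell_q$, $G_{\ell_q}$ defined by exchanging $p$ and $q$, a perfect matching of $G_{\gamma^{(pq)}}$ means a pair $(P_p,P_q)$ of $\gamma$-symmetric perfect matchings of $G_{\ell_p}$ and $G_{\ell_q}$ with $\operatorname{res}(P_p)=\operatorname{res}(P_q)$ as perfect matchings of $G_\gamma$. (3) $B_\delta$: black vertices are the vertices of $T_\delta$ incident to at least one diagonal, white vertices are the triangles of $T_\delta$; a triangle is joined to those of its three vertices that are black. (4) $\overline{Q}_\delta$: vertices are the diagonals and boundary segments of $T_\delta$; there is an arrow $i\to j$ for each triangle of $T_\delta$ having sides $i,j$ with $j$ following $i$ counterclockwise, and additionally an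 arrow $i\to j$ for each pair of boundary segments $i,j$ not in a common triangle that are consecutive along the boundary (at a common boundary vertex), $i$ being the predecessor of $j$ in clockwise order. Triangle cycles are the 3-cycles inside triangles of $T_\delta$; exterior cycles are the cycles winding around a vertex (boundary vertex incident to a diagonal, or puncture) of $T_\delta$. $\overline W_\delta=\sum(\text{triangle cycles})-\sum(\text{exterior cycles})$. A cut is a set $C$ of arrows such that every cycle appearing in $\overline W_\delta$ contains exactly one arrow of $C$; it is minimal if $|C|$ equals the number $n(\delta)$ of triangle cycles (which equals the number of exterior cycles). *)

(* Defs.v *)
From HB Require Import structures.
From mathcomp Require Import all_boot all_order all_algebra.
From mathcomp Require Import complex.
From mathcomp Require Import all_classical all_reals all_analysis.

Set Implicit Arguments.
Unset Strict Implicit.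
Unset Printing Implicit Defensive.

Import Order.TTheory GRing.Theory Num.Theory numFieldNormedType.Exports.

Local Open Scope classical_set_scope.
Local Open Scope card_scope.
Local Open Scope complex_scope.
Local Open Scope ring_scope.

Notation plane R := (R[i]^o).

Definition upper_half_plane (R : realType) : set (plane R) :=
  [set z | 0 <= complex.Im z].

Definition sq_modulus (R : realType) (z : plane R) : R :=
  complex.Re z ^+ 2 + complex.Im z ^+ 2.

Definition closed_disc (R : realType) : set (plane R) :=
  [set z | sq_modulus z <= 1].

Definition unit_circle (R : realType) : set (plane R) :=
  [set z | sq_modulus z = 1].

Definition sphere2 (R : realType) : set (R * R * R) :=
  [set x | x.1.1 ^+ 2 + x.1.2 ^+ 2 + x.2 ^+ 2 = 1].

(* For compact S and Hausdorff V an injective continuous map is a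
   homeomorphism onto its image. *)
Definition homeomorphic_to (S V : topologicalType) (K : set V) : Prop :=
  exists h : S -> V, [/\ continuous h, injective h & range h = K].

Record chart (R : realType) (S : topologicalType) := Chart {
  dom : set S;
  coord : S -> plane R
}.

(* A homeomorphism from an open set onto a relatively open subset of the
   closed upper half plane. *)
Definition is_chart (R : realType) (S : topologicalType) (a : chart R S) :=
  [/\ open (dom a), {within dom a, continuous (coord a)}, set_inj (dom a) (coord a)
    & forall V, open V -> V `<=` dom a ->
        exists W, open W /\ coord a @` V = W `&` upper_half_plane (R := R)].

(* The transition from a to b is holomorphic wherever the coordinate a lies in
   the open upper half plane.  At the other points it is only required to be
   continuous; it then extends holomorphically by Schwarz reflection. *)
Definition holomorphic_transition (R : realType) (S : topologicalType)
    (a b : chart R S) :=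
  forall x, dom a x -> dom b x -> 0 < complex.Im (coord a x) ->
    exists g : plane R -> plane R,
      derivable g (coord a x) 1 /\ \forall y \near x, g (coord a y) = coord b y.

Definition riemann_surface (R : realType) (S : topologicalType)
    (atlas : set (chart R S)) :=
  [/\ forall a, atlas a -> is_chart a,
      forall x, exists a, atlas a /\ dom a x
    & forall a b, atlas a -> atlas b -> holomorphic_transition a b].

Definition boundary (R : realType) (S : topologicalType)
    (atlas : set (chart R S)) : set S :=
  [set x | forall a, atlas a -> dom a x -> complex.Im (coord a x) = 0].

Definition excluded_surface (R : realType) (S : topologicalType)
    (bd M : set S) : Prop :=
  (homeomorphic_to S (closed_disc (R := R)) /\
     [\/ M `&` bd #= `I_1 /\ M `\` bd #<= `I_1,
         M `&` bd #= `I_2 /\ M `\` bd = set0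
       | M `&` bd #= `I_3 /\ M `\` bd = set0])
  \/ (homeomorphic_to S (sphere2 (R := R)) /\ M #<= `I_3).

Record marked_surface (R : realType) := MarkedSurface {
  surf :> topologicalType;
  atlas : set (chart R surf);
  M : set surf;
  surf_hausdorff : hausdorff_space surf;
  surf_compact : compact [set: surf];
  surf_connected : connected [set: surf];
  surf_riemann : riemann_surface atlas;
  M_neq0 : M !=set0;
  M_finite : finite_set M;
  M_boundary : forall x, boundary atlas x ->
    connected_component (boundary atlas) x `&` M !=set0;
  surf_not_excluded : ~ excluded_surface R (boundary atlas) M
}.

Arguments M {R} m.

Definition bd (R : realType) (X : marked_surface R) : set X :=
  boundary (atlas (m := X)).

Arguments bd {R} X.

Definition closed_once_punctured (R : realType) (X : marked_surface R) :=
  bd X = set0 /\ M X #= `I_1.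

(* A curve is a function on R of which only the values on [0, 1] matter. *)
Definition trace (R : realType) (X : marked_surface R) (c : R -> X) : set X :=
  c @` `[0, 1]%classic.

Definition open_trace (R : realType) (X : marked_surface R) (c : R -> X) :
  set X := c @` `]0, 1[%classic.

Definition reverse (R : realType) (X : marked_surface R) (c : R -> X) :
  (R -> X) := fun t => c (1 - t).

(* D is an embedded closed disc whose boundary circle is the loop c. *)
Definition monogon (R : realType) (X : marked_surface R) (c : R -> X)
    (D : set X) : Prop :=
  c 0 = c 1 /\ exists f : plane R -> X,
    [/\ {within closed_disc (R := R), continuous f},
        set_inj (closed_disc (R := R)) f,
        f @` unit_circle (R := R) = trace c & f @` closed_disc (R := R) = D].

(* c cobounds with part of the boundary of X a disc with vertices c 0 and c 1
   and no further marked point.  The vertices, images of 1 and -1, coincide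
   when c is a loop parallel to a boundary component. *)
Definition cuts_unpunctured_digon (R : realType) (X : marked_surface R)
    (c : R -> X) : Prop :=
  exists f : plane R -> X,
    [/\ {within closed_disc (R := R), continuous f},
        forall z w, closed_disc z -> closed_disc w -> f z = f w ->
          [\/ z = w, z = 1 /\ w = -1 | z = -1 /\ w = 1],
        f @` [set z | unit_circle z /\ 0 <= complex.Im z] = trace c,
        f @` [set z | unit_circle z /\ complex.Im z <= 0] `<=` bd X
      & M X `&` f @` closed_disc (R := R) = [set c 0; c 1]].

Definition is_arc (R : realType) (X : marked_surface R) (c : R -> X) : Prop :=
  [/\ {within `[0, 1]%classic, continuous c}
      /\ (forall s t, 0 <= s -> s < t -> t <= 1 -> c s = c t -> s = 0 /\ t = 1),
      M X (c 0) /\ M X (c 1),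
      open_trace c `&` (M X `|` bd X) = set0,
      ~ (exists D, monogon c D /\ M X `&` D = [set c 0])
    & ~ cuts_unpunctured_digon c].

Definition isotopic (R : realType) (X : marked_surface R) (c d : R -> X) :=
  exists H : R * R -> X,
    [/\ {within `[0, 1]%classic `*` `[0, 1]%classic, continuous H},
        forall t, 0 <= t -> t <= 1 -> H (0, t) = c t,
        forall t, 0 <= t -> t <= 1 -> H (1, t) = d t
      & forall s, 0 <= s -> s <= 1 ->
          [/\ is_arc (fun t => H (s, t)), H (s, 0) = c 0 & H (s, 1) = c 1]].

Definition same_arc (R : realType) (X : marked_surface R) (c d : R -> X) :=
  isotopic c d \/ isotopic c (reverse d).

Definition compatible_arcs (R : realType) (X : marked_surface R)
    (c d : R -> X) :=
  exists c' d', [/\ isotopic c c', isotopic d d'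
                  & open_trace c' `&` open_trace d' = set0].

(* notched false is the tag at the end c 0, notched true that at the end c 1;
   the value true means notched. *)
Record tagged_curve (R : realType) (X : marked_surface R) := TaggedCurve {
  under :> R -> X;
  notched : bool -> bool
}.

Definition end_of (R : realType) (X : marked_surface R) (c : R -> X)
  (e : bool) : X := if e then c 1 else c 0.

Definition tags (at0 at1 : bool) : bool -> bool :=
  fun e => if e then at1 else at0.

Definition plain (R : realType) (X : marked_surface R) (c : R -> X) :=
  TaggedCurve c (tags false false).

Definition is_tagged_arc (R : realType) (X : marked_surface R)
    (a : tagged_curve X) : Prop :=
  [/\ is_arc a,
      ~ (exists D r, [/\ monogon a D, r <> a 0 & M X `&` D = [set a 0; r]]),
      forall e, notched a e -> ~ bd X (end_of a e),
      a 0 = a 1 -> notched a false = notched a true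
    & closed_once_punctured X -> forall e, notched a e = false].

Definition same_tagged_arc (R : realType) (X : marked_surface R)
    (a b : tagged_curve X) :=
  (isotopic a b /\ forall e, notched a e = notched b e) \/
  (isotopic a (reverse b) /\ forall e, notched a e = notched b (~~ e)).

Definition compatible (R : realType) (X : marked_surface R)
    (a b : tagged_curve X) : Prop :=
  [/\ compatible_arcs a b,
      ~ same_arc a b ->
        forall e e', end_of a e = end_of b e' -> notched a e = notched b e',
      isotopic a b -> exists e, notched a e = notched b e
    & isotopic a (reverse b) -> exists e, notched a e = notched b (~~ e)].

(* Tagged arcs are isotopy classes; a set of them is given here by the set of
   all curves representing them (maximality makes T closed under isotopy). *)
Definition tagged_triangulation (R : realType) (X : marked_surface R)
    (T : set (tagged_curve X)) : Prop :=
  [/\ forall a, T a -> is_tagged_arc a,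
      forall a b, T a -> T b -> compatible a b
    & forall a, is_tagged_arc a -> (forall b, T b -> compatible a b) -> T a].

Definition notched_at (R : realType) (X : marked_surface R)
    (a : tagged_curve X) (r : X) : Prop :=
  exists e, notched a e /\ end_of a e = r.

Definition one_notched_at (R : realType) (X : marked_surface R)
    (a : tagged_curve X) (r : X) : Prop :=
  notched_at a r /\ notched a false != notched a true.

Definition plain_or_one_notched (R : realType) (X : marked_surface R)
    (T : set (tagged_curve X)) : Prop :=
  (forall a, T a -> ~~ (notched a false && notched a true)) /\
  (forall r a b, T a -> T b -> one_notched_at a r -> one_notched_at b r ->
     same_tagged_arc a b).

Definition no_common_notch (R : realType) (X : marked_surface R)
    (T : set (tagged_curve X)) (d : tagged_curve X) : Prop :=
  forall a r, T a -> one_notched_at a r -> ~ notched_at d r.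

(* The loop c cuts out a monogon which contains the one-notched arc a and whose
   only puncture is the notched endpoint r of a. *)
Definition loop_around (R : realType) (X : marked_surface R)
    (a : tagged_curve X) (r : X) (c : R -> X) : Prop :=
  is_arc c /\ exists D,
    [/\ monogon c D, r <> c 0, M X `&` D = [set c 0; r] & trace a `<=` D].

(* The arcs of the ideal triangulation obtained from T by replacing every
   one-notched arc by the loop around it. *)
Definition ideal_arcs (R : realType) (X : marked_surface R)
    (T : set (tagged_curve X)) : set (R -> X) :=
  [set c | T (plain c)
           \/ exists a r, [/\ T a, one_notched_at a r & loop_around a r c]].

(* The corners of a triangle are numbered counterclockwise by 'I_3 and side k
   goes from corner k to corner k + 1. *)
Definition corner (R : realType) (k : 'I_3) : plane R :=
  nth 0 [:: 0; 1; 0 +i* 1] k.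

Definition segment (R : realType) (z w : plane R) (t : R) : plane R :=
  (1 - t)%:C * z + t%:C * w.

Definition closed_triangle (R : realType) : set (plane R) :=
  [set z | [/\ 0 <= complex.Re z, 0 <= complex.Im z
             & complex.Re z + complex.Im z <= 1]].

Definition open_triangle (R : realType) : set (plane R) :=
  [set z | [/\ 0 < complex.Re z, 0 < complex.Im z
             & complex.Re z + complex.Im z < 1]].

Definition side_point (R : realType) (k : 'I_3) (t : R) : plane R :=
  segment (corner R k) (corner R (k + 1)) t.

Definition open_side (R : realType) (k : 'I_3) : set (plane R) :=
  side_point k @` `]0, 1[%classic.

Definition holomorphic_into (R : realType) (X : marked_surface R)
    (U : set (plane R)) (f : plane R -> X) : Prop :=
  forall z a, U z -> atlas a -> dom a (f z) -> derivable (coord a \o f) z 1.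

(* Curves representing the arcs of the ideal triangulation are chosen without
   crossings.  Each complementary region is parametrised by a standard
   triangle, holomorphically in the interior: this says that the
   parametrisation preserves the orientation, and exists by the Riemann
   mapping theorem and Caratheodory's extension to the boundary.  In a
   self-folded triangle two sides are glued to one another, so the standard
   triangle is the self-folded triangle cut open along its radius. *)
Record dissection (R : realType) (X : marked_surface R)
    (T : set (tagged_curve X)) := Dissection {
  face : finType;
  param : face -> plane R -> X;
  glue : face * 'I_3 -> option (face * 'I_3);
  side_curve : face * 'I_3 -> (R -> X) :=
    fun x t => param x.1 (side_point x.2 t);
  param_continuous : forall f,
    {within closed_triangle (R := R), continuous (param f)};
  param_holomorphic : forall f,
    holomorphic_into (open_triangle (R := R)) (param f);
  param_corner : forall f k, M X (param f (corner R k));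
  param_cover : forall x, exists f z, closed_triangle z /\ param f z = x;
  param_inj : forall f g z w, open_triangle z -> closed_triangle w ->
    param f z = param g w -> f = g /\ z = w;
  side_boundary : forall x, glue x = None ->
    [/\ open_trace (side_curve x) `<=` bd X `\` M X
      & forall s t, 0 < s -> s < t -> t < 1 ->
          side_curve x s <> side_curve x t];
  side_glued : forall x y, glue x = Some y ->
    [/\ x != y, ideal_arcs T (side_curve x)
      & open_trace (side_curve x) = open_trace (side_curve y)];
  side_disjoint : forall x y, x != y ->
    open_trace (side_curve x) `&` open_trace (side_curve y) !=set0 ->
    glue x = Some y;
  ideal_arcs_complete : forall c, ideal_arcs T c ->
    exists2 x, glue x <> None & same_arc c (side_curve x);
  ideal_arcs_distinct : forall x y, glue x <> None -> glue y <> None ->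
    same_arc (side_curve x) (side_curve y) -> x = y \/ glue x = Some y;
  (* The self-folded triangles are the monogons cut out by the loops around the
     one-notched arcs of T: the radius, notched at the vertex around which the
     triangle is folded, belongs to T. *)
  self_folded : forall f k, glue (f, k) = Some (f, k + 1) ->
    T (TaggedCurve (side_curve (f, k)) (tags false true))
}.

(* Triangles 0, ..., len, triangle i being glued along its side exit i to the
   side entry (i + 1) of triangle i + 1. *)
Record strip := Strip {
  len : nat;
  entry : nat -> 'I_3;
  exit : nat -> 'I_3
}.

Record route (F : finType) := Route {
  strip_of :> strip;
  tri : nat -> F;
  start : 'I_3;
  stop : 'I_3
}.

(* The curve c is in minimal position: it is a concatenation of straight
   chords of the triangles tri 0, ..., tri len, the first one issuing from the
   corner start of tri 0 and the last one ending at the corner stop of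
   tri len.  A chord interior to the triangle never returns to the side it comes
   from, so no crossing with the triangulation can be removed by an isotopy. *)
Definition follows (R : realType) (X : marked_surface R)
    (T : set (tagged_curve X)) (K : dissection T) (c : R -> X)
    (w : route (face K)) : Prop :=
  exists (t : nat -> R) (z z' : nat -> plane R),
    [/\ t 0%N = 0 /\ t (len w).+1 = 1,
        z 0%N = corner R (start w) /\ z' (len w) = corner R (stop w),
        forall i, (i < len w)%N ->
          [/\ open_side (exit w i) (z' i), open_side (entry w i.+1) (z i.+1)
            & glue (tri w i, exit w i) = Some (tri w i.+1, entry w i.+1)],
        forall i, (i <= len w)%N -> t i < t i.+1
      & forall i s, (i <= len w)%N -> 0 <= s -> s <= 1 ->
          c (t i + s * (t i.+1 - t i)) = param (tri w i) (segment (z i) (z' i) s)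
          /\ (0 < s -> s < 1 -> open_triangle (segment (z i) (z' i) s))].

(* The triangle corner reached from the corner x by turning counterclockwise
   around their common vertex. *)
Definition turn (R : realType) (X : marked_surface R)
    (T : set (tagged_curve X)) (K : dissection T) (x : face K * 'I_3) :
    face K * 'I_3 := odflt x (glue (x.1, x.2 - 1)).

(* The triangles around a puncture in counterclockwise order, beginning with
   the one in which the arc ends: their number, and the corner of the k-th one
   which lies at the puncture. *)
Record fan := Fan {
  valency : nat;
  apex : nat -> 'I_3
}.

Definition fan_at (R : realType) (X : marked_surface R)
    (T : set (tagged_curve X)) (K : dissection T) (x : face K * 'I_3) : fan :=
  Fan (fingraph.order (turn (K := K)) x)
      (fun k => (iter k (turn (K := K)) x).2).

Definition stop_fan (R : realType) (X : marked_surface R)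
    (T : set (tagged_curve X)) (K : dissection T) (w : route (face K))
    (b : bool) : option fan :=
  if b then Some (fan_at (tri w (len w), stop w)) else None.

Definition start_fan (R : realType) (X : marked_surface R)
    (T : set (tagged_curve X)) (K : dissection T) (w : route (face K))
    (b : bool) : option fan :=
  if b then Some (fan_at (tri w 0, start w)) else None.

Record polygon := Polygon {
  ptri : finType;
  pglue : rel (ptri * 'I_3)
}.

(* The number of triangles glued on around an end of the arc. *)
Definition extra (o : option fan) : nat :=
  if o is Some v then (valency v).-1 else 0%N.

Definition arc_tri (n : nat) (fq fp : option fan) : finType :=
  ('I_n.+1 + ('I_(extra fp) + 'I_(extra fq)))%type.

(* The k-th triangle of the fan at the end p, resp. q, of the arc. *)
Definition p_fan_tri (n : nat) (fq fp : option fan) (t : arc_tri n fq fp)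
    (k : nat) : bool :=
  match t with
  | inl i => (i == n :> nat) && (k == 0%N)
  | inr (inl j) => k == j.+1
  | inr (inr _) => false
  end.

Definition q_fan_tri (n : nat) (fq fp : option fan) (t : arc_tri n fq fp)
    (k : nat) : bool :=
  match t with
  | inl i => (i == 0%N :> nat) && (k == 0%N)
  | inr (inl _) => false
  | inr (inr j) => k == j.+1
  end.

Definition fan_glue (U : finType) (fan_tri : U -> nat -> bool)
    (o : option fan) (x y : U * 'I_3) : bool :=
  if o is Some v then
    [exists k : 'I_(valency v),
      let k' := (k.+1 %% valency v)%N in
      [&& fan_tri x.1 k, x.2 == apex v k - 1,
          fan_tri y.1 k' & y.2 == apex v k']]
  else false.

Definition strip_glue (w : strip) (fq fp : option fan)
    (x y : arc_tri (len w) fq fp * 'I_3) : bool :=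
  match x.1, y.1 with
  | inl i, inl j =>
      [&& j == i.+1 :> nat, x.2 == exit w i & y.2 == entry w j]
  | _, _ => false
  end.

(* fq and fp are the fans at the first and last point of the arc, None
   standing for a plain end. *)
Definition arc_polygon (w : strip) (fq fp : option fan) : polygon :=
  let g (x y : arc_tri (len w) fq fp * 'I_3) :=
    [|| strip_glue x y, fan_glue (@p_fan_tri (len w) fq fp) fp x y
      | fan_glue (@q_fan_tri (len w) fq fp) fq x y] in
  Polygon (fun x y => g x y || g y x).

Definition diagonal (P : polygon) (x : ptri P * 'I_3) : bool :=
  [exists y, pglue x y].

(* Glueing side i to side j identifies corner i with corner j + 1 and corner
   i + 1 with corner j. *)
Definition meet_corners (P : polygon) (x y : ptri P * 'I_3) : bool :=
  pglue x (y.1, y.2 - 1) || pglue (x.1, x.2 - 1) y.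

Definition vertex (P : polygon) (x : ptri P * 'I_3) : {set ptri P * 'I_3} :=
  [set y | connect (@meet_corners P) x y]%SET.

Definition on_diagonal (P : polygon) (x : ptri P * 'I_3) : bool :=
  [exists y in vertex x, diagonal y || diagonal (y.1, y.2 - 1)].

Definition diagonal_vertices (P : polygon) : {set {set ptri P * 'I_3}} :=
  [set vertex x | x in [pred x | on_diagonal x]]%SET.

(* An angle is named by its triangle corner. *)
Definition angle_matching (P : polygon) (A : {set ptri P * 'I_3}) : bool :=
  [forall v in diagonal_vertices P, #|[set x in A | x \in v]%SET| == 1%N] &&
  [forall t : ptri P, #|[set x in A | x.1 == t]%SET| == 1%N].

Record graph := Graph {
  gvert : finType;
  gedge : finType;
  verts : {set gvert};
  edges : {set gedge};
  incident : gedge -> gvert -> bool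
}.

Definition perfect_matching (G : graph) (P : {set gedge G}) : bool :=
  (P \subset edges G) &&
  [forall v in verts G, #|[set e in P | incident e v]%SET| == 1%N].

(* The graph whose white vertices are the triangles and whose black vertices
   are the vertices incident to a diagonal. *)
Definition bipartite_graph (P : polygon) : graph :=
  @Graph ({set ptri P * 'I_3} + ptri P)%type
         ({set ptri P * 'I_3} * ptri P)%type
    [set v | match v with
             | inl b => b \in diagonal_vertices P
             | inr _ => true
             end]%SET
    [set e | (e.1 \in diagonal_vertices P) && [exists k, (e.2, k) \in e.1]]%SET
    (fun e v => match v with
                | inl b => e.1 == b
                | inr t => e.2 == t
                end).

(* Tile i of a snake graph, counted from 0, bounds the triangles i and i + 1 of
   the strip.  A corner of a triangle in a tile is (i, b, k), for corner k of
   the triangle i + b. *)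
(* The side of triangle i + b that is the diagonal of tile i. *)
Definition tile_diagonal (w : strip) (i : nat) (b : bool) : 'I_3 :=
  if b then entry w i.+1 else exit w i.

Definition same_tile_vertex (w : strip)
    (x y : 'I_(len w) * bool * 'I_3) : bool :=
  let: (i, b, k) := x in let: (j, c, l) := y in
  [&& i == j, c == ~~ b &
    ((k == tile_diagonal w i b) && (l == tile_diagonal w i c + 1)) ||
    ((k == tile_diagonal w i b + 1) && (l == tile_diagonal w i c))].

(* Tiles i and i + 1 share triangle i + 1 and are glued along its side s which
   is the diagonal of neither. *)
Definition glued_tile_vertex (w : strip)
    (x y : 'I_(len w) * bool * 'I_3) : bool :=
  let: (i, b, k) := x in let: (j, c, l) := y in
  [&& j == i.+1 :> nat, b, ~~ c, k == l &
    [exists s : 'I_3, [&& s != tile_diagonal w i b, s != tile_diagonal w j c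
                        & (k == s) || (k == s + 1)]]].

Definition tile_vertex (w : strip) (x : 'I_(len w) * bool * 'I_3) :
    {set 'I_(len w) * bool * 'I_3} :=
  [set y | connect (fun y z => [|| same_tile_vertex y z,
                       glued_tile_vertex y z | glued_tile_vertex z y]) x y]%SET.

(* A side of a tile is named by the pair (j, s) of the triangle j of the strip
   and the side s of it of which it is a copy.  Two sides of tiles have the
   same name exactly when they are glued, so names are edges of the graph. *)
Definition side_in_tile (w : strip) (e : 'I_(len w).+1 * 'I_3)
    (i : 'I_(len w)) (b : bool) : bool :=
  (e.1 == (i + b)%N :> nat) && (e.2 != tile_diagonal w i b).

Definition snake_graph (w : strip) : graph :=
  @Graph {set 'I_(len w) * bool * 'I_3} ('I_(len w).+1 * 'I_3)%type
    [set tile_vertex x | x in [set: 'I_(len w) * bool * 'I_3]]%SET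
    [set e | [exists i, exists b, side_in_tile e i b]]%SET
    (fun e v => [exists i, exists b, side_in_tile e i b &&
                   (((i, b, e.2) \in v) || ((i, b, e.2 + 1) \in v))]).

(* The strip of triangles along the arc traversed backwards. *)
Definition rev_strip (w : strip) : strip :=
  Strip (len w) (fun j => exit w (len w - j)) (fun j => entry w (len w - j)).

(* The strip of triangles along the curve which follows the arc to its last
   point p, goes around p counterclockwise, and returns along the arc.  The
   first zeta crossed is the side apex 0 - 1 of the last triangle of the arc,
   the last one its side apex 0. *)
Definition hook_strip (w : strip) (v : fan) : strip :=
  let n := len w in let m := valency v in let N := (n + m + n)%N in
  Strip N
    (fun j => if (j <= n)%N then entry w j
              else if (j < n + m)%N then apex v (j - n)
              else if j == (n + m)%N then apex v 0
              else exit w (N - j))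
    (fun j => if (j < n)%N then exit w j
              else if (j < n + m)%N then apex v (j - n) - 1
              else entry w (N - j)).

(* Triangles j and N - j of the hook strip are copies of the same triangle j
   of the arc.  The edges of the first (last) n tiles that are copies of sides
   of triangles j < n are all their edges other than zeta_1 and zeta_m, the
   edges incident to the vertex p. *)
Definition symmetric_matching (w : strip) (v : fan)
    (P : {set gedge (snake_graph (hook_strip w v))}) : bool :=
  perfect_matching P &&
  [forall e : 'I_(len (hook_strip w v)).+1 * 'I_3,
    (e.1 < len w)%N ==> ((e \in P) == ((rev_ord e.1, e.2) \in P))].

(* Q is res(P). *)
Definition is_res (w : strip) (v : fan)
    (P : {set gedge (snake_graph (hook_strip w v))})
    (Q : {set gedge (snake_graph w)}) : bool :=
  perfect_matching Q &&
  [forall e : 'I_(len w).+1 * 'I_3,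
    (e.1 < len w)%N ==> ((e \in Q) == ((inord e.1, e.2) \in P))].

(* The isomorphism from the snake graph of the arc to that of the reversed
   arc. *)
Definition flip (w : strip) (Q : {set gedge (snake_graph w)}) :
    {set gedge (snake_graph (rev_strip w))} :=
  [set (rev_ord e.1, e.2) | e in Q]%SET.

Definition snake_matchings (w : strip) (fq fp : option fan) : Type :=
  match fq, fp with
  | None, None => {P : {set gedge (snake_graph w)} | perfect_matching P}
  | None, Some p =>
      {P : {set gedge (snake_graph (hook_strip w p))} | symmetric_matching P}
  | Some q, None =>
      {P : {set gedge (snake_graph (hook_strip (rev_strip w) q))}
         | symmetric_matching P}
  | Some q, Some p =>
      {PQ : {set gedge (snake_graph (hook_strip w p))} *
            {set gedge (snake_graph (hook_strip (rev_strip w) q))}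
         | [&& symmetric_matching PQ.1, symmetric_matching PQ.2 &
               [exists Q : {set gedge (snake_graph w)},
                  is_res PQ.1 Q && is_res PQ.2 (flip Q)]]}
  end.

(* The potential is a list of cycles with coefficients.  A cycle, none of which
   passes twice through an arrow here, is recorded as the set of its arrows. *)
Record quiver_with_potential := QP {
  qvert : finType;
  qarr : finType;
  qverts : {set qvert};
  qarrows : {set qarr};
  qsource : qarr -> qvert;
  qtarget : qarr -> qvert;
  potential : seq (int * {set qarr})
}.

Definition is_cut (Q : quiver_with_potential) (C : {set qarr Q}) : bool :=
  (C \subset qarrows Q) &&
  all (fun z => #|(C :&: z.2)%SET| == 1%N) (potential Q).

(* A diagonal or boundary segment, as the set of the triangle sides that are
   glued to form it. *)
Definition edge_of (P : polygon) (x : ptri P * 'I_3) : {set ptri P * 'I_3} :=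
  [set y | (y == x) || pglue x y]%SET.

(* inl (t, k) is the arrow from side k to side k + 1 inside the triangle t;
   inr (x, y) is an arrow between boundary segments. *)
Definition polygon_arrow (P : polygon) : finType :=
  ((ptri P * 'I_3) + (ptri P * 'I_3) * (ptri P * 'I_3))%type.

(* Side k of a triangle runs from corner k to corner k + 1 with the polygon on
   its left.  Clockwise along the boundary, the segment x immediately precedes
   y when the initial corner of x is the final corner of y. *)
Definition is_polygon_arrow (P : polygon) (a : polygon_arrow P) : bool :=
  match a with
  | inl _ => true
  | inr (x, y) => [&& ~~ diagonal x, ~~ diagonal y, x.1 != y.1
                    & (y.1, y.2 + 1) \in vertex x]
  end.

Definition triangle_cycle (P : polygon) (t : ptri P) :
    {set polygon_arrow P} :=
  [set a | match a with inl x => x.1 == t | inr _ => false end]%SET.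

(* The arrows around the vertex v: one for each angle at v, and the boundary
   arrow at v if v is on the boundary. *)
Definition exterior_cycle (P : polygon) (v : {set ptri P * 'I_3}) :
    {set polygon_arrow P} :=
  [set a | is_polygon_arrow a &&
           match a with
           | inl x => (x.1, x.2 + 1) \in v
           | inr (x, y) => x \in v
           end]%SET.

Definition polygon_qp (P : polygon) : quiver_with_potential :=
  @QP {set ptri P * 'I_3} (polygon_arrow P)
    [set edge_of x | x in [set: ptri P * 'I_3]]%SET
    [set a | is_polygon_arrow a]%SET
    (fun a => match a with
              | inl x => edge_of x
              | inr (x, y) => edge_of x
              end)
    (fun a => match a with
              | inl x => edge_of (x.1, x.2 + 1)
              | inr (x, y) => edge_of y
              end)
    ([seq (1, triangle_cycle t) | t <- enum (ptri P)] ++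
     [seq (-1, exterior_cycle v) | v <- enum (diagonal_vertices P)]).

Definition minimal_cut (P : polygon) (C : {set polygon_arrow P}) : bool :=
  @is_cut (polygon_qp P) C && (#|C| == #|ptri P|).

Definition in_bijection (A B : Type) : Prop := exists f : A -> B, bijective f.

(* Main.v *)
Require Import Defs.
From HB Require Import structures.
From mathcomp Require Import all_boot all_order all_algebra.
From mathcomp Require Import complex.
From mathcomp Require Import all_classical all_reals all_analysis.
From mathcomp Require Import fintype finset zify ring lra.

Set Implicit Arguments.
Unset Strict Implicit.
Unset Printing Implicit Defensive.

Import Order.TTheory GRing.Theory Num.Theory numFieldNormedType.Exports.

Local Open Scope ring_scope.

(* In a strip of triangles 0, ..., n, consecutive ones sharing a diagonal,
   choose one angle in every triangle.  The choice is a matching of angles if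
   and only if a local rule holds across each diagonal, expressing that exactly
   one end of the diagonal is matched by the triangles preceding it.  Replacing
   angles by opposite sides turns the vertex equations of the snake graph into
   the same local rule, so both kinds of matchings of a plain arc are the same
   local data.

   Around a notched end the polygon has a fan of m triangles.  Given which end
   of the first diagonal of the arc at that puncture is matched within the fan,
   the matchings of the fan are those of a linear chain of m triangles obtained
   by cutting it open.  The same chain appears between the two symmetric halves
   of the hook strip, where one more angle is forced.  Hence angle
   matchings and snake matchings are both counted by a matching of the strip
   together with one matching of a linear chain for every notched end.

   Since the three corners of a triangle of the polygon are different vertices,
   angles are edges of the bipartite graph.  A minimal cut has one arrow in
   every triangle, hence no others, and arrows in triangles are angles.

   The surface only matters for showing that the arc never leaves a triangle
   through the side by which it entered, and that every puncture at which it is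
   notched lies in at least two corners of triangles.  If there were only one,
   either it would lie on a side in the boundary, or the triangle would be
   self-folded and its radius notched at that puncture, against (A2). *)

(** The bijections are not given by formulas. All the sets are finite, and each has
    [#|local_matchings w|] times one factor [end_size] per end as its number of elements; relations
    such as [is_res] serve only for counting, through [card_double_count]. The main obstacle is that
    vertices, of the polygon as of the snake graph, are connected components of an identification of
    triangle corners. Both are handled by a labelling of corners which is constant along
    identifications, while every corner is connected to a canonical one that its label determines.
    Membership in a vertex thereby becomes equality of labels. Corners and sides are residues modulo
    3, side k being opposite to corner k - 1. Glueing two sides reverses their direction and so acts
    on corners as a reflection [c - k]. Case distinctions inside triangles thus become statements
    about a few residues, which [I3] checks by letting each run through 0, 1 and -1. *)

Lemma I3_ind (P : 'I_3 -> Prop) : P 0 -> P 1 -> P (-1) -> forall k, P k.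
Proof.
move=> P0 P1 P2 [[|[|[|]]] //= lt].
- by have -> : Ordinal lt = 0 by apply: val_inj.
- by have -> : Ordinal lt = 1 by apply: val_inj.
by have -> : Ordinal lt = -1 by apply: val_inj.
Qed.

Ltac I3 :=
  repeat (match goal with k : ?U |- _ => unify U 'I_3; move: k end);
  repeat (apply: I3_ind); vm_compute; done.

Ltac lia_clear :=
  repeat match goal with
  | H : _ <-> _ |- _ => clear H
  | H : forall _, _ |- _ => clear H
  | H : (_ == _) = _ |- _ => clear H
  end; lia.

Lemma connect_invariant (T : finType) (e : rel T) (L : eqType) (f : T -> L) :
  (forall x y, e x y -> f x = f y) -> forall x y, connect e x y -> f x = f y.
Proof.
move=> fe x y /connectP[p]; elim: p x => [|z p IH] x /=; first by move=> _ ->.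
by case/andP=> /fe -> /IH h /h.
Qed.

(** * Snake graphs *)

Section Strip.
Variable w : strip.
Local Notation n := (len w).

(* newc i is the corner of triangle i opposite to the side through which the
   strip enters, so that its vertex is new; oldc i is the corner opposite to
   the exit.  In the first and the last triangle these are the ends of the arc,
   oldc 0 and newc n, together with an arbitrary end of the diagonal. *)
Definition newc (i : nat) : 'I_3 :=
  if i == 0%N then exit w 0 else entry w i - 1.

Definition oldc (i : nat) : 'I_3 :=
  if i == n then entry w n else exit w i - 1.

(* The corner of triangle i identified with corner k of triangle i + 1 by
   glueing; opposite corners are mapped to each other. *)
Definition cross (i : nat) (k : 'I_3) : 'I_3 :=
  entry w i.+1 + exit w i + 1 - k.

Definition nonreturning : Prop :=
  (0 < n)%N /\ forall i, (0 < i < n)%N -> entry w i != exit w i.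

(* Exactly one end of the diagonal between triangles i and i + 1 is matched by
   the angles of triangles 0, ..., i: the end newc i if and only if q i = newc i.
   The angle q (i + 1) equals oldc (i + 1) if and only if the latter is the
   unmatched end. *)
Definition local_matching (q : nat -> 'I_3) : bool :=
  [&& q 0%N != oldc 0, q n != newc n &
    [forall i : 'I_n, (q i.+1 == oldc i.+1) ==
       ((cross i (oldc i.+1) == newc i) (+) (q i == newc i))]].

Hypothesis w_ok : nonreturning.

Lemma len_gt0 : (0 < n)%N. Proof. by case: w_ok. Qed.

Lemma oldcE i : (i < n)%N -> oldc i = exit w i - 1.
Proof. by rewrite /oldc => lt; rewrite ltn_eqF. Qed.

Lemma newcE i : newc i.+1 = entry w i.+1 - 1.
Proof. by []. Qed.

(** Between the ends, the two corners are opposite to different sides because the strip does not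
    return. In triangles 0 and n one of them is the end of the arc and the other was chosen on the
    diagonal. *)
Lemma oldc_newc i : (i <= n)%N -> oldc i != newc i.
Proof.
have [n0 nr] := w_ok.
case: i => [|i] le; first by rewrite oldcE // /newc /=; move: (exit w 0); I3.
rewrite newcE; have [lt|ge] := ltnP i.+1 n.
  by rewrite oldcE //; move: (nr i.+1 lt); move: (entry _ _) (exit _ _); I3.
have -> : i.+1 = n by lia.
by rewrite /oldc eqxx; move: (entry _ _); I3.
Qed.

Definition tile_corner : finType := ('I_n * bool * 'I_3)%type.

(* Every vertex of the snake graph other than the two extremal ones is an end
   of the diagonal of exactly one tile; its label (i, k) says that it is corner
   k of triangle i in tile i. *)
Definition tile_label (x : tile_corner) : nat * 'I_3 :=
  let: (i, b, k) := x in
  if b then (if k == newc i.+1 then (i.+1, k) else (i : nat, cross i k))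
  else (if (0 < i)%N && (k == oldc i) then (i.-1, cross i.-1 k)
        else (i : nat, k)).

Definition tile_rel (y z : tile_corner) : bool :=
  [|| same_tile_vertex y z, glued_tile_vertex y z | glued_tile_vertex z y].

Lemma tile_rel_sym : symmetric tile_rel.
Proof.
move=> x y; rewrite /tile_rel; congr (_ || _); last exact: orbC.
case: x y => [[i b] k] [[j c] l] /=; rewrite eq_sym.
have [->|] //= := eqVneq j i; case: b; case: c => //=;
by rewrite orbC [X in X || _]andbC [X in _ || X]andbC.
Qed.

Lemma tile_rel_label (x y : tile_corner) :
  tile_rel x y -> tile_label x = tile_label y.
Proof.
have same (i : 'I_n) k l :
    same_tile_vertex (i, false, k) (i, true, l) ->
    tile_label (i, false, k) = tile_label (i, true, l).
  rewrite /same_tile_vertex /tile_label /tile_diagonal eqxx oldcE // newcE /=.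
  rewrite /cross => h; rewrite !ifF.
  - by congr pair; apply/eqP; move: h; move: (exit _ _) (entry _ _); I3.
  - by move: h; move: (exit _ _) (entry _ _); I3.
  - by move: h; case: (0 < i)%N => //; move: (exit _ _) (entry _ _); I3.
have glued u v : glued_tile_vertex u v -> tile_label u = tile_label v.
  case: u v => [[i b] k] [[j c] l] /=.
  case/and5P=> /eqP ij -> /negPf-> /eqP <- /existsP[s]; rewrite ij /= => h.
  have lt : (i.+1 < n)%N by rewrite -ij.
  have := w_ok.2 i.+1 lt; move: h.
  rewrite /tile_diagonal oldcE ?newcE // /cross /= => h1 h2.
  case: ifP => h3.
    by rewrite ifF //=; move: h2 h3; move: (exit _ _) (entry _ _); clear; I3.
  by rewrite ifT //; move: h1 h2 h3; move: (exit _ _) (entry _ _); clear; I3.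
case/or3P=> [h|/glued ->|/glued ->] //.
case: x y h => [[i b] k] [[j c] l] h.
have [eij ecb] : i = j /\ c = ~~ b by case/and3P: (h) => /eqP-> /eqP->.
subst j c; case: b h => h; last exact: same.
apply/esym/same; move: h => /=; rewrite !eqxx /=.
by rewrite orbC [X in X || _]andbC [X in _ || X]andbC.
Qed.

Lemma tile_vertexP (x y : tile_corner) :
  (y \in tile_vertex x) = (tile_label x == tile_label y).
Proof.
rewrite inE; change (connect tile_rel x y = (tile_label x == tile_label y)).
apply/idP/eqP; first exact: (connect_invariant tile_rel_label).
pose canonical (z : tile_corner) :=
  (tile_label z == (z.1.1 + z.1.2, z.2)%N) && (z.1.2 ==> (z.1.1.+1 == n)).
have canon z : exists2 t, connect tile_rel z t & canonical t.
  have nl i : (i < n)%N -> newc i.+1 != oldc i.+1.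
    by rewrite eq_sym; apply: oldc_newc.
  have left (i : 'I_n) k :
      (i == 0%N :> nat) || (k != oldc i) -> canonical (i, false, k).
    rewrite /canonical /= addn0 andbT; case: ltnP => //= i0.
    by rewrite eqn0Ngt i0 /= => /negPf->.
  have right (i : 'I_n) k : k != newc i.+1 ->
     exists2 t, connect tile_rel (i, true, k) t & canonical t.
    move=> hk; exists (i, false, cross i k); last first.
      apply: left; rewrite oldcE // orbC; apply/orP; left.
      by move: hk; rewrite newcE /cross; move: (exit _ _) (entry _ _); I3.
    apply: connect1; rewrite /tile_rel /= eqxx /= /cross.
    by move: hk; rewrite newcE; move: (exit _ _) (entry _ _); I3.
  have third (a b k : 'I_3) : a != b -> (k == a - 1) || (k == b - 1) ->
     exists s, [&& s != a, s != b & (k == s) || (k == s + 1)].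
    (* The three residues add up to 0, so this is the side different from a and b. *)
    move=> h1 h2; exists (- a - b); move: h1 h2; clear; I3.
  case: z => [[i [] k]].
    have [hk|] := eqVneq k (newc i.+1); last exact: right.
    have [lt|ge] := ltnP i.+1 n; last first.
      exists (i, true, k); first exact: connect0.
      by rewrite /canonical /= hk eqxx addn1 eqxx /= eqn_leq ge ltn_ord.
    exists (Ordinal lt, false, k).
      apply: connect1; apply/or3P; apply: Or32; rewrite /= !eqxx /=.
      apply/existsP; apply: third.
        exact: (w_ok.2 i.+1).
      by rewrite hk newcE eqxx.
    by apply: left; rewrite hk /= nl.
  case: (boolP ((i == 0%N :> nat) || (k != oldc i))) => [h|].
    by exists (i, false, k); [exact: connect0 | exact: left].
  rewrite negb_or negbK => /andP[i0 /eqP hk].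
  have lt : (i.-1 < n)%N by case: i {hk i0} => i /=; lia.
  have ie : (Ordinal lt).+1 = i by rewrite /=; lia.
  have [|t ht ct] := right (Ordinal lt) k.
    by rewrite ie hk; apply: oldc_newc; rewrite ltnW.
  exists t => //; apply: connect_trans ht; apply: connect1.
  apply/or3P; apply: Or33; rewrite /glued_tile_vertex ie !eqxx /=.
  apply/existsP; apply: third.
    by rewrite ie; apply: w_ok.2; rewrite lt0n i0 /=.
  by rewrite hk oldcE // eqxx orbT.
move=> xy; have [s xs cs] := canon x; have [t yt ct] := canon y.
suff st : s = t.
  by apply: connect_trans xs _; rewrite st (sym_connect_sym tile_rel_sym).
have := connect_invariant tile_rel_label xs.
rewrite xy (connect_invariant tile_rel_label yt).
case/andP: cs ct => /eqP -> hb /andP[/eqP -> hc].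
case: s t hb hc {xs yt} => [[i b] k] [[j c] l] /= hb hc [h1 ->].
move: hb hc h1; case: b; case: c => /=; rewrite ?addn0 ?addn1.
- by move=> _ _ [/val_inj->].
- by move=> /eqP e _ h; move: (ltn_ord j); lia.
- by move=> _ /eqP e h; move: (ltn_ord i); lia.
- by move=> _ _ /val_inj->.
Qed.

Lemma crossK i : involutive (cross i).
Proof. by move=> k; rewrite /cross subKr. Qed.

Lemma cross_newc_old i k : (i < n)%N ->
  (cross i k == oldc i) = (k == newc i.+1).
Proof.
move=> lt; rewrite oldcE // newcE /cross.
by move: (entry _ _) (exit _ _); clear; I3.
Qed.

(** A side is missing from the graph when it is the diagonal of every tile containing its triangle.
    An inner triangle lies in two tiles with different diagonals and loses nothing; triangles 0 and
    n lie in one tile each and lose the side opposite to the end of the arc. *)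
Lemma snake_edgeE (e : 'I_n.+1 * 'I_3) : (e \in edges (snake_graph w)) =
  ~~ ((e.1 == 0%N :> nat) && (e.2 == oldc 0 + 1)) &&
  ~~ ((e.1 == n :> nat) && (e.2 == newc n + 1)).
Proof.
have n0 := len_gt0; case: e => j s; rewrite inE /=.
have newn : newc n + 1 = entry w n.
  by rewrite /newc eqn0Ngt n0 /= subrK.
have old0 : oldc 0 + 1 = exit w 0 by rewrite oldcE // subrK.
rewrite newn old0; apply/existsP/idP.
  case=> i /existsP[b]; rewrite /side_in_tile /= => /andP[/eqP ->].
  rewrite /tile_diagonal; case: b; rewrite ?addn1 ?addn0 /= => sd.
    by apply/negP => /andP[/eqP <-]; apply/negP.
  rewrite [_ == n]ltn_eqF // andbT.
  by apply/negP => /andP[/eqP e0]; apply/negP; move: sd; rewrite e0.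
case/andP=> h0 hn.
have left (jn : (j < n)%N) : s != exit w j ->
    exists i, [exists b, side_in_tile (j, s) i b].
  move=> h; exists (Ordinal jn); apply/existsP; exists false.
  by rewrite /side_in_tile /= addn0 eqxx.
have right : (0 < j)%N -> s != entry w j ->
    exists i, [exists b, side_in_tile (j, s) i b].
  case: j {h0 hn left} => [[|j] lt] //= _ h.
  have lt' : (j < n)%N by [].
  exists (Ordinal lt'); apply/existsP; exists true.
  by rewrite /side_in_tile /= addn1 eqxx.
have [jn|jn] := ltnP j n.
  have [j0|j0] := posnP j; first by apply: left => //; move: h0; rewrite j0.
  have [e|] := eqVneq s (exit w j); last exact: left.
  by apply: right => //; rewrite e eq_sym; apply: w_ok.2; rewrite j0.
have e : j = n :> nat by move: (ltn_ord j); lia.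
by apply: right; [rewrite e | move: hn; rewrite e eqxx].
Qed.

(* Side k + 1 of a triangle is opposite to corner k. *)
Definition opposite_sides (q : nat -> 'I_3) : {set 'I_n.+1 * 'I_3} :=
  [set e : 'I_n.+1 * 'I_3 | e.2 == q e.1 + 1].

(** The formula of [tile_label] without bounds on the tile, so that tiles [e.1] and [e.1.-1] can be
    mentioned before they are known to exist. *)
Definition nat_tile_label (i : nat) (b : bool) (k : 'I_3) : nat * 'I_3 :=
  if b then (if k == newc i.+1 then (i.+1, k) else (i, cross i k))
  else (if (0 < i)%N && (k == oldc i) then (i.-1, cross i.-1 k) else (i, k)).

(** Triangle [e.1] is the first triangle of tile [e.1] and the second one of the tile before it; in
    each of them the side is an edge unless it is the diagonal. *)
Lemma incident_label (e : 'I_n.+1 * 'I_3) (x : tile_corner) :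
  let l := tile_label x in
  incident (g := snake_graph w) e (tile_vertex x) =
  [|| [&& (e.1 < n)%N, e.2 != exit w e.1 &
        (nat_tile_label e.1 false e.2 == l)
        || (nat_tile_label e.1 false (e.2 + 1) == l)]
    | [&& (0 < e.1)%N, e.2 != entry w e.1 &
        (nat_tile_label e.1.-1 true e.2 == l)
        || (nat_tile_label e.1.-1 true (e.2 + 1) == l)]].
Proof.
case: e => j s l /=.
have lE y : (y \in tile_vertex x) = (nat_tile_label y.1.1 y.1.2 y.2 == l).
  by rewrite tile_vertexP eq_sym; case: y => [[i b] k].
apply/existsP/idP => /=.
  case=> i /existsP[b] /andP[/andP[/= /eqP -> sd]]; rewrite !lE /=.
  case: b sd => /= sd; rewrite ?addn1 ?addn0 => ->; last by rewrite ltn_ord sd.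
  by rewrite sd /= orbT.
case/orP.
  case/and3P=> jn sd h; exists (Ordinal jn); apply/existsP; exists false.
  by rewrite /side_in_tile /= !lE addn0 eqxx sd.
case: j => [[|j] lt] //= /andP[sd h].
have lt' : (j < n)%N by [].
exists (Ordinal lt'); apply/existsP; exists true.
by rewrite /side_in_tile /= !lE addn1 eqxx sd.
Qed.

(** The start of the arc occurs only in triangle 0, opposite to the exit side. All edges of the
    graph in that triangle are other sides and hence contain it. The last triangle is similar. *)
Lemma incident_start (e : 'I_n.+1 * 'I_3) (x : tile_corner) :
  e \in edges (snake_graph w) -> tile_label x = (0%N, oldc 0) ->
  incident (g := snake_graph w) e (tile_vertex x) = (e.1 == 0%N :> nat).
Proof.
have n0 := len_gt0.
move=> he xl; move: he; rewrite snake_edgeE incident_label xl.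
case: e => [[j lt] s] /=; case: j lt => [|j] lt /=.
  rewrite n0 /nat_tile_label oldcE //= orbF => /andP[h _].
  by move: h; rewrite !xpair_eqE /=; move: (exit _ _); clear; I3.
move=> _; rewrite /nat_tile_label /=; apply/negbTE.
have aux k : (k != newc j.+1) -> ((j, cross j k) == (0%N, oldc 0)) = false.
  move=> h; apply/negP; rewrite xpair_eqE => /andP[/eqP j0].
  by apply/negP; move: h; rewrite j0 -cross_newc_old.
have aux2 k : ((if k == oldc j.+1 then (j, cross j k) else (j.+1, k))
      == (0%N, oldc 0)) = false.
  case: ifP => // /eqP ->; apply: aux; exact: oldc_newc.
have aux3 k : ((if k == newc j.+1 then (j.+1, k) else (j, cross j k))
      == (0%N, oldc 0)) = false.
  by case: ifP => // /negbT; exact: aux.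
by rewrite !aux2 !aux3 !andbF.
Qed.

Lemma incident_stop (e : 'I_n.+1 * 'I_3) (x : tile_corner) :
  e \in edges (snake_graph w) -> tile_label x = (n, newc n) ->
  incident (g := snake_graph w) e (tile_vertex x) = (e.1 == n :> nat).
Proof.
have n0 := len_gt0.
move=> he xl; move: he; rewrite snake_edgeE incident_label xl.
case: e => [[j lt] s] /=; have [jn|jn] := ltnP j n.
  rewrite (ltn_eqF jn) /= andbT => _; apply/negbTE.
  have aux k : (nat_tile_label j false k == (n, newc n)) = false.
    rewrite /nat_tile_label; case: ifP => _; rewrite xpair_eqE.
      by rewrite (_ : _ == n = false) //; lia.
    by rewrite ltn_eqF.
  rewrite !aux andbF /=; case: j lt jn {aux} => //= j lt jn.
  have aux k : (nat_tile_label j true k == (n, newc n)) = false.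
    rewrite /nat_tile_label; case: ifP => _; rewrite xpair_eqE.
      by rewrite ltn_eqF.
    by rewrite (_ : _ == n = false) //; lia.
  by rewrite !aux andbF.
have jE : j = n by lia.
subst j; rewrite eqxx n0 /= => /andP[_].
have -> : n = n.-1.+1 by lia.
rewrite /nat_tile_label newcE /= => h.
have aux k : ((if k == entry w n.-1.+1 - 1 then (n.-1.+1, k)
    else (n.-1, cross n.-1 k)) == (n.-1.+1, entry w n.-1.+1 - 1)) =
    (k == entry w n.-1.+1 - 1).
  case: ifP => [/eqP ->|]; first by rewrite eqxx.
  by rewrite xpair_eqE => _; rewrite (_ : _ == _ = false) //; lia.
rewrite !aux; move: h; move: (entry _ _); clear; I3.
Qed.

(** For i > 0 the corner [newc i] lies on the side common to tiles i - 1 and i, hence meets every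
    side of triangle i but its opposite. The third corner of triangle i, as a vertex of tile i, is
    not identified with its copy in tile i - 1, and there only the side opposite to [newc i]
    contains it. The exclusive or covers both cases; in triangle i + 1 the old corner takes the part
    of the new one. *)
Lemma incident_end (e : 'I_n.+1 * 'I_3) (x : tile_corner) i k :
  e \in edges (snake_graph w) -> tile_label x = (i, k) ->
  (i < n)%N -> k != oldc i ->
  incident (g := snake_graph w) e (tile_vertex x) =
  ((e.1 == i :> nat) && ((k == newc i) (+) (e.2 == newc i + 1))) ||
  ((e.1 == i.+1 :> nat) &&
     ((cross i k == oldc i.+1) (+) (e.2 == oldc i.+1 + 1))).
Proof.
have n0 := len_gt0.
move=> he xl lt ko; move: he; rewrite snake_edgeE incident_label xl.
case: e => [[j ltj] s] /=; rewrite ltnS in ltj.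
have [ji|nji] := eqVneq j i.
  subst j; rewrite lt (ltn_eqF (ltnSn i)) orbF (ltn_eqF lt) /= andbT.
  have aux k' : (nat_tile_label i false k' == (i, k)) = (k' == k).
    rewrite /nat_tile_label; case: ifP => [/andP[i0 /eqP ->]|_].
      rewrite xpair_eqE (_ : _ == _ = false); last by lia.
      by rewrite [RHS]eq_sym (negPf ko).
    by rewrite xpair_eqE eqxx.
  rewrite !aux; case: i lt ko {xl aux ltj} => [|i] lt ko.
    rewrite /= orbF => h; move: ko h; rewrite oldcE // /newc /=.
    by move: (exit _ _); clear; I3.
  have aux k' : (nat_tile_label i true k' == (i.+1, k)) =
      (k' == newc i.+1) && (k' == k).
    rewrite /nat_tile_label; case: ifP => _; rewrite xpair_eqE ?eqxx //.
    by rewrite (ltn_eqF (ltnSn i)).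
  move=> _; rewrite /= !aux newcE; move: ko; rewrite oldcE //.
  move: (w_ok.2 i.+1 lt).
  by move: (exit _ _) (entry _ _); clear; I3.
have [ji|nji'] := eqVneq j i.+1; last first.
  move=> _ /=.
  apply/negbTE; rewrite negb_or; apply/andP; split.
    have aux k' : (nat_tile_label j false k' == (i, k)) = false.
      rewrite /nat_tile_label; case: ifP => [/andP[j0 _]|_]; rewrite xpair_eqE.
        by rewrite (_ : _ == _ = false) //; lia.
      by rewrite (negPf nji).
    by rewrite !aux !andbF.
  case: j ltj nji nji' => //= j ltj nji nji'.
  have aux k' : (nat_tile_label j true k' == (i, k)) = false.
    rewrite /nat_tile_label; case: ifP => _; rewrite xpair_eqE.
      by rewrite (negPf nji).
    by rewrite (_ : _ == _ = false) //; lia.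
  by rewrite !aux !andbF.
subst j; rewrite /=.
have aux k' : (nat_tile_label i true k' == (i, k)) =
    (k' != newc i.+1) && (k' == cross i k).
  rewrite /nat_tile_label; case: ifP => _; rewrite xpair_eqE.
    by rewrite (gtn_eqF (ltnSn i)).
  by rewrite eqxx /= (can2_eq (crossK i) (crossK i)).
have aux2 k' : (nat_tile_label i.+1 false k' == (i, k)) =
    (k' == oldc i.+1) && (k' == cross i k).
  rewrite /nat_tile_label /=; case: ifP => _; rewrite xpair_eqE.
    by rewrite eqxx /= (can2_eq (crossK i) (crossK i)).
  by rewrite (gtn_eqF (ltnSn i)).
rewrite !aux !aux2.
have {ko} : cross i k != newc i.+1 by rewrite -cross_newc_old // crossK.
move: (cross i k) => c.
have [lt'|ge] := ltnP i.+1 n.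
  rewrite (ltn_eqF lt') => hc _; move: hc; rewrite oldcE // newcE.
  move: (w_ok.2 i.+1 lt').
  by move: (exit _ _) (entry _ _); clear; I3.
have e : i.+1 = n by lia.
have oE : oldc i.+1 = entry w i.+1 by rewrite /oldc e eqxx.
rewrite -e eqxx /= newcE oE.
by move: (entry _ _); clear; I3.
Qed.

Lemma card_row (P : {set 'I_n.+1 * 'I_3}) (i : nat) (f : pred 'I_3) : (i <= n)%N ->
  #|[set e in P | (e.1 == i :> nat) && f e.2]| =
  (\sum_(s : 'I_3) (((inord i, s) \in P) && f s))%N.
Proof.
move=> le; transitivity (\sum_(j : 'I_n.+1) \sum_(s : 'I_3)
    ((j, s) \in [set e in P | (e.1 == i :> nat) && f e.2] : nat))%N.
  rewrite pair_bigA -sum1_card big_mkcond /=.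
  by apply: eq_bigr => -[j s] _ /=; case: (_ \in _).
rewrite (bigD1 (inord i)) //= [X in (_ + X)%N]big1 ?addn0 => [|j ji].
  by apply: eq_bigr => s _; rewrite inE /= inordK // eqxx.
apply: big1 => s _; rewrite inE /= (_ : (_ == i) = false) ?andbF //.
by apply: contraNF ji => /eqP ji; rewrite -ji inord_val.
Qed.

Lemma sum_xor (X : pred 'I_3) (b : bool) (t : 'I_3) :
  (\sum_(s : 'I_3) (X s && (b (+) (s == t)) : nat) =
   if b then (\sum_(s : 'I_3) (X s : nat)) - X t else X t)%N.
Proof.
rewrite (bigD1 t) //= eqxx addbT; case: b => /=.
  rewrite andbF add0n [in RHS](bigD1 t) //= addKn.
  by apply: eq_bigr => s /negPf ->; rewrite andbT.
by rewrite andbT big1 ?addn0 // => s /negPf ->; rewrite andbF.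
Qed.

Lemma card_end (P : {set 'I_n.+1 * 'I_3}) (x : tile_corner) i k :
  P \subset edges (snake_graph w) -> tile_label x = (i, k) ->
  (i < n)%N -> k != oldc i ->
  let X j s := (inord j, s) \in P : bool in
  #|[set e in P | incident (g := snake_graph w) e (tile_vertex x)]| =
  ((if k == newc i then (\sum_s (X i s : nat)) - X i (newc i + 1)%R
    else X i (newc i + 1)%R) +
   (if cross i k == oldc i.+1 then (\sum_s (X i.+1 s : nat)) - X i.+1 (oldc i.+1 + 1)%R
    else X i.+1 (oldc i.+1 + 1)%R))%N.
Proof.
move=> sP xl lt ko X.
rewrite -(sum_xor (X i) (k == newc i)) -(sum_xor (X i.+1) (cross i k == oldc i.+1)).
rewrite -(@card_row P i (fun s => _ (+) _)) ?(ltnW lt) //.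
rewrite -(@card_row P i.+1 (fun s => _ (+) _)) //.
rewrite -cardsUI (_ : _ :&: _ = set0) ?cards0 ?addn0.
  apply: eq_card => e; rewrite !inE -andb_orr.
  have [eP|//] := boolP (e \in P).
  by rewrite (incident_end (subsetP sP _ eP) xl).
apply/setP => e; rewrite !inE.
have [->|] := eqVneq (e.1 : nat) i; last by rewrite andbF.
by rewrite (ltn_eqF (ltnSn i)) /= !andbF.
Qed.

Lemma card_start (P : {set 'I_n.+1 * 'I_3}) (x : tile_corner) :
  P \subset edges (snake_graph w) -> tile_label x = (0%N, oldc 0) ->
  #|[set e in P | incident (g := snake_graph w) e (tile_vertex x)]| =
  (\sum_s ((inord 0, s) \in P))%N.
Proof.
move=> sP xl; transitivity #|[set e in P | (e.1 == 0%N :> nat) && predT e.2]|.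
  apply: eq_card => e; rewrite !inE andbT; have [eP|//] := boolP (e \in P).
  by rewrite (incident_start (subsetP sP _ eP) xl).
by rewrite card_row //; apply: eq_bigr => s _; rewrite andbT.
Qed.

Lemma card_stop (P : {set 'I_n.+1 * 'I_3}) (x : tile_corner) :
  P \subset edges (snake_graph w) -> tile_label x = (n, newc n) ->
  #|[set e in P | incident (g := snake_graph w) e (tile_vertex x)]| =
  (\sum_s ((inord n, s) \in P))%N.
Proof.
move=> sP xl; transitivity #|[set e in P | (e.1 == n :> nat) && predT e.2]|.
  apply: eq_card => e; rewrite !inE andbT; have [eP|//] := boolP (e \in P).
  by rewrite (incident_stop (subsetP sP _ eP) xl).
by rewrite card_row //; apply: eq_bigr => s _; rewrite andbT.
Qed.

Lemma tile_label_cases (x : tile_corner) :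
  [\/ tile_label x = (0%N, oldc 0), tile_label x = (n, newc n)
    | exists i k, [/\ tile_label x = (i, k), (i < n)%N & k != oldc i]].
Proof.
have n0 := len_gt0.
have cr i k : (i < n)%N -> k != newc i.+1 -> cross i k != oldc i.
  by move=> lt; rewrite cross_newc_old.
case: x => [[i [] k]] /=.
  have lt := ltn_ord i.
  case: ifP => [/eqP ->|h]; last first.
    by apply: Or33; exists i, (cross i k); split => //; apply: cr; rewrite ?h.
  have [lt'|ge] := ltnP i.+1 n.
    apply: Or33; exists i.+1, (newc i.+1); split => //.
    by rewrite eq_sym; apply: oldc_newc.
  have -> : i.+1 = n by lia.
  exact: Or32.
have lt := ltn_ord i; case: ifP => [/andP[i0 /eqP ->]|h].
  apply: Or33; exists i.-1, (cross i.-1 (oldc i)); split => //; first by lia.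
  apply: cr; first by lia.
  by rewrite prednK //; apply: oldc_newc; rewrite ltnW.
have [ko|ko] := eqVneq k (oldc i); last by apply: Or33; exists i, k.
have [i0|i0] := posnP i; last by rewrite i0 ko eqxx in h.
by apply: Or31; rewrite ko i0.
Qed.

Lemma local_matchingP (q : nat -> 'I_3) :
  reflect [/\ q 0%N != oldc 0, q n != newc n &
    forall i, (i < n)%N -> (q i.+1 == oldc i.+1) =
       ((cross i (oldc i.+1) == newc i) (+) (q i == newc i))]
  (local_matching q).
Proof.
apply: (iffP and3P) => [] [h0 hn hi]; split => //.
  by move=> i lt; have /eqP := forallP hi (Ordinal lt).
by apply/forallP => i; apply/eqP; exact: hi.
Qed.

Lemma cross_newc i : (i < n)%N ->
  (cross i (newc i) == oldc i.+1) = (cross i (oldc i.+1) == newc i).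
Proof. by move=> lt; rewrite (can2_eq (crossK i) (crossK i)) eq_sym. Qed.

Lemma perfect_matching_opposite_sides (q : nat -> 'I_3) :
  local_matching q ->
  perfect_matching (G := snake_graph w) (opposite_sides q).
Proof.
have n0 := len_gt0.
move=> /local_matchingP[q0 qn ql].
have sP : opposite_sides q \subset edges (snake_graph w).
  apply/subsetP => e; rewrite inE snake_edgeE => /eqP ->.
  rewrite !(inj_eq (addIr _)); apply/andP; split.
    by apply/negP => /andP[/eqP -> /eqP]; exact/eqP.
  by apply/negP => /andP[/eqP -> /eqP]; exact/eqP.
have XE j s : (j <= n)%N -> ((inord j, s) \in opposite_sides q) = (s == q j + 1).
  by move=> le; rewrite inE /= inordK.
have sumX j : (j <= n)%N ->
    (\sum_(s : 'I_3) ((inord j, s) \in opposite_sides q : nat) = 1)%N.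
  move=> le; rewrite (bigD1 (q j + 1)) //= XE // eqxx big1 // => s h.
  by rewrite XE // (negPf h).
rewrite /perfect_matching sP /=; apply/forall_inP => v /imsetP[x _ ->].
apply/eqP; case: (tile_label_cases x) => [xl|xl|[i [k [xl lt ko]]]].
- by rewrite (card_start sP xl) sumX.
- by rewrite (card_stop sP xl) sumX.
rewrite (card_end sP xl) // !sumX ?(ltnW lt) // !XE ?(ltnW lt) //.
rewrite !(inj_eq (addIr _)) [_ == q i]eq_sym [_ == q i.+1]eq_sym ql //.
rewrite -cross_newc //.
have [->|kn] := eqVneq k (newc i); first by case: (cross _ _ == _); case: (q i == _).
(* Here k and [newc i] are the two ends of the diagonal, and exactly one of them is the old corner
   of the next triangle. *)
have -> : (cross i k == oldc i.+1) = ~~ (cross i (newc i) == oldc i.+1).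
  move: kn ko; have [h1 h2] : oldc i != newc i /\ oldc i.+1 != newc i.+1.
    by split; apply: oldc_newc; rewrite // ltnW.
  move: h1 h2; rewrite newcE oldcE // /cross.
  by move: (oldc _) (newc _) (entry _ _) (exit _ _); clear; I3.
by case: (cross _ _ == _); case: (q i == _).
Qed.

(** Adding the equations at the two ends of diagonal i shows that triangles i and i + 1 together
    carry two edges of P. Triangle 0 carries one, by the equation at the start of the arc; so every
    triangle carries exactly one, and q selects the corner opposite to it. *)
Lemma perfect_matching_local (P : {set gedge (snake_graph w)}) :
  perfect_matching P ->
  exists2 q, local_matching q & P = opposite_sides q.
Proof.
have n0 := len_gt0.
move=> /andP[sP /forall_inP cP].
have cardv (x : tile_corner) :
    #|[set e in P | incident (g := snake_graph w) e (tile_vertex x)]| = 1%N.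
  by apply/eqP/cP/imset_f; rewrite inE.
pose X j (s : 'I_3) : bool := (inord j, s) \in P.
have X0 : X 0%N (oldc 0 + 1) = false.
  apply/negP => /(subsetP sP); rewrite snake_edgeE /= inordK // !eqxx.
  by [].
have Xn : X n (newc n + 1) = false.
  apply/negP => /(subsetP sP); rewrite snake_edgeE /= inordK // !eqxx.
  by rewrite andbF.
have sum0 : (\sum_s (X 0%N s : nat) = 1)%N.
  by rewrite -(@card_start P (Ordinal n0, false, oldc 0)).
have ends i (k : 'I_3) (lt : (i < n)%N) : k != oldc i ->
  ((if k == newc i then (\sum_s (X i s : nat)) - X i (newc i + 1)%R
    else X i (newc i + 1)%R) +
   (if cross i k == oldc i.+1 then (\sum_s (X i.+1 s : nat)) - X i.+1 (oldc i.+1 + 1)%R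
    else X i.+1 (oldc i.+1 + 1)%R) = 1)%N.
  move=> ko; rewrite -(@card_end P (Ordinal lt, false, k) i k) //.
  by rewrite /= (negPf ko) andbF.
have le_sum j s : ((X j s : nat) <= \sum_s (X j s : nat))%N.
  by rewrite [leqRHS](bigD1 s) //= leq_addr.
have third i : (i < n)%N -> exists k, [/\ k != oldc i, k != newc i &
   (cross i k == oldc i.+1) = ~~ (cross i (newc i) == oldc i.+1)].
  move=> lt; exists (- oldc i - newc i).
  have [h1 h2] : oldc i != newc i /\ oldc i.+1 != newc i.+1.
    by split; apply: oldc_newc; rewrite // ltnW.
  move: h1 h2; rewrite newcE oldcE // /cross.
  by move: (oldc _) (newc _) (entry _ _) (exit _ _); clear; I3.
have step i : (i < n)%N -> (\sum_s (X i s : nat) = 1)%N ->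
   (\sum_s (X i.+1 s : nat) = 1)%N /\
   X i.+1 (oldc i.+1 + 1) = ((cross i (oldc i.+1) == newc i) (+) X i (newc i + 1)).
  move=> lt s1; have [k [k1 k2 k3]] := third i lt.
  have := ends i k lt k1; have := ends i (newc i) lt.
  rewrite eq_sym oldc_newc ?(ltnW lt) // eqxx => /(_ isT).
  rewrite k3 (negPf k2) s1 cross_newc //.
  have := le_sum i.+1 (oldc i.+1 + 1).
  case: (cross _ _ == _) => /=; case: (X i _); case: (X i.+1 _) => /=; lia.
have sums i : (i <= n)%N -> (\sum_s (X i s : nat) = 1)%N.
  by elim: i => // i IH lt; case: (step i lt (IH (ltnW lt))).
have ex i : exists s, (i <= n)%N ==> X i s.
  have [le|] := leqP i n; last by exists 0.
  case: (pickP (X i)) => [s h|h]; first by exists s; rewrite h.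
  by have := sums i le; rewrite big1 // => s _; rewrite h.
(* The premise inside [ex] makes q defined for all i; subtracting 1 passes from a side to the
   opposite corner. *)
pose q i := xchoose (ex i) - 1.
have XE i s : (i <= n)%N -> X i s = (s == q i + 1).
  move=> le; rewrite /q subrK; have /implyP/(_ le) := xchooseP (ex i).
  move: (xchoose _) => t Xt; have [->//|st] := eqVneq s t.
  apply/negbTE/negP => Xs; have := sums i le.
  by rewrite (bigD1 t) //= (bigD1 s) //= Xt Xs.
exists q.
  apply/local_matchingP; split.
  - by have := X0; rewrite XE // (inj_eq (addIr _)) eq_sym => ->.
  - by have := Xn; rewrite XE // (inj_eq (addIr _)) eq_sym => ->.
  move=> i lt; have [_] := step i lt (sums i (ltnW lt)).
  by rewrite !XE ?(ltnW lt) // !(inj_eq (addIr _)) eq_sym [newc i == q i]eq_sym.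
apply/setP => -[j s]; rewrite inE /= -XE; last by rewrite -ltnS.
by rewrite /X inord_val.
Qed.

Lemma eq_local_matching (q q' : nat -> 'I_3) :
  (forall i, (i <= n)%N -> q i = q' i) -> local_matching q = local_matching q'.
Proof.
move=> e; rewrite /local_matching !e //; congr [&& _, _ & _].
by apply: eq_forallb => i; rewrite !e // ltnW.
Qed.

Lemma eq_opposite_sides (q q' : nat -> 'I_3) :
  opposite_sides q = opposite_sides q' <-> (forall i, (i <= n)%N -> q i = q' i).
Proof.
split => [/setP e i le|e]; last first.
  by apply/setP => x; rewrite !inE e // -ltnS.
have := e (inord i, q i + 1); rewrite !inE /= inordK // eqxx => /esym/eqP.
by move/addIr.
Qed.
End Strip.

(** * Strips hooked around a puncture *)

Section Reverse.
Variable w : strip.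
Hypothesis w_ok : nonreturning w.
Local Notation n := (len w).

Lemma newc_rev i : (i <= n)%N -> newc (rev_strip w) i = oldc w (n - i).
Proof.
have n0 := len_gt0 w_ok.
case: i => [|i] le; first by rewrite subn0 /newc /oldc /= eqxx subn0.
by rewrite newcE /= oldcE //; lia.
Qed.

Lemma oldc_rev i : (i <= n)%N -> oldc (rev_strip w) i = newc w (n - i).
Proof.
rewrite /oldc /= => le; case: eqP => [->|ne]; first by rewrite !subnn.
by rewrite /newc /= (_ : (n - i == 0)%N = false) //; lia.
Qed.

Lemma cross_rev i k : (i < n)%N ->
  cross (rev_strip w) i k = cross w (n - i.+1) k.
Proof.
rewrite /cross /= => lt; rewrite [X in X + 1]addrC.
by rewrite (_ : (n - i = (n - i.+1).+1)%N) //; lia.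
Qed.

Lemma nonreturning_rev : nonreturning (rev_strip w).
Proof.
split; first exact: len_gt0 w_ok.
by move=> i /= h; rewrite eq_sym; apply: w_ok.2; lia.
Qed.

(** Reversal exchanges [newc] and [oldc], and the rule across a diagonal, an equation with an
    exclusive or, is symmetric in the two adjacent triangles. *)
Lemma local_matching_rev q :
  local_matching (rev_strip w) (fun i => q (n - i)%N) = local_matching w q.
Proof.
have n0 := len_gt0 w_ok.
have revE i : (i < n)%N ->
   ((q (n - i.+1)%N == oldc (rev_strip w) i.+1) =
     (cross (rev_strip w) i (oldc (rev_strip w) i.+1) == newc (rev_strip w) i) (+)
     (q (n - i)%N == newc (rev_strip w) i)) <->
   (q (n - i.+1).+1 == oldc w (n - i.+1).+1) =
     (cross w (n - i.+1) (oldc w (n - i.+1).+1) == newc w (n - i.+1)) (+)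
     (q (n - i.+1)%N == newc w (n - i.+1)).
  move=> lt; rewrite oldc_rev // newc_rev ?(ltnW lt) // cross_rev //.
  have -> : (n - i = (n - i.+1).+1)%N by lia.
  rewrite cross_newc //; last by lia.
  by do 3 case: (_ == _); split.
apply/local_matchingP/local_matchingP => /= -[h0 hn hi]; split.
- by move: hn; rewrite newc_rev // subnn.
- by move: h0; rewrite oldc_rev // subn0.
- move=> i lt; have ni : (n - i.+1 < n)%N by lia.
  have := (revE _ ni).1 (hi _ ni).
  by rewrite (_ : (n - (n - i.+1).+1 = i)%N) //; lia.
- by rewrite oldc_rev // subn0.
- by rewrite newc_rev // subnn.
by move=> i lt; apply/(revE _ lt)/hi; lia.
Qed.
End Reverse.

(* The matchings of the triangles of a fan, cut open along one diagonal: m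
   triangles with a common apex, where the value 0 stands for the angle at the
   apex, 1 and -1 for the angles on the preceding and on the following
   diagonal. *)
Definition fan_matching (m : nat) (f : nat -> 'I_3) : bool :=
  [&& f 0%N != 1, f m.-1 != -1 &
    [forall i : 'I_m.-1, (f i.+1 == 1) == (f i != -1)]].

Lemma fan_matchingP m (f : nat -> 'I_3) :
  reflect [/\ f 0%N != 1, f m.-1 != -1 &
    forall i, (i < m.-1)%N -> (f i.+1 == 1) = (f i != -1)]
  (fan_matching m f).
Proof.
apply: (iffP and3P) => [] [h0 hn hi]; split => //.
  by move=> i lt; have /eqP := forallP hi (Ordinal lt).
by apply/forallP => i; apply/eqP; exact: hi.
Qed.

Lemma eq_fan_matching m (f g : nat -> 'I_3) : (0 < m)%N ->
  (forall i, (i < m)%N -> f i = g i) -> fan_matching m f = fan_matching m g.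
Proof.
move=> m0 e; rewrite /fan_matching !e //; try lia.
congr [&& _, _ & _]; apply: eq_forallb => i; have := ltn_ord i => lt.
by rewrite !e //; lia.
Qed.

Definition fan_ok (w : strip) (v : fan) : Prop :=
  (1 < valency v)%N /\ apex v 0 = newc w (len w).

Section Hook.
Variables (w : strip) (v : fan).
Hypotheses (w_ok : nonreturning w) (v_ok : fan_ok w v).
Local Notation n := (len w).
Local Notation m := (valency v).
Local Notation w' := (hook_strip w v).
Local Notation N := (n + m + n)%N.

(* Triangle n + m of the hook strip is again a copy of triangle n. *)
Definition hook_apex (t : nat) : 'I_3 := apex v (if t == m then 0%N else t).

Let n0 : (0 < n)%N := len_gt0 w_ok.
Let m1 : (1 < m)%N := v_ok.1.

Lemma apex0E : apex v 0 = entry w n - 1.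
Proof. by rewrite v_ok.2 /newc eqn0Ngt n0. Qed.

Lemma oldc_apex : oldc w n = apex v 0 + 1.
Proof. by rewrite apex0E /oldc eqxx subrK. Qed.

(** This begins a dictionary for the hook strip. Triangles up to n are as in w; in the triangles
    [N - i] old and new corners are exchanged; in the fan they are the corners [apex + 1] and
    [apex - 1]. The exceptions are triangle n, whose new corner is the apex, and triangle n + m,
    whose old corner is the apex. *)
Lemma hook_newc i : (i <= n)%N -> newc w' i = newc w i.
Proof. by rewrite /newc /= => ->; rewrite n0. Qed.

Lemma hook_newc_fan t : (0 < t <= m)%N -> newc w' (n + t) = hook_apex t - 1.
Proof.
move=> ht; rewrite /newc /= /hook_apex.
rewrite ifF; last by lia.
rewrite ifF; last by lia.
rewrite ltn_add2l eqn_add2l addKn.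
by case: (ltngtP t m) ht => //; lia.
Qed.

Lemma hook_newc_back i : (i < n)%N -> newc w' (N - i) = oldc w i.
Proof.
move=> lt; rewrite oldcE // /newc /=.
rewrite ifF; last by lia.
rewrite ifF; last by lia.
rewrite ifF; last by lia.
rewrite ifF; last by lia.
by rewrite (_ : (N - (N - i) = i)%N) //; lia.
Qed.

Lemma hook_oldc i : (i <= n)%N -> oldc w' i = oldc w i.
Proof.
move=> le; rewrite oldcE /=; last by lia.
have [lt|ge] := ltnP i n; first by rewrite oldcE.
have -> : i = n by lia.
by rewrite ifT ?subnn ?oldc_apex; [apply/eqP; move: (apex v 0); clear; I3|lia].
Qed.

Lemma hook_oldc_fan t : (t < m)%N -> oldc w' (n + t) = hook_apex t + 1.
Proof.
move=> lt; rewrite oldcE /=; last by lia.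
rewrite ifF; last by lia.
rewrite ifT; last by lia.
rewrite /hook_apex (ltn_eqF lt) addKn.
by apply/eqP; move: (apex v t); clear; I3.
Qed.

Lemma hook_oldc_back i : (i <= n)%N -> oldc w' (N - i) = newc w i.
Proof.
move=> le; rewrite /oldc /=; case: eqP => e.
  have i0 : i = 0%N by lia.
  rewrite i0 /newc /= ifF; last by lia.
  rewrite ifF; last by lia.
  rewrite ifF; last by lia.
  by rewrite subnn.
rewrite ifF; last by lia.
rewrite ifF; last by lia.
rewrite /newc ifF; last by lia.
by rewrite (_ : (N - (N - i) = i)%N) //; lia.
Qed.

Lemma hook_cross i k : (i < n)%N -> cross w' i k = cross w i k.
Proof. by move=> lt; rewrite /cross /= lt. Qed.

Lemma hook_cross_fan t k : (t < m)%N ->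
  cross w' (n + t) k = hook_apex t.+1 + hook_apex t - k.
Proof.
move=> lt; rewrite /cross /= /hook_apex.
rewrite ifF; last by lia.
rewrite [X in _ + X + 1]ifF; last by lia.
rewrite [X in _ + X + 1]ifT; last by lia.
rewrite (ltn_eqF lt) addKn -addnS ltn_add2l eqn_add2l addKn addrA subrK.
by case: (ltngtP t.+1 m) lt => //; lia.
Qed.

Lemma hook_cross_back i k : (i < n)%N ->
  cross w' (N - i.+1) k = cross w i k.
Proof.
move=> lt; rewrite /cross /=.
rewrite ifF; last by lia.
rewrite ifF; last by lia.
rewrite ifF; last by lia.
rewrite [X in _ + X + 1]ifF; last by lia.
rewrite [X in _ + X + 1]ifF; last by lia.
rewrite (_ : (N - (N - i.+1).+1 = i)%N); last by lia.
rewrite (_ : (N - (N - i.+1) = i.+1)%N); last by lia.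
by rewrite [X in X + 1]addrC.
Qed.

Lemma nonreturning_hook : nonreturning w'.
Proof.
split=> /=; first by lia.
move=> i hi; have [lt|ge] := ltnP i n.
  by rewrite (ltnW lt); apply: w_ok.2; lia.
have [e|ne] := eqVneq i n.
  rewrite e leqnn subnn ifT; last by lia.
  by rewrite apex0E; move: (entry w n); clear; I3.
rewrite ifF; last by lia.
have [lt|ge'] := ltnP i (n + m).
  by move: (apex v _); clear; I3.
have [e|ne'] := eqVneq i (n + m)%N.
  rewrite (_ : (N - i = n)%N); last by lia.
  by rewrite apex0E; move: (entry w n); clear; I3.
by rewrite eq_sym; apply: w_ok.2; lia.
Qed.

Lemma hook_apexm : hook_apex m = apex v 0.
Proof. by rewrite /hook_apex eqxx. Qed.

Lemma hook_apex0 : hook_apex 0 = apex v 0.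
Proof. by rewrite /hook_apex; case: (_ == m). Qed.

Definition fan_offset (q : nat -> 'I_3) (t : nat) : 'I_3 :=
  q (n + t)%N - hook_apex t.

(** Away from triangles n, ..., n + m the rule repeats that of q. The five conditions belong to the
    last diagonal of w, to the first, middle and last diagonals of the fan, and to the last diagonal
    of w on the way back. The first and last fan diagonals are special because of the exceptional
    corners of triangles n and n + m. *)
Lemma hook_local_core q q' : local_matching w q ->
  (forall i, (i < n)%N -> q' i = q i) ->
  (forall i, (i < n)%N -> q' (N - i)%N = q i) ->
  let r := fan_offset q' in
  local_matching w' q' <->
  [/\ (r 0%N == 1) = (q n == oldc w n), (r 1%N == 1) = (r 0%N == 0),
      forall t, (0 < t < m.-1)%N -> (r t.+1 == 1) = (r t != -1),
      (r m == 0) = (r m.-1 == -1) & (r m == -1) = (q n != oldc w n)].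
Proof.
move=> /local_matchingP[q0 qn ql] qf qb r.
have e1 (a b : 'I_3) : (a - b == 1) = (a == b + 1) by clear; I3.
have e0 (a b : 'I_3) : (a - b == 0) = (a == b) by clear; I3.
have e2 (a b : 'I_3) : (a - b == -1) = (a == b - 1) by clear; I3.
have n1 : n = n.-1.+1 by lia_clear.
have ltn1 : (n.-1 < n)%N by lia_clear.
have qn1 := ql n.-1 ltn1; rewrite -n1 in qn1.
have first_fan : ((q' (n + 1)%N == oldc w' (n + 1)) =
    (cross w' (n + 0) (oldc w' (n + 1)) == newc w' (n + 0)) (+)
    (q' (n + 0)%N == newc w' (n + 0))) <-> (r 1%N == 1) = (r 0%N == 0).
  rewrite hook_oldc_fan // hook_cross_fan ?(ltnW m1) // [in newc _ _]addn0.
  rewrite hook_newc // -v_ok.2 hook_apex0 /r e1 e0 hook_apex0.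
  rewrite (_ : _ + _ - _ == _ = false) //.
  by move: (hook_apex 1) (apex v 0); clear; I3.
have mid_fan t : (0 < t < m.-1)%N -> ((q' (n + t.+1)%N == oldc w' (n + t.+1)) =
    (cross w' (n + t) (oldc w' (n + t.+1)) == newc w' (n + t)) (+)
    (q' (n + t)%N == newc w' (n + t))) <-> (r t.+1 == 1) = (r t != -1).
  move=> ht; rewrite hook_oldc_fan; last by lia_clear.
  rewrite hook_cross_fan; last by lia_clear.
  rewrite hook_newc_fan; last by lia_clear.
  rewrite /r /fan_offset e1 e2 (_ : _ + _ - _ == _) //.
  by move: (hook_apex _) (hook_apex _); clear; I3.
have last_fan : ((q' (n + m)%N == oldc w' (n + m)) =
    (cross w' (n + m.-1) (oldc w' (n + m)) == newc w' (n + m.-1)) (+)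
    (q' (n + m.-1)%N == newc w' (n + m.-1))) <-> (r m == 0) = (r m.-1 == -1).
  have -> : oldc w' (n + m) = apex v 0.
    by have := @hook_oldc_back n (leqnn n); rewrite addnK -v_ok.2.
  rewrite hook_cross_fan; last by lia_clear.
  rewrite hook_newc_fan; last by lia_clear.
  rewrite prednK ?(ltnW m1) // /r e0 e2 hook_apexm.
  rewrite (_ : _ + _ - _ == _ = false) //.
  by move: (hook_apex _) (apex v 0); clear; I3.
have first_back : ((q' (n + m).+1 == oldc w' (n + m).+1) =
    (cross w' (n + m) (oldc w' (n + m).+1) == newc w' (n + m)) (+)
    (q' (n + m)%N == newc w' (n + m))) <-> (r m == -1) = (q n != oldc w n).
  have -> : (n + m).+1 = (N - n.-1)%N by lia_clear.
  rewrite hook_oldc_back ?leq_pred // qb //.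
  have -> : cross w' (n + m) (newc w n.-1) = cross w n.-1 (newc w n.-1).
    by rewrite -hook_cross_back //; congr cross; lia_clear.
  rewrite hook_newc_fan; last by lia_clear.
  rewrite /r /fan_offset e2 hook_apexm.
  (* The image is an end of the last diagonal of w, and these ends are [oldc w n] and
     [apex v 0 - 1]. *)
  have cE : (cross w n.-1 (newc w n.-1) == apex v 0 - 1) =
      ~~ (cross w n.-1 (newc w n.-1) == oldc w n).
    have : cross w n.-1 (newc w n.-1) != newc w n.
      rewrite [in newc w n]n1 newcE /cross.
      have := @oldc_newc _ w_ok n.-1 (leq_pred n); rewrite oldcE //.
      by move: (newc _ _) (entry _ _) (exit _ _); clear; I3.
    rewrite oldc_apex -v_ok.2; move: (cross _ _ _) (apex v 0); clear; I3.
  have := ql n.-1 ltn1; rewrite -cross_newc // -n1 cE => ->.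
  by do 3 case: (_ == _); split.
split.
  case/local_matchingP => q'0 q'n q'l; split.
  - rewrite /r /fan_offset e1 addn0 hook_apex0 -oldc_apex -(hook_oldc (leqnn n)).
    rewrite [in LHS]n1 q'l; last by rewrite /=; lia_clear.
    by rewrite -n1 hook_cross // hook_oldc // hook_newc ?leq_pred // qf // qn1.
  - by apply/first_fan; rewrite addn0 addn1; apply: q'l => /=; lia_clear.
  - by move=> t ht; apply/mid_fan => //; rewrite addnS; apply: q'l => /=; lia_clear.
  - apply/last_fan; have -> : (n + m = (n + m.-1).+1)%N by lia_clear.
    by apply: q'l => /=; lia_clear.
  - by apply/first_back/q'l => /=; lia_clear.
case=> c1 c2 c3 c4 c5; apply/local_matchingP; split.
- by rewrite qf // hook_oldc.
- have -> : len w' = (N - 0)%N by rewrite /= subn0.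
  by rewrite qb // hook_newc_back.
move=> i /= lt; have [lti|] := ltnP i n.-1.
  rewrite !qf ?hook_oldc ?hook_newc ?hook_cross ?ql //; lia_clear.
rewrite leq_eqVlt => /orP[/eqP <-|gei].
  rewrite -n1 hook_oldc // hook_newc ?leq_pred // hook_cross // (qf n.-1) //.
  move: c1; rewrite /r /fan_offset e1 addn0 hook_apex0 -oldc_apex => ->.
  by rewrite qn1.
have [e|nei] := eqVneq i n.
  by have := first_fan.2 c2; rewrite addn0 addn1 e.
have [ltm|gem] := ltnP i (n + m.-1).
  have ht : (0 < i - n < m.-1)%N by lia_clear.
  by have := (mid_fan _ ht).2 (c3 _ ht); rewrite addnS subnKC //; lia_clear.
move: gem; rewrite leq_eqVlt => /orP[/eqP <-|gei'].
  by rewrite (_ : (n + m.-1).+1 = n + m)%N; [exact/last_fan | lia_clear].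
have [->|ne] := eqVneq i (n + m)%N; first exact/first_back.
have -> : (i = N - (N - i.+1).+1)%N by lia_clear.
set j := (N - i.+1)%N; have ltj : (j.+1 < n)%N by lia_clear.
rewrite -subSn; last by lia_clear.
rewrite subSS hook_oldc_back; last by lia_clear.
rewrite hook_cross_back; last by lia_clear.
rewrite hook_newc_back // !qb //; last by lia_clear.
by rewrite cross_newc ?ql ?addKb //; lia_clear.
Qed.

(** If q selects [oldc w n], triangle n is forced and the chain consists of triangles n + 1, ..., n
    + m. Otherwise triangle n + m is forced and the chain is n, ..., n + m - 1. The forced triangle
    imposes the condition at its end of the chain. *)
Lemma hook_localE q q' : local_matching w q ->
  (forall i, (i < n)%N -> q' i = q i) ->
  (forall i, (i < n)%N -> q' (N - i)%N = q i) ->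
  local_matching w' q' =
  if q n == oldc w n then (q' n == oldc w n) &&
    fan_matching m (fun t => fan_offset q' t.+1)
  else (q' (n + m)%N == apex v 0 - 1) &&
    fan_matching m (fan_offset q').
Proof.
move=> qq qf qb; apply/idP/idP.
  case/(hook_local_core qq qf qb).
  set r := fan_offset q'.
  have -> : (q' n == oldc w n) = (r 0%N == 1).
    rewrite /r /fan_offset addn0 hook_apex0 oldc_apex.
    by move: (q' n) (apex v 0); clear; I3.
  have -> : (q' (n + m)%N == apex v 0 - 1) = (r m == -1).
    by rewrite /r /fan_offset hook_apexm; move: (q' _) (apex v 0); clear; I3.
  move=> c1 c2 c3 c4 c5; rewrite c1 c5; case: ifP => qn; rewrite ?qn /=.
    apply/fan_matchingP; split.
    - by rewrite -/(r 1%N) c2 ; move: c1; rewrite qn => /eqP ->.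
    - by rewrite -/(r m.-1.+1) prednK ?(ltnW m1) // c5 qn.
    move=> t lt; rewrite -/(r t.+1) -/(r t.+2).
    have [lt'|ge] := ltnP t.+1 m.-1; first by apply: c3.
    have e : t.+1 = m.-1 by lia_clear.
    rewrite e -[X in _ = ~~ X]c4 prednK ?(ltnW m1) //.
    by move: c5; rewrite qn; move: (r m); clear; I3.
  apply/fan_matchingP; split.
  - by rewrite -/(r 0%N) c1 qn.
  - by rewrite -/(r m.-1) -c4; move: c5; rewrite qn => /eqP ->.
  move=> [|t] lt; rewrite -/(r _) -/(r _).
    by rewrite c2; move: c1; rewrite qn; move: (r 0%N); clear; I3.
  by apply: c3.
move=> h; apply/(hook_local_core qq qf qb); move: h.
set r := fan_offset q'.
have -> : (q' n == oldc w n) = (r 0%N == 1).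
  rewrite /r /fan_offset addn0 hook_apex0 oldc_apex.
  by move: (q' n) (apex v 0); clear; I3.
have -> : (q' (n + m)%N == apex v 0 - 1) = (r m == -1).
  by rewrite /r /fan_offset hook_apexm; move: (q' _) (apex v 0); clear; I3.
case: ifP => qn /andP[/eqP rE /fan_matchingP[]].
  rewrite -/(r 1%N) -/(r m.-1.+1) prednK ?(ltnW m1) // => f0 f1 f2.
  split.
  - by rewrite rE.
  - by rewrite rE; move: f0; move: (r 1%N); clear; I3.
  - by move=> [|t] ht //; apply: f2; lia_clear.
  (* At the end of the chain the value -1 is excluded, so being different from 1 means being 0. *)
  - have := f2 m.-2; rewrite -/(r m.-2.+2) -/(r m.-2.+1).
    rewrite (_ : m.-2.+2 = m); last by lia_clear.
    rewrite (_ : m.-2.+1 = m.-1); last by lia_clear.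
    move=> /(_ _); move: f1; move: (r m) (r m.-1) => a b h1 h2.
    have {}h2 : (a == 1) = (b != -1) by apply: h2; lia_clear.
    by move: h1 h2; clear; I3.
  - by rewrite (negPf f1).
rewrite -/(r 0%N) -/(r m.-1) => f0 f1 f2; split.
- by rewrite (negPf f0).
- have {}f2 : (r 1%N == 1) = (r 0%N != -1) by apply: f2; lia_clear.
  by move: f0 f2; move: (r 1%N) (r 0%N); clear; I3.
- by move=> t ht; apply: f2; lia_clear.
- by rewrite rE; move: f1; move: (r m.-1); clear; I3.
- by rewrite rE.
Qed.
End Hook.

(** * Counting the matchings of snake graphs *)

(** Finite functions can be counted, whereas the predicates speak of sequences indexed by natural
    numbers; the default 0 only makes the sequence total. *)
Definition extend m (r : {ffun 'I_m -> 'I_3}) (i : nat) : 'I_3 :=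
  if insub i is Some j then r j else 0.

Lemma extend_ord m (r : {ffun 'I_m -> 'I_3}) (i : 'I_m) : extend r i = r i.
Proof. by rewrite /extend valK. Qed.

Lemma extend_ffun m (f : nat -> 'I_3) i : (i < m)%N ->
  extend [ffun j : 'I_m => f j] i = f i.
Proof. by move=> lt; rewrite (extend_ord _ (Ordinal lt)) ffunE. Qed.

Lemma eq_extend m (r r' : {ffun 'I_m -> 'I_3}) :
  (forall i, (i < m)%N -> extend r i = extend r' i) -> r = r'.
Proof. by move=> e; apply/ffunP => i; rewrite -!extend_ord e. Qed.

Definition fan_matchings m : {set {ffun 'I_m -> 'I_3}} :=
  [set r | fan_matching m (extend r)].

Definition local_matchings w : {set {ffun 'I_(len w).+1 -> 'I_3}} :=
  [set q | local_matching w (extend q)].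

Lemma card_local_matchings_rev w : nonreturning w ->
  #|local_matchings (rev_strip w)| = #|local_matchings w|.
Proof.
move=> w_ok; pose f (q : {ffun 'I_(len w).+1 -> 'I_3}) :=
  [ffun i : 'I_(len w).+1 => extend q (len w - i)].
have fE q i : (i <= len w)%N -> extend (f q) i = extend q (len w - i).
  by move=> le; rewrite (@extend_ffun _ (fun i => extend q (len w - i))).
have fK : involutive f.
  move=> q; apply: eq_extend => i lt; rewrite !fE ?leq_subr //.
  by rewrite subKn.
rewrite -[RHS](card_preimset _ (inv_inj fK)).
apply: eq_card => q; rewrite !inE.
rewrite -(local_matching_rev w_ok); apply: eq_local_matching => i le.
by rewrite fE ?leq_subr // subKn.
Qed.

(** R is the graph of a map with fibres of constant size, which need not be available as a
    function. *)
Lemma card_double_count (S U : finType) (A : {set S}) (B : {set U})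
    (R : S -> U -> bool) (k : nat) :
  {in A, forall x, #|[set y in B | R x y]| = 1%N} ->
  {in B, forall y, #|[set x in A | R x y]| = k} ->
  #|A| = (#|B| * k)%N.
Proof.
move=> hA hB.
have cE (V : finType) (C : {set V}) (p : pred V) :
    #|[set y in C | p y]| = (\sum_(y in C) p y)%N.
  rewrite -sum1_card big_mkcond [RHS]big_mkcond /=.
  by apply: eq_bigr => y _; rewrite !inE; case: (y \in C); case: (p y).
rewrite -sum_nat_const -sum1_card.
rewrite -(eq_bigr _ hA) -[RHS](eq_bigr _ hB).
under eq_bigr do rewrite cE; rewrite exchange_big /=.
by apply: eq_bigr => y _; rewrite cE.
Qed.

Section SnakeCount.
Variable w : strip.
Hypothesis w_ok : nonreturning w.
Local Notation n := (len w).

Lemma perfect_matching_oppositeE q :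
  perfect_matching (G := snake_graph w) (opposite_sides w q) =
  local_matching w q.
Proof.
apply/idP/idP; last exact: perfect_matching_opposite_sides.
case/(perfect_matching_local w_ok) => q' lq' /eq_opposite_sides e.
by rewrite (eq_local_matching e).
Qed.

Lemma card_snake_matchings :
  #|[set P | perfect_matching (G := snake_graph w) P]| = #|local_matchings w|.
Proof.
rewrite -(card_in_imset (f := fun q => opposite_sides w (extend q))).
  apply: eq_card => P; rewrite inE; apply/idP/imsetP.
    case/(perfect_matching_local w_ok) => q lq ->.
    exists [ffun i : 'I_n.+1 => q i].
      rewrite inE (eq_local_matching (q' := q)) // => i le.
      by rewrite extend_ffun.
    by apply/eq_opposite_sides => i le; rewrite extend_ffun.
  by case=> q; rewrite inE => lq ->; apply: perfect_matching_opposite_sides.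
move=> q q' _ _ /eq_opposite_sides e; apply: eq_extend => i; exact: e.
Qed.

Lemma flip_opposite_sides q :
  flip (opposite_sides w q) =
  opposite_sides (rev_strip w) (fun i => q (n - i)%N).
Proof.
apply/setP => -[j s]; rewrite inE /=; apply/imsetP/eqP => [[[i t]]|->].
  by rewrite inE /= => /eqP -> [-> ->]; rewrite /= subSS subKn // -ltnS.
exists (rev_ord j, q (n - j)%N + 1); last by rewrite rev_ordK.
by rewrite inE /= subSS.
Qed.

Variable v : fan.
Hypothesis v_ok : fan_ok w v.
Local Notation m := (valency v).
Local Notation w' := (hook_strip w v).
Local Notation N := (n + m + n)%N.

Lemma symmetric_oppositeE q' :
  symmetric_matching (opposite_sides w' q') =
  local_matching w' q' && [forall i : 'I_n, q' i == q' (N - i)%N].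
Proof.
have n0 := len_gt0 w_ok.
have hook_ok := nonreturning_hook w_ok v_ok.
rewrite /symmetric_matching; congr (_ && _).
  apply/idP/idP; last exact: perfect_matching_opposite_sides.
  case/(perfect_matching_local hook_ok) => q2 lq2 /eq_opposite_sides e.
  by rewrite (eq_local_matching e).
apply/forallP/forallP => h.
  move=> i; have ltN : (i < N.+1)%N by have := ltn_ord i; lia_clear.
  have := h (Ordinal ltN, q' i + 1).
  by rewrite !inE /= ltn_ord eqxx subSS => /eqP/esym/eqP/addIr ->.
case=> j s; apply/implyP => /= lt.
have /eqP := h (Ordinal lt) => /= e.
by rewrite !inE /= subSS -e.
Qed.

Lemma is_res_oppositeE q' q :
  is_res (w := w) (v := v) (opposite_sides w' q') (opposite_sides w q) =
  local_matching w q && [forall i : 'I_n, q i == q' i].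
Proof.
rewrite /is_res perfect_matching_oppositeE; congr (_ && _).
apply/forallP/forallP => h.
  move=> i; have ltN : (i < n.+1)%N by have := ltn_ord i; lia_clear.
  have := h (Ordinal ltN, q i + 1).
  rewrite !inE /= ltn_ord eqxx inordK; last by have := ltn_ord i; lia_clear.
  by move=> /eqP/esym/eqP/addIr ->.
case=> j s; apply/implyP => /= lt.
have /eqP := h (Ordinal lt) => /= e.
by rewrite !inE /= inordK -?e //; lia_clear.
Qed.

(** On triangles before n the restriction is prescribed. In triangle n the apex is excluded, and the
    rule across the last diagonal decides between the other two corners. *)
Lemma card_res (P : {set gedge (snake_graph w')}) : symmetric_matching P ->
  #|[set Q in [set Q | perfect_matching (G := snake_graph w) Q] |
      is_res (w := w) (v := v) P Q]| = 1%N.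
Proof.
have n0 := len_gt0 w_ok; have n1 : n = n.-1.+1 by lia_clear.
have hook_ok := nonreturning_hook w_ok v_ok.
move=> sP; have /(perfect_matching_local hook_ok)[q' lq' PE] :
  perfect_matching P by case/andP: sP.
move: sP; rewrite PE symmetric_oppositeE lq' /= => /forallP sq'.
(* The hook strip may select the apex in triangle n, which a matching of w cannot; [apex v 0 - 1]
   takes its place. *)
pose q i := if (i < n)%N then q' i else
  if q' n == oldc w n then oldc w n else apex v 0 - 1.
have qn : q n != newc w n.
  rewrite /q ltnn -v_ok.2; case: ifP => _.
    by rewrite (oldc_apex w_ok v_ok); move: (apex v 0); clear; I3.
  by move: (apex v 0); clear; I3.
have lq : local_matching w q.
  move/local_matchingP: lq' => [h0 _ hi].
  apply/local_matchingP; split => //.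
    by rewrite /q n0 -(hook_oldc w_ok v_ok).
  move=> i lt; have := hi i; rewrite /= (hook_oldc w_ok v_ok) //.
  rewrite (hook_newc v w_ok) ?(ltnW lt) // (hook_cross v) //.
  rewrite [q i]/q lt => <-; last by lia_clear.
  rewrite /q; have [//|ge] := ltnP i.+1 n.
  have -> : i.+1 = n by lia_clear.
  case: ifP => _; first by rewrite eqxx.
  by rewrite (oldc_apex w_ok v_ok); move: (apex v 0); clear; I3.
apply/eqP/cards1P; exists (opposite_sides w q).
apply/setP => Q; rewrite !inE; apply/andP/eqP.
  case=> /(perfect_matching_local w_ok)[q2 lq2 ->].
  rewrite is_res_oppositeE => /andP[_ /forallP e].
  have {}e i : (i < n)%N -> q2 i = q i.
    by move=> lt; rewrite /q lt; have /eqP := e (Ordinal lt).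
  apply/eq_opposite_sides => i; rewrite leq_eqVlt => /orP[/eqP ->|]; last exact: e.
  move: lq lq2 => /local_matchingP[_ _ h] /local_matchingP[_ qn2 h2].
  have qq2 : (q2 n == oldc w n) = (q n == oldc w n).
    have lt1 : (n.-1 < n)%N by lia_clear.
    by have := h _ lt1; have := h2 _ lt1; rewrite -n1 (e n.-1) // => -> ->.
  apply/eqP; move: (@oldc_newc w w_ok n (leqnn n)) qn qn2 qq2.
  by move: (q n) (q2 n) (oldc w n) (newc w n); clear; I3.
move=> ->; rewrite perfect_matching_oppositeE is_res_oppositeE lq; split=> //=.
by apply/forallP => i; rewrite /q ltn_ord.
Qed.

(** The inverse of restriction: the chain r is inserted where [hook_localE] allows it, shifted by
    one if triangle n is the forced one. *)
Definition hook_matching (q r : nat -> 'I_3) (i : nat) : 'I_3 :=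
  if (i < n)%N then q i
  else if (i <= n + m)%N then
    (if q n == oldc w n then
       if i == n then oldc w n else r (i - n).-1 + hook_apex v (i - n)
     else
       if i == (n + m)%N then apex v 0 - 1 else r (i - n)%N + hook_apex v (i - n))
  else q (N - i)%N.

Lemma hook_matching_fan q r t : (t <= m)%N ->
  hook_matching q r (n + t) =
  if q n == oldc w n then
    if t == 0%N then oldc w n else r t.-1 + hook_apex v t
  else if t == m then apex v 0 - 1 else r t + hook_apex v t.
Proof.
move=> le; rewrite /hook_matching ifF; last by lia_clear.
have -> : (n + t == n) = (t == 0%N) by lia.
by rewrite leq_add2l le eqn_add2l addKn.
Qed.

Lemma hook_matching_back q r i : (i < n)%N ->
  hook_matching q r (N - i) = q i.
Proof.
move=> lt; rewrite /hook_matching ifF; last by lia_clear.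
rewrite ifF; last by lia_clear.
by rewrite subKn //; lia_clear.
Qed.

Lemma hook_matching_local q r : local_matching w q -> fan_matching m r ->
  local_matching w' (hook_matching q r).
Proof.
have m1 := v_ok.1.
move=> lq fr; rewrite (hook_localE w_ok v_ok lq).
- have e1 (a b : 'I_3) : a + b - b = a by rewrite addrK.
  case: ifP => qn.
    have := hook_matching_fan q r (leq0n m); rewrite addn0 qn => ->.
    rewrite /= eqxx (eq_fan_matching (g := r)) // ?(ltnW m1) // => t lt.
    by rewrite /fan_offset hook_matching_fan // qn /= e1.
  rewrite hook_matching_fan // qn !eqxx /=.
  rewrite (eq_fan_matching (g := r)) // ?(ltnW m1) // => t lt.
  by rewrite /fan_offset hook_matching_fan ?(ltnW lt) // qn (ltn_eqF lt) e1.
- by move=> i lt; rewrite /hook_matching lt.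
exact: hook_matching_back.
Qed.

(** Symmetry and the restriction fix all triangles outside n, ..., n + m, and [hook_localE] leaves a
    chain of m triangles to be filled. *)
Lemma card_res_fiber (Q : {set gedge (snake_graph w)}) :
  perfect_matching Q ->
  #|[set P in [set P | symmetric_matching P] | is_res (w := w) (v := v) P Q]| =
  #|fan_matchings m|.
Proof.
have n0 := len_gt0 w_ok; have m1 := v_ok.1.
have hook_ok := nonreturning_hook w_ok v_ok.
case/(perfect_matching_local w_ok) => q lq ->.
rewrite -(card_in_imset
  (f := fun r => opposite_sides w' (hook_matching q (extend r)))); last first.
  move=> r r' _ _ /eq_opposite_sides e; apply: eq_extend => t lt.
  case qn : (q n == oldc w n).
    have := e (n + t.+1)%N; rewrite !hook_matching_fan // qn /=.
    by move=> /(_ _)/addIr; apply; rewrite /=; lia_clear.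
  have := e (n + t)%N; rewrite !hook_matching_fan ?(ltnW lt) // qn (ltn_eqF lt).
  by move=> /(_ _)/addIr; apply; rewrite /=; lia_clear.
apply: eq_card => P; rewrite !inE; apply/andP/imsetP; last first.
  case=> r; rewrite inE => fr ->.
  rewrite symmetric_oppositeE is_res_oppositeE lq hook_matching_local //=.
  split; apply/forallP => i; last by rewrite /hook_matching ltn_ord.
  by rewrite hook_matching_back // /hook_matching ltn_ord.
case=> sP; have /(perfect_matching_local hook_ok)[q' lq' PE] :
  perfect_matching P by case/andP: sP.
move: sP; rewrite PE symmetric_oppositeE lq' is_res_oppositeE lq /=.
move=> /forallP sq' /forallP eq'.
have qf i : (i < n)%N -> q' i = q i.
  by move=> lt; have /eqP := eq' (Ordinal lt).
have qb i : (i < n)%N -> q' (N - i)%N = q i.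
  by move=> lt; rewrite -qf //; have /eqP := sq' (Ordinal lt).
move: lq'; rewrite (hook_localE w_ok v_ok lq qf qb).
case: ifP => qn /andP[/eqP qE fr].
  exists [ffun t : 'I_m => q' (n + t.+1)%N - hook_apex v t.+1].
    rewrite inE (eq_fan_matching
      (g := fun t => q' (n + t.+1)%N - hook_apex v t.+1)) //; first by lia_clear.
    by move=> t lt; rewrite (extend_ffun (fun t => q' (n + t.+1)%N - hook_apex v t.+1)).
  apply: (eq_opposite_sides w' _ _).2 => i /= le.
  have [lt|ge] := ltnP i n; first by rewrite /hook_matching lt qf.
  have [le'|gt] := leqP i (n + m); last first.
    have -> : i = (N - (N - i))%N by lia_clear.
    by rewrite hook_matching_back ?qb //; lia_clear.
  rewrite -(subnKC ge) hook_matching_fan ?qn; last by lia_clear.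
  case: eqP => [-> |/eqP t0]; first by rewrite addn0.
  rewrite (extend_ffun (fun t => q' (n + t.+1)%N - hook_apex v t.+1));
    last by lia_clear.
  by rewrite prednK ?subrK // lt0n.
exists [ffun t : 'I_m => q' (n + t)%N - hook_apex v t].
  rewrite inE (eq_fan_matching
    (g := fun t => q' (n + t)%N - hook_apex v t)) //; first by lia_clear.
  by move=> t lt; rewrite (extend_ffun (fun t => q' (n + t)%N - hook_apex v t)).
apply: (eq_opposite_sides w' _ _).2 => i /= le.
have [lt|ge] := ltnP i n; first by rewrite /hook_matching lt qf.
have [le'|gt] := leqP i (n + m); last first.
  have -> : i = (N - (N - i))%N by lia_clear.
  by rewrite hook_matching_back ?qb //; lia_clear.
rewrite -(subnKC ge) hook_matching_fan ?qn; last by lia_clear.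
case: eqP => [->//|/eqP tm].
rewrite (extend_ffun (fun t => q' (n + t)%N - hook_apex v t)) ?subrK //.
by lia_clear.
Qed.

Lemma card_symmetric_matchings :
  #|[set P : {set gedge (snake_graph w')} | symmetric_matching P]| =
  (#|local_matchings w| * #|fan_matchings m|)%N.
Proof.
rewrite -card_snake_matchings.
apply: (card_double_count (R := is_res (w := w) (v := v))) => [P|Q]; rewrite inE.
  exact: card_res.
exact: card_res_fiber.
Qed.
End SnakeCount.

Lemma fan_ok_rev w v : nonreturning w ->
  (1 < valency v)%N -> apex v 0 = oldc w 0 -> fan_ok (rev_strip w) v.
Proof. by move=> w_ok m1 a0; split => //; rewrite newc_rev // subnn. Qed.

(** Once the common restriction is fixed, the choices at the two ends are independent, so the fibre
    is a product. *)
Lemma card_symmetric_pairs (w : strip) (p q : fan) :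
  nonreturning w -> fan_ok w p -> fan_ok (rev_strip w) q ->
  #|[set PQ : {set gedge (snake_graph (hook_strip w p))} *
              {set gedge (snake_graph (hook_strip (rev_strip w) q))}
     | [&& symmetric_matching PQ.1, symmetric_matching PQ.2 &
       [exists Q : {set gedge (snake_graph w)},
         is_res PQ.1 Q && is_res PQ.2 (flip Q)]]]| =
  (#|local_matchings w| *
   (#|fan_matchings (valency p)| * #|fan_matchings (valency q)|))%N.
Proof.
move=> w_ok p_ok q_ok; have r_ok := nonreturning_rev w_ok.
have flip_perfect Q : perfect_matching (G := snake_graph w) Q ->
    perfect_matching (flip Q).
  case/(perfect_matching_local w_ok) => c lc ->.
  by rewrite flip_opposite_sides perfect_matching_oppositeE // local_matching_rev.
rewrite -(card_snake_matchings w_ok).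
apply: (card_double_count
  (R := fun PQ Q => is_res PQ.1 Q && is_res PQ.2 (flip Q))) => [PQ|Q]; rewrite inE.
  case/and3P=> sP sQ /existsP[Q /andP[rP rQ]].
  apply/eqP; rewrite eqn_leq; apply/andP; split.
    rewrite -(card_res w_ok p_ok sP); apply: subset_leq_card.
    apply/subsetP => Q'; rewrite !inE => /andP[-> /andP[-> _]] //.
  rewrite card_gt0; apply/set0Pn; exists Q; rewrite !inE rP rQ.
  by case/andP: rP => ->.
move=> pQ; rewrite -(card_res_fiber w_ok p_ok pQ).
rewrite -(card_res_fiber r_ok q_ok (flip_perfect _ pQ)) -cardsX.
apply: eq_card => -[P P']; rewrite !inE /=.
case: (boolP (is_res P Q)) => rP; last by rewrite !andbF.
case: (boolP (is_res P' (flip Q))) => rP'; last by rewrite !andbF.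
rewrite !andbT /=; case: (symmetric_matching P) => //=.
case: (symmetric_matching P') => //=.
by apply/existsP; exists Q; rewrite rP rP'.
Qed.

(** * Matchings of the angles of a strip *)

Section StripRoot.
Variable w : strip.
Hypothesis w_ok : nonreturning w.
Local Notation n := (len w).

(* A representative of the vertex of the strip at corner k of triangle i: the
   corner of smallest triangle index. *)
Fixpoint strip_root (i : nat) (k : 'I_3) : nat * 'I_3 :=
  if i is j.+1 then
    if k == newc w i then (i, k) else strip_root j (cross w j k)
  else (0%N, k).

Lemma strip_rootS i k : strip_root i.+1 k =
  if k == newc w i.+1 then (i.+1, k) else strip_root i (cross w i k).
Proof. by []. Qed.

Lemma strip_root_le i k : ((strip_root i k).1 <= i)%N.
Proof.
elim: i k => // i IH k; rewrite strip_rootS; case: ifP => // _.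
exact: leq_trans (IH _) (leqnSn i).
Qed.

Lemma strip_root_new i k : (0 < i)%N -> k = newc w i -> strip_root i k = (i, k).
Proof. by case: i => // i _ ->; rewrite strip_rootS eqxx. Qed.

(** The new corner of a triangle has a larger index than all vertices met before, and [cross] is
    injective on the other corners. *)
Lemma strip_root_inj i : injective (strip_root i).
Proof.
elim: i => [|i IH] k k'; first by case.
have le := @strip_root_le i.
rewrite !strip_rootS; case: ifP => [/eqP -> | _]; case: ifP => [/eqP -> //| _].
- by move=> e; have := le (cross w i k'); rewrite -e ltnn.
- by move=> e; have := le (cross w i k); rewrite e ltnn.
by move/IH/(inv_inj (crossK w i)).
Qed.

Lemma strip_root_cross i k : k != newc w i.+1 ->
  strip_root i.+1 k = strip_root i (cross w i k).
Proof. by rewrite strip_rootS => /negPf ->. Qed.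

(** Later triangles are reached only through the exit side of triangle i, and [oldc w i] is the
    corner off that side. *)
Lemma strip_root_above i j k : (i < j <= n)%N ->
  (i < (strip_root j k).1)%N \/
  exists2 k', k' != oldc w i & strip_root j k = strip_root i k'.
Proof.
elim: j k => // j IH k /andP[]; rewrite ltnS leq_eqVlt => /orP[/eqP <-|ij] jn.
  have [->|nk] := eqVneq k (newc w i.+1); first by left; rewrite strip_root_new.
  by right; exists (cross w i k); rewrite ?cross_newc_old ?strip_root_cross.
have [->|nk] := eqVneq k (newc w j.+1); first by left; rewrite strip_root_new //= ltnW.
by rewrite strip_root_cross //; apply: IH; rewrite ij ltnW.
Qed.

Lemma strip_root_old i j k : (i < j <= n)%N ->
  strip_root j k != strip_root i (oldc w i).
Proof.
move=> ij; apply/negP => /eqP e.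
have [|[k' nk]] := strip_root_above k ij.
  by rewrite e ltnNge strip_root_le.
by rewrite e => /strip_root_inj ek; rewrite ek eqxx in nk.
Qed.

Definition third_corner (i : nat) : 'I_3 := - oldc w i - newc w i.

Lemma third_cornerP i : (i <= n)%N ->
  (third_corner i != oldc w i) && (third_corner i != newc w i).
Proof.
move/(oldc_newc w_ok); rewrite /third_corner.
by move: (oldc _ _) (newc _ _); clear; I3.
Qed.

Lemma corner_cases i k : (i <= n)%N ->
  [\/ k = oldc w i, k = newc w i | k = third_corner i].
Proof.
move/(oldc_newc w_ok) => h.
have : [|| k == oldc w i, k == newc w i | k == third_corner i].
  by move: h; rewrite /third_corner; move: (oldc _ _) (newc _ _); clear; I3.
by case/or3P => /eqP ->; [exact: Or31 | exact: Or32 | exact: Or33].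
Qed.

Lemma corner_count i k : (i <= n)%N ->
  ((k == oldc w i) + (k == newc w i) + (k == third_corner i) = 1)%N.
Proof.
move/(oldc_newc w_ok) => h; apply/eqP; move: h; rewrite /third_corner.
by move: (oldc _ _) (newc _ _); clear; I3.
Qed.

Variable q : nat -> 'I_3.

Definition strip_count (j : nat) (r : nat * 'I_3) : nat :=
  (\sum_(i < j.+1) (strip_root i (q i) == r))%N.

Lemma strip_countS j r :
  strip_count j.+1 r = (strip_count j r + (strip_root j.+1 (q j.+1) == r))%N.
Proof. by rewrite /strip_count big_ord_recr. Qed.

Lemma strip_count0 r : strip_count 0 r = (strip_root 0 (q 0) == r).
Proof. by rewrite /strip_count big_ord_recl big_ord0 addn0. Qed.

Lemma strip_count_corner j k :
  strip_count j.+1 (strip_root j.+1 k) =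
  (strip_count j (strip_root j.+1 k) + (q j.+1 == k))%N.
Proof. by rewrite strip_countS (inj_eq (@strip_root_inj j.+1)). Qed.

Lemma strip_count_lt j r : (j < r.1)%N -> strip_count j r = 0%N.
Proof.
move=> lt; apply: big1 => i _; apply/eqP; rewrite eqb0; apply/negP => /eqP e.
have := strip_root_le i (q i); rewrite e; have := ltn_ord i; lia.
Qed.

Lemma strip_count_new j :
  strip_count j (strip_root j (newc w j)) = (q j == newc w j).
Proof.
case: j => [|j]; first by rewrite strip_count0 (inj_eq (@strip_root_inj 0)).
by rewrite strip_count_corner strip_count_lt ?strip_root_new.
Qed.

Lemma strip_count_old i j : (i <= j <= n)%N ->
  strip_count j (strip_root i (oldc w i)) =
  strip_count i (strip_root i (oldc w i)).
Proof.
elim: j => [|j IH] /andP[]; first by rewrite leqn0 => /eqP ->.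
rewrite leq_eqVlt => /orP[/eqP -> //|ij] jn.
rewrite strip_countS IH; last by rewrite -ltnS ij ltnW.
by rewrite (negPf (strip_root_old _ _)) ?addn0 // ij.
Qed.

(* Both sums run over the two ends of the diagonal between triangles j and
   j + 1. *)
Lemma strip_count_ends j (f := fun i k => strip_count j (strip_root i k)) :
  (j < n)%N ->
  (f j.+1 (oldc w j.+1) + f j.+1 (third_corner j.+1) =
   f j (newc w j) + f j (third_corner j))%N /\
  f j.+1 (oldc w j.+1) =
    if cross w j (oldc w j.+1) == newc w j then f j (newc w j)
    else f j (third_corner j).
Proof.
move=> lt; rewrite /f.
have /andP[t1 t2] := third_cornerP lt.
have /andP[t3 t4] := third_cornerP (ltnW lt).
have o := oldc_newc w_ok lt.
rewrite !strip_root_cross //.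
have o' : cross w j (oldc w j.+1) != oldc w j by rewrite cross_newc_old.
have t' : cross w j (third_corner j.+1) != oldc w j by rewrite cross_newc_old.
have ne : cross w j (oldc w j.+1) != cross w j (third_corner j.+1).
  by rewrite (inj_eq (inv_inj (crossK w j))) eq_sym.
move: o' t' ne; move: (cross _ _ _) (cross _ _ _) => b a.
move=> oa ob ab; have : (a == newc w j) && (b == third_corner j) ||
    (b == newc w j) && (a == third_corner j).
  move: oa ob ab (oldc_newc w_ok (ltnW lt)); rewrite /third_corner.
  by move: (oldc _ _) (newc _ _); clear; I3.
case/orP => /andP[/eqP -> /eqP ->]; first by rewrite eqxx.
by rewrite (negPf t4) addnC.
Qed.

(** A conservation law. Entering triangle j + 1 adds one angle, while its old vertex, carrying
    exactly one angle, leaves the sum. The initial value is 1 unless triangle 0 spends its angle on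
    the start of the arc. *)
Lemma strip_count_balance j : (j <= n)%N ->
  (forall i, (0 < i <= j)%N -> strip_count i (strip_root i (oldc w i)) = 1%N) ->
  (strip_count j (strip_root j (newc w j)) +
   strip_count j (strip_root j (third_corner j)) = (q 0%N != oldc w 0))%N.
Proof.
elim: j => [|j IH] jn h.
  rewrite !strip_count0 !(inj_eq (@strip_root_inj 0)).
  by have := corner_count (q 0%N) jn; case: (_ == oldc w 0) => /=; lia.
rewrite -IH ?(ltnW jn) //; last first.
  by move=> i /andP[i0 ij]; apply: h; rewrite i0 leqW.
have [<- _] := strip_count_ends jn.
have := h j.+1; rewrite !strip_count_corner => /(_ _).
have := corner_count (q j.+1) jn.
rewrite [strip_count j (strip_root j.+1 (newc w j.+1))]strip_count_lt; last first.
  by rewrite strip_root_new.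
by rewrite leqnn => + /(_ isT); lia.
Qed.

(** By the conservation law the two ends of a diagonal carry one angle from the preceding triangles.
    One of these ends is the old vertex of the next triangle, its last chance to be matched, so it
    must be selected there exactly when it is the unmatched end. *)
Lemma strip_count_local : 
  local_matching w q <->
  [/\ q 0%N != oldc w 0, q n != newc w n &
   forall i, (0 < i <= n)%N -> strip_count i (strip_root i (oldc w i)) = 1%N].
Proof.
have step j : (j < n)%N -> q 0%N != oldc w 0 ->
    (forall i, (0 < i <= j)%N -> strip_count i (strip_root i (oldc w i)) = 1%N) ->
    strip_count j.+1 (strip_root j.+1 (oldc w j.+1)) = 1%N <->
    (q j.+1 == oldc w j.+1) =
       ((cross w j (oldc w j.+1) == newc w j) (+) (q j == newc w j)).
  move=> lt q0 h; have [_ e] := strip_count_ends lt.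
  have := strip_count_balance (ltnW lt) h; rewrite q0.
  rewrite strip_count_corner e strip_count_new.
  case: (cross _ _ _ == _); case: (q j == _); case: (q j.+1 == _) => /=;
  by move=> b; split=> //; lia.
split=> [/local_matchingP[q0 qn ql]|[q0 qn h]]; last first.
  apply/local_matchingP; split => // i lt; apply/step => //; last exact: h.
  by move=> j /andP[j0 ji]; apply: h; rewrite j0 (leq_trans ji (ltnW lt)).
split => //.
suff H j : (j <= n)%N ->
    forall i, (0 < i <= j)%N -> strip_count i (strip_root i (oldc w i)) = 1%N.
  exact: H.
elim: j => [|j IH] jn i; first by case: i.
move=> /andP[i0]; rewrite leq_eqVlt => /orP[/eqP ->|ij]; last first.
  by apply: (IH (ltnW jn)); rewrite i0.
by apply/step => //; [exact: IH (ltnW jn) | exact: ql].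
Qed.

Definition inner_root (r : nat * 'I_3) : Prop :=
  [/\ r != (0%N, oldc w 0), r != (n, newc w n) &
    exists i k, (i <= n)%N /\ r = strip_root i k].

Lemma strip_root_n : strip_root n (newc w n) = (n, newc w n).
Proof. by rewrite strip_root_new // len_gt0. Qed.

(** A vertex can be followed forwards until it is an old corner or lies in triangle n. The inner
    vertices are therefore the old corners of triangles 1, ..., n and the third corner of triangle
    n. *)
Lemma local_strip_count :
  local_matching w q <-> forall r, inner_root r -> strip_count n r = 1%N.
Proof.
have n0 := len_gt0 w_ok; have n1 : n = n.-1.+1 by lia.
have /andP[t1 t2] := third_cornerP (leqnn n).
split=> [/strip_count_local[q0 qn h] r [r0 rn [i [k [le]]]]|h].
  have [d e] : exists d, (n - i = d)%N by exists (n - i)%N.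
  elim: d i k le e r0 rn => [|d IH] i k le e r0 rn re.
    have ei : i = n by lia.
    move: re r0 rn; rewrite ei; case: (corner_cases k (leqnn n)) => -> ->.
    - by move=> _ _; apply: h; rewrite n0 leqnn.
    - by rewrite strip_root_n eqxx.
    move=> _ _; have := strip_count_balance (leqnn n) h.
    by rewrite strip_count_new (negPf qn) q0.
  have lt : (i < n)%N by lia.
  have [ko|nk] := eqVneq k (oldc w i).
    have i0 : (0 < i)%N.
      by rewrite lt0n; apply: contraNneq r0 => i0; rewrite re ko i0.
    by rewrite re ko strip_count_old ?le ?leqnn //; apply: h; rewrite i0.
  apply: (IH i.+1 (cross w i k)) => //; first by lia.
  rewrite re strip_root_cross ?crossK //.
  by rewrite -cross_newc_old // crossK.
have old i : (0 < i <= n)%N -> strip_count i (strip_root i (oldc w i)) = 1%N.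
  move=> /andP[i0 le]; rewrite -(@strip_count_old i n) ?le ?leqnn //.
  apply: h; split; last by exists i, (oldc w i).
    by apply: (@strip_root_old 0 i (oldc w i)); rewrite i0.
  move: le; rewrite leq_eqVlt => /orP[/eqP ->|lt].
    by rewrite -strip_root_n (inj_eq (@strip_root_inj n)) oldc_newc.
  apply/negP => /eqP e; have := strip_root_le i (oldc w i).
  by rewrite e /= leqNgt lt.
have cn : strip_count n (strip_root n (third_corner n)) = 1%N.
  apply: h; split; last by exists n, (third_corner n).
    by apply: (@strip_root_old 0 n); rewrite n0 leqnn.
  by rewrite -strip_root_n (inj_eq (@strip_root_inj n)).
(* The balance reads [(q n == newc w n) + 1 = (q 0 != oldc w 0)] and settles both ends of the arc at
   once. *)
have := strip_count_balance (leqnn n) old; rewrite cn strip_count_new => b.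
apply/strip_count_local; split => //.
  by move: b; case: (q 0%N == _) => //=; lia.
by move: b; case: (q n == _) => //=; case: (_ == _) => /=; lia.
Qed.

Lemma local_strip_count_ends : local_matching w q ->
  strip_count n (0%N, oldc w 0) = 0%N /\ strip_count n (n, newc w n) = 0%N.
Proof.
case/local_matchingP => q0 qn _; split; last first.
  by rewrite -strip_root_n strip_count_new (negPf qn).
rewrite (@strip_count_old 0 n) ?leqnn // strip_count0.
by rewrite (inj_eq (@strip_root_inj 0)) (negPf q0).
Qed.
End StripRoot.

(** * Fans and vertices of the polygon *)

(* Labels of the vertices of the polygon: inl for the vertices of the strip and
   inr (b, g) for the outer end of diagonal g of the fan at the last (b = true)
   or first (b = false) point of the arc. *)
Definition label : eqType := ((nat * 'I_3) + (bool * nat))%type.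

Section FanRoot.
Variables (v : fan) (base : 'I_3 -> nat * 'I_3) (b : bool).
Local Notation m := (valency v).
Hypothesis m1 : (1 < m)%N.

Definition next_tri (g : nat) : nat := if g.+1 == m then 0%N else g.+1.
Definition prev_tri (i : nat) : nat := if i is j.+1 then j else m.-1.

Lemma next_triE g : (g < m)%N -> (g.+1 %% m)%N = next_tri g.
Proof.
rewrite /next_tri => lt; case: eqP => [->|ne]; first by rewrite modnn.
by rewrite modn_small //; lia.
Qed.

Lemma next_tri_lt g : (g < m)%N -> (next_tri g < m)%N.
Proof. by rewrite /next_tri; case: eqP => *; lia. Qed.

Lemma prev_tri_lt i : (i < m)%N -> (prev_tri i < m)%N.
Proof. by case: i => /= *; lia. Qed.

Lemma next_triK g : (g < m)%N -> prev_tri (next_tri g) = g.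
Proof. by rewrite /next_tri; case: eqP => //= <-. Qed.

Lemma prev_triK i : (i < m)%N -> next_tri (prev_tri i) = i.
Proof.
rewrite /next_tri; case: i => [|i] /= lt; first by rewrite prednK ?eqxx // ltnW.
by rewrite ltn_eqF.
Qed.

(* The diagonals of the fan are numbered so that diagonal g lies between the
   triangles g and g + 1; the label of its outer end. *)
Definition gap_label (g : nat) : label :=
  if g == 0%N then inl (base (apex v 0 - 1))
  else if g.+1 == m then inl (base (apex v 0 + 1)) else inr (b, g).

(** Triangle i lies between diagonals i - 1 and i, cyclically. Triangle 0 belongs to the strip as
    well, so the puncture and the outer ends of diagonals 0 and m - 1 keep the labels given by
    [base]. *)
Definition fan_root (i : nat) (k : 'I_3) : label :=
  if k == apex v i then inl (base (apex v 0))
  else if k == apex v i + 1 then gap_label (prev_tri i) else gap_label i.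

Lemma fan_root0 k : fan_root 0 k = inl (base k).
Proof.
rewrite /fan_root /gap_label /= prednK ?eqxx ?(ltnW m1) //.
rewrite (_ : (m.-1 == 0%N) = false); last by lia.
case: eqP => [-> //|/eqP h1]; case: eqP => [-> //|/eqP h2].
congr (inl (base _)); apply/eqP; move: h1 h2; move: (apex v 0); clear; I3.
Qed.

(* Number of the angles at the outer end of diagonal g chosen in the fan, the
   angles being given relatively to the apex. *)
Definition gap_count (f : nat -> 'I_3) (g : nat) : nat :=
  ((f g == -1)%R + (f (next_tri g) == 1)%R)%N.

Lemma sum_shift (F : nat -> nat -> nat) :
  (\sum_(i < m) F i (prev_tri i) = \sum_(g < m) F (next_tri g) g)%N.
Proof.
have [m' mE] : exists m', m = m'.+1 by exists m.-1; rewrite prednK // ltnW.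
rewrite mE big_ord_recl big_ord_recr /= addnC; congr (_ + _)%N; last first.
  by rewrite /next_tri /prev_tri mE eqxx.
apply: eq_bigr => i _; rewrite /bump /= add1n /next_tri mE eqSS ltn_eqF //.
Qed.

Lemma sum_fan_root (c : nat -> 'I_3) (l : label)
    (f := fun i => c i - apex v i) :
  (\sum_(i < m) (fan_root i (c i) == l) =
   (\sum_(i < m) (f i == 0)%R) * (inl (base (apex v 0)) == l) +
   \sum_(g < m) gap_count f g * (gap_label g == l))%N.
Proof.
have -> : (\sum_(g < m) gap_count f g * (gap_label g == l) =
    \sum_(g < m) (f g == -1)%R * (gap_label g == l) +
    \sum_(g < m) (f (next_tri g) == 1)%R * (gap_label g == l))%N.
  by rewrite -big_split; apply: eq_bigr => g _; exact: mulnDl.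
rewrite big_distrl /=.
rewrite -(sum_shift (fun i g => (f i == 1)%R * (gap_label g == l))%N).
rewrite -!big_split /=; apply: eq_bigr => i _.
rewrite /fan_root /f; move: (c i) (apex v i).
apply: I3_ind; apply: I3_ind;
by rewrite /=  ?mul0n ?mul1n ?addn0 ?add0n.
Qed.

Lemma sum_fan_angles (f : nat -> 'I_3) :
  (\sum_(i < m) (f i == 0)%R + \sum_(g < m) gap_count f g = m)%N.
Proof.
rewrite /gap_count big_split /= -(sum_shift (fun i g => (f i == 1)%R : nat)).
rewrite -!big_split /=.
rewrite -[RHS]card_ord -sum1_card; apply: eq_bigr => i _.
by move: (f i); apply: I3_ind.
Qed.

Lemma sum_gaps (F : nat -> nat) :
  (\sum_(g < m) F g = F 0 + F m.-1 + \sum_(1 <= g < m.-1) F g)%N.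
Proof.
rewrite -(big_mkord xpredT F) big_ltn ?(ltnW m1) //.
rewrite -{1}(prednK (ltnW m1)) big_nat_recr /=; last by lia.
by rewrite -addnA; congr (_ + _)%N; rewrite addnC.
Qed.

(* The angle q, which is not the one at the apex, tells which of the two ends
   of the diagonal opposite to the apex of triangle 0 is matched in the fan. *)
Definition fan_filling (f : nat -> 'I_3) (q : 'I_3) : Prop :=
  [/\ q != 0, (\sum_(i < m) (f i == 0)%R = 1)%N,
      forall g, (0 < g < m.-1)%N -> gap_count f g = 1%N,
      gap_count f 0 = (q == -1) & gap_count f m.-1 = (q == 1)].

(** Of the m angles one is at the puncture and m - 2 are at the outer ends of diagonals 1, ..., m -
    2. This leaves one for diagonals 0 and m - 1 together. *)
Lemma fan_filling_exists (f : nat -> 'I_3) :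
  (\sum_(i < m) (f i == 0)%R = 1)%N ->
  (forall g, (0 < g < m.-1)%N -> gap_count f g = 1%N) ->
  exists q, fan_filling f q.
Proof.
move=> f0 fg; have := sum_fan_angles f; rewrite f0 sum_gaps.
rewrite (eq_big_nat _ _ (F2 := fun=> 1%N)) //.
rewrite sum_nat_const_nat muln1 => s.
have {s} : (gap_count f 0 + gap_count f m.-1 = 1)%N by lia.
case g0 : (gap_count f 0) => [|[|//]] => s.
  by exists 1; split => //; rewrite ?g0.
by exists (-1); split => //; rewrite ?g0 //; case: s.
Qed.

Lemma fan_filling_inj f q q' : fan_filling f q -> fan_filling f q' -> q = q'.
Proof.
case=> h0 _ _ h1 _ [h2 _ _ h3 _]; apply/eqP; move: h3; rewrite h1 {h1}.
by move: h0 h2; move: q q'; apply: I3_ind; apply: I3_ind.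
Qed.

Lemma eq_fan_filling f f' q : (forall i, (i < m)%N -> f i = f' i) ->
  fan_filling f q -> fan_filling f' q.
Proof.
move=> e [h0 h1 h2 h3 h4].
have ge g : (g < m)%N -> gap_count f' g = gap_count f g.
  by move=> lt; rewrite /gap_count !e ?next_tri_lt.
split=> //.
- by rewrite -[RHS]h1; apply: eq_bigr => i _; rewrite e.
- by move=> g hg; rewrite ge ?h2 //; lia.
- by rewrite ge // ltnW.
- by rewrite ge //; lia.
Qed.

(** For -1 no angle of the fan lies at the outer end of diagonal m - 1, along which the fan is cut
    into the chain 0, ..., m - 1. For 1, in [fan_filling1], the cut is along diagonal 0 and the
    chain is 1, ..., m - 1, 0. *)
Lemma fan_fillingN f : fan_filling f (-1) <-> fan_matching m f.
Proof.
have m0 := ltnW m1.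
have gE g : (g < m.-1)%N -> (gap_count f g = 1%N <-> (f g.+1 == 1) = (f g != -1)).
  move=> lt; rewrite /gap_count /next_tri ifF; last by lia.
  by case: (_ == _); case: (_ == _).
have lastE : gap_count f m.-1 = ((f m.-1 == -1)%R + (f 0 == 1)%R)%N.
  by rewrite /gap_count /next_tri prednK // eqxx.
split=> [[_ _ h2 h3 h4]|/fan_matchingP[h0 h1 h2]].
  move: h4; rewrite lastE => h4; apply/fan_matchingP.
  split; try by apply/negP => e; move: h4; rewrite e ?addn1.
  move=> i lt; apply/gE => //; case: i lt => [|i] lt; first by rewrite h3.
  exact: h2.
have g0 g : (g < m.-1)%N -> gap_count f g = 1%N by move=> lt; apply/gE/h2.
have gl : gap_count f m.-1 = 0%N by rewrite lastE (negPf h0) (negPf h1).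
split => //.
- have := sum_fan_angles f; rewrite sum_gaps.
  rewrite (eq_big_nat _ _ (F2 := fun=> 1%N)); last by move=> i hi; apply: g0; lia.
  rewrite sum_nat_const_nat muln1 g0 ?gl; lia.
- by move=> g hg; apply: g0; lia.
- by rewrite g0 //; lia.
Qed.

Lemma fan_filling1 f : fan_filling f 1 <-> fan_matching m (f \o next_tri).
Proof.
have m0 := ltnW m1.
have n0E : next_tri 0 = 1%N by rewrite /next_tri ifF //; lia.
have nlE : next_tri m.-1 = 0%N by rewrite /next_tri prednK // eqxx.
have nE g : (g < m.-1)%N -> next_tri g = g.+1.
  by move=> lt; rewrite /next_tri ifF //; lia.
have gE g : (g < m.-1)%N ->
    (gap_count f g.+1 = 1%N <->
     ((f \o next_tri) g.+1 == 1) = ((f \o next_tri) g != -1)).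
  move=> lt; rewrite /gap_count /= (nE g) //.
  by case: (_ == _); case: (_ == _).
split=> [[_ _ h2 h3 h4]|/fan_matchingP[]].
  apply/fan_matchingP; split; rewrite /= ?nlE ?n0E.
  - by apply/negP => e; move: h3; rewrite /gap_count n0E e addn1.
  - by apply/negP => e; move: h3; rewrite /gap_count e.
  move=> i lt; apply/gE => //.
  have [e|ne] := eqVneq i.+1 m.-1; first by rewrite e h4.
  by apply: h2; lia.
rewrite /= ?nlE ?n0E => h0 h1 h2.
have g0 g : (0 < g < m)%N -> gap_count f g = 1%N.
  by case: g => // g hg; apply/gE/h2; lia.
have gz : gap_count f 0 = 0%N by rewrite /gap_count n0E (negPf h0) (negPf h1).
split => //.
- have := sum_fan_angles f; rewrite sum_gaps.
  rewrite (eq_big_nat _ _ (F2 := fun=> 1%N)); last by move=> i hi; apply: g0; lia.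
  by rewrite sum_nat_const_nat muln1 gz g0; lia.
- by move=> g hg; apply: g0; lia.
- by rewrite g0 //; lia.
Qed.
End FanRoot.

Lemma gap_label_inj v base b g g' : (1 < valency v)%N -> injective base ->
  (g < valency v)%N -> (g' < valency v)%N ->
  gap_label v base b g = gap_label v base b g' -> g = g'.
Proof.
move=> m1 bi lt lt'; rewrite /gap_label.
have ne : apex v 0 - 1 <> apex v 0 + 1.
  by apply/eqP; move: (apex v 0); clear; I3.
case: (g =P 0%N) => [->|g0]; case: (g' =P 0%N) => [->|g0'] //.
- by case: eqP => // _ [h]; case: ne; exact: bi.
- by case: eqP => // _ [h]; case: ne; apply: bi; rewrite h.
case: eqP => e; case: eqP => e' //; last by case.
by move=> _; lia.
Qed.

Lemma fan_root_inj v base b i : (1 < valency v)%N -> injective base ->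
  (i < valency v)%N -> injective (fan_root v base b i).
Proof.
move=> m1 bi lt.
have ga g : gap_label v base b g <> inl (base (apex v 0)).
  rewrite /gap_label; case: eqP => _.
    by case=> /bi/eqP; move: (apex v 0); clear; I3.
  case: eqP => // _.
  by case=> /bi/eqP; move: (apex v 0); clear; I3.
have pn : prev_tri v i <> i by rewrite /prev_tri; case: i lt; lia.
have gp : gap_label v base b (prev_tri v i) <> gap_label v base b i.
  by move/gap_label_inj => /(_ m1 bi (prev_tri_lt m1 lt) lt).
have cs k : [|| k == apex v i, k == apex v i + 1 | k == apex v i - 1].
  by move: (apex v i); clear; I3.
have r0 : fan_root v base b i (apex v i) = inl (base (apex v 0)).
  by rewrite /fan_root eqxx.
have r1 : fan_root v base b i (apex v i + 1) = gap_label v base b (prev_tri v i).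
  by rewrite /fan_root eqxx ifF //; move: (apex v i); clear; I3.
have r2 : fan_root v base b i (apex v i - 1) = gap_label v base b i.
  by rewrite /fan_root !ifF //; move: (apex v i); clear; I3.
move=> k k'.
case/or3P: (cs k) => /eqP ->; case/or3P: (cs k') => /eqP -> //;
rewrite ?r0 ?r1 ?r2 // => e;
by first [case: (ga _ e) | case: (ga _ (esym e)) | case: (gp (esym e))].
Qed.

(** * Ends of the arc, plain or notched *)

Definition end_ok (c : 'I_3) (o : option fan) : Prop :=
  if o is Some v then (1 < valency v)%N /\ apex v 0 = c else True.

Definition end_root (o : option fan) (base : 'I_3 -> nat * 'I_3) (b : bool)
    (i : nat) (k : 'I_3) : label :=
  if o is Some v then fan_root v base b i k else inl (base k).

Lemma end_rootE o v base b i k : o = Some v ->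
  end_root o base b i k = fan_root v base b i k.
Proof. by move->. Qed.

Lemma end_okE c o v : end_ok c o -> o = Some v ->
  (1 < valency v)%N /\ apex v 0 = c.
Proof. by case: o => //= u h [<-]. Qed.

Lemma extraP c o j : end_ok c o -> (j < extra o)%N ->
  exists v, [/\ o = Some v, (1 < valency v)%N & (j.+1 < valency v)%N].
Proof. by case: o => //= v [m1 _] lt; exists v; split => //; lia. Qed.

Lemma end_root0 c o base b k : end_ok c o -> end_root o base b 0 k = inl (base k).
Proof. by case: o => [v [m1 _]|_] //=; exact: fan_root0. Qed.

Lemma fan_glue_some (U : finType) (ft : U -> nat -> bool) o (x y : U * 'I_3) :
  fan_glue ft o x y -> exists v, o = Some v.
Proof. by case: o => // v; exists v. Qed.

Lemma fan_glueP (U : finType) (ft : U -> nat -> bool) o v (x y : U * 'I_3) :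
  o = Some v -> (1 < valency v)%N ->
  fan_glue ft o x y <-> exists g, [/\ (g < valency v)%N, ft x.1 g,
    x.2 = apex v g - 1, ft y.1 (next_tri v g) & y.2 = apex v (next_tri v g)].
Proof.
move=> -> m1 /=; split.
  case/existsP => k; rewrite next_triE // => /and4P[h1 /eqP h2 h3 /eqP h4].
  by exists k.
case=> g [lt h1 h2 h3 h4]; apply/existsP; exists (Ordinal lt) => /=.
by rewrite next_triE // h1 h2 h3 h4 !eqxx.
Qed.

Lemma card_graph_sel (S V : finType) (f : S -> V) (p : pred V) : injective f ->
  #|[set x in f @: [set: S] | p x]| = (\sum_(s : S) p (f s))%N.
Proof.
move=> fi; rewrite -sum1_card.
transitivity (\sum_(x in f @: [set: S]) p x)%N.
  rewrite big_mkcond [RHS]big_mkcond; apply: eq_bigr => x _.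
  by rewrite inE; case: (_ \in _); case: (p x).
rewrite big_imset /=; last by move=> ? ? _ _; exact: fi.
by apply: eq_bigl => s; rewrite inE.
Qed.

Lemma sum_nat_delta a b x : (\sum_(a <= i < b) (i == x) = (a <= x < b))%N.
Proof.
transitivity (\sum_(a <= i < b | i == x) 1)%N; last first.
  by rewrite big_nat1_eq; case: (_ && _).
by rewrite [RHS]big_mkcond; apply: eq_bigr => i _; case: (_ == _).
Qed.

(** Seen from the rest of the strip, a filled fan acts like a single triangle with the angle q; a
    plain end is such a triangle already. *)
Definition filling (o : option fan) (g : nat -> 'I_3) (q : 'I_3) : Prop :=
  if o is Some v then fan_filling v (fun i => g i - apex v i) (q - apex v 0)
  else g 0%N = q.

Definition end_count (o : option fan) (base : 'I_3 -> nat * 'I_3) (b : bool)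
    (g : nat -> 'I_3) (l : label) : nat :=
  (\sum_(i < (extra o).+1) (end_root o base b i (g i) == l))%N.

Lemma sub_eq1 (a b : 'I_3) : (a - b == 1) = (a == b + 1).
Proof. by rewrite subr_eq addrC. Qed.

Lemma sub_eqN1 (a b : 'I_3) : (a - b == -1) = (a == b - 1).
Proof. by rewrite subr_eq addrC. Qed.

Lemma end_count_fan v base b g l : (1 < valency v)%N ->
  let f i := g i - apex v i in
  (end_count (Some v) base b g l =
   (\sum_(i < valency v) (f i == 0)%R) * (inl (base (apex v 0)) == l) +
   (gap_count v f 0 * (inl (base (apex v 0 - 1)%R) == l) +
    gap_count v f (valency v).-1 * (inl (base (apex v 0 + 1)%R) == l) +
    \sum_(1 <= i < (valency v).-1) gap_count v f i * (inr (b, i) == l)))%N.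
Proof.
move=> m1 f; rewrite /end_count /= prednK ?(ltnW m1) //.
rewrite sum_fan_root //.
rewrite (sum_gaps m1 (fun i => gap_count v f i * (gap_label v base b i == l))%N).
congr (_ + (_ + _ + _))%N.
  rewrite /gap_label prednK ?eqxx ?(ltnW m1) // (_ : (_ == 0%N) = false) //; lia.
apply: eq_big_nat => i hi; rewrite /gap_label !ifF //; lia.
Qed.

(** Apart from the angle q, a filled fan contributes exactly one angle at the puncture and one at
    each outer end that is not in the strip. *)
Lemma end_count_filling c o base b g q l : end_ok c o -> filling o g q ->
  (end_count o base b g l = (inl (base q) == l) +
   (if o is Some v then (inl (base (apex v 0)) == l) +
      \sum_(1 <= i < (valency v).-1) (inr (b, i) == l) else 0))%N.
Proof.
case: o => [v|] /=; last first.
  by move=> _ <-; rewrite /end_count big_ord_recl big_ord0 !addn0.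
move=> [m1 _] [q0 f0 fm fN f1].
rewrite end_count_fan // f0 fN f1 mul1n.
rewrite (eq_big_nat _ _ (F2 := fun i => (inr (b, i) == l : nat))); last first.
  by move=> i hi; rewrite fm ?mul1n //; lia.
rewrite sub_eq1 sub_eqN1; move: q0; rewrite subr_eq0 => q0.
have : (q == apex v 0 + 1) || (q == apex v 0 - 1).
  by move: q0; move: (apex v 0); clear; I3.
case/orP => /eqP ->.
  rewrite (_ : (_ == _ - 1) = false) ?eqxx; last by move: (apex v 0); clear; I3.
  by rewrite mul0n add0n mul1n addnCA.
rewrite (_ : (_ == _ + 1) = false) ?eqxx; last by move: (apex v 0); clear; I3.
by rewrite mul0n addn0 mul1n addnCA.
Qed.

Lemma filling_exists c o base b g : end_ok c o -> injective base ->
  (o -> end_count o base b g (inl (base c)) = 1%N) ->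
  (forall v i, o = Some v -> (0 < i < (valency v).-1)%N ->
     end_count o base b g (inr (b, i)) = 1%N) ->
  exists q, filling o g q.
Proof.
case: o => [v|] /=; last by exists (g 0%N).
move=> [m1 <-] bi h0 hi; pose f i := g i - apex v i.
have [|i hi'|q hq] := @fan_filling_exists v m1 f.
- rewrite -[RHS]h0 // end_count_fan // eqxx muln1.
  rewrite !(inj_eq (@inl_inj _ _)) !(inj_eq bi).
  rewrite (_ : (_ - 1 == _) = false); last by move: (apex v 0); clear; I3.
  rewrite (_ : (_ + 1 == _) = false); last by move: (apex v 0); clear; I3.
  rewrite !muln0 !add0n [X in _ = (_ + X)%N]big1 ?addn0 // => i _.
  by rewrite muln0.
- rewrite -[RHS](hi v i) // end_count_fan // !muln0 !add0n.
  rewrite (bigD1_seq i) ?iota_uniq ?mem_index_iota //=.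
  rewrite eqxx muln1 big1 ?addn0 // => j ji.
  by rewrite (inj_eq (@inr_inj _ _)) xpair_eqE eqxx /= (negPf ji) muln0.
by exists (q + apex v 0); rewrite /= addrK.
Qed.

(** The decidable form provided by [fan_fillingN] and [fan_filling1]: q decides where the fan is cut
    open. *)
Definition fillingb (o : option fan) (g : nat -> 'I_3) (q : 'I_3) : bool :=
  if o is Some v then
    (q != apex v 0) && fan_matching (valency v)
      (fun i => let j := if q == apex v 0 + 1 then next_tri v i else i in
                g j - apex v j)
  else g 0%N == q.

Lemma fillingP c o g q : end_ok c o ->
  reflect (filling o g q) (fillingb o g q).
Proof.
case: o => [v|] /=; last by move=> _; exact: eqP.
move=> [m1 _]; apply: (iffP andP).
  case=> q0; case: eqP => [->|/eqP q1].
    rewrite addrAC subrr add0r => h.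
    exact: (fan_filling1 m1 (fun i => g i - apex v i)).2 h.
  rewrite (_ : q - _ = -1); first by move/(fan_fillingN m1).
  by apply/eqP; move: q0 q1; move: (apex v 0); clear; I3.
move=> h; have q0 : q != apex v 0 by case: h => + _ _ _ _; rewrite subr_eq0.
split=> //; case: eqP => [qE|/eqP q1].
  move: h; rewrite qE addrAC subrr add0r => h.
  exact: (fan_filling1 m1 (fun i => g i - apex v i)).1 h.
move: h; rewrite (_ : q - _ = -1); first by move/(fan_fillingN m1).
by apply/eqP; move: q0 q1; move: (apex v 0); clear; I3.
Qed.

Lemma filling_inj o g q q' : filling o g q -> filling o g q' -> q = q'.
Proof.
case: o => [v|] /=; last by move=> -> ->.
by move=> h /(fan_filling_inj h)/addIr.
Qed.

Lemma eq_filling c o g g' q : end_ok c o ->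
  (forall i, (i <= extra o)%N -> g i = g' i) -> filling o g q -> filling o g' q.
Proof.
case: o => [v|] /=; last by move=> _ e <-; rewrite e.
move=> [m1 _] e; apply: eq_fan_filling => // i lt.
by rewrite e //; lia.
Qed.

Definition end_size (o : option fan) : nat :=
  if o is Some v then #|fan_matchings (valency v)| else 1%N.

(** Either cut gives a chain of m triangles, so the number does not depend on q. *)
Lemma card_fillings c o q : end_ok c o -> q != c ->
  #|[set g : {ffun 'I_(extra o).+1 -> 'I_3} | fillingb o (extend g) q]| =
  end_size o.
Proof.
case: o => [v|] /=; last first.
  move=> _ _; apply/eqP/cards1P; exists [ffun=> q]; apply/setP => g.
  rewrite !inE; apply/eqP/eqP => [h|->]; last by rewrite (extend_ffun (fun=> q)).
  apply: eq_extend => -[|//] _; rewrite h (extend_ffun (fun=> q)) //.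
move=> [m1 <-] qa; have mE := prednK (ltnW m1).
rewrite -[in RHS]mE qa /=.
pose s i := if q == apex v 0 + 1 then next_tri v i else i.
pose f (g : {ffun 'I_(valency v).-1.+1 -> 'I_3}) :=
  [ffun i : 'I_(valency v).-1.+1 => extend g (s i) - apex v (s i)].
have fE g i : (i < valency v)%N -> extend (f g) i = extend g (s i) - apex v (s i).
  by move=> lt; rewrite (extend_ffun (fun i => extend g (s i) - apex v (s i))) ?mE.
have f_inj : injective f.
  move=> g g' e; apply: eq_extend => i lt'.
  have lt : (i < valency v)%N by rewrite -mE.
  have [j lj <-] : exists2 j, (j < valency v)%N & s j = i.
    rewrite /s; case: eqP => _; last by exists i.
    by exists (prev_tri v i); [exact: prev_tri_lt | exact: prev_triK].
  by have := fE g j lj; rewrite e fE // => /addIr.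
rewrite -[RHS](card_preimset _ f_inj); apply: eq_card => g; rewrite !inE.
transitivity (fan_matching (valency v) (extend (f g))); last first.
  exact: (congr1 (fun m => fan_matching m (extend (f g))) (esym mE)).
apply: eq_fan_matching; first exact: ltnW.
by move=> i lt; rewrite fE.
Qed.

(** * Labels of the vertices of the polygon *)

Section Polygon.
Variables (w : strip) (fq fp : option fan).
Local Notation n := (len w).
Local Notation P := (arc_polygon w fq fp).
Local Notation tri := (arc_tri n fq fp).
Hypotheses (w_ok : nonreturning w).
Hypotheses (fp_ok : end_ok (newc w n) fp) (fq_ok : end_ok (oldc w 0) fq).

Let n0 : (0 < n)%N := len_gt0 w_ok.

Definition q_base (k : 'I_3) : nat * 'I_3 := (0%N, k).

Definition root (x : tri * 'I_3) : label :=
  match x.1 with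
  | inl i => inl (strip_root w i x.2)
  | inr (inl j) => end_root fp (strip_root w n) true j.+1 x.2
  | inr (inr j) => end_root fq q_base false j.+1 x.2
  end.

Lemma root_p t k c v : fp = Some v -> p_fan_tri t k ->
  root (t, c) = fan_root v (strip_root w n) true k c.
Proof.
move=> E; have [m1 _] := end_okE fp_ok E.
case: t => [i|[j|j]] //=; last first.
  by move=> /eqP ->; rewrite /root /= (end_rootE _ _ _ _ E).
by case/andP=> /eqP ei /eqP ->; rewrite fan_root0 // /root /= ei.
Qed.

Lemma root_q t k c v : fq = Some v -> q_fan_tri t k ->
  root (t, c) = fan_root v q_base false k c.
Proof.
move=> E; have [m1 _] := end_okE fq_ok E.
case: t => [i|[j|j]] //=; last first.
  by move=> /eqP ->; rewrite /root /= (end_rootE _ _ _ _ E).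
by case/andP=> /eqP ei /eqP ->; rewrite fan_root0 // /root /= ei.
Qed.

Lemma root_inj t : injective (fun k => root (t, k)).
Proof.
case: t => [i|[j|j]] k k' /=.
- by rewrite /root /= => -[] /strip_root_inj.
- have [v [E m1 lt]] := extraP fp_ok (ltn_ord j).
  rewrite /root /= !(end_rootE _ _ _ _ E); apply: fan_root_inj => //.
  exact: strip_root_inj.
have [v [E m1 lt]] := extraP fq_ok (ltn_ord j).
rewrite /root /= !(end_rootE _ _ _ _ E); apply: fan_root_inj => //.
by move=> a a' [].
Qed.

Definition half_glue (x y : tri * 'I_3) : bool :=
  [|| strip_glue x y, fan_glue (@p_fan_tri n fq fp) fp x y
    | fan_glue (@q_fan_tri n fq fp) fq x y].

Lemma pglueE (x y : tri * 'I_3) :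
  pglue (p := P) x y = half_glue x y || half_glue y x.
Proof. by []. Qed.

Lemma pglue_sym (x y : tri * 'I_3) : pglue (p := P) x y = pglue (p := P) y x.
Proof. by rewrite !pglueE orbC. Qed.

Lemma fan_root_glue v base b g : (1 < valency v)%N -> (g < valency v)%N ->
  fan_root v base b g (apex v g - 1) =
  fan_root v base b (next_tri v g) (apex v (next_tri v g) + 1) /\
  fan_root v base b g (apex v g - 1 + 1) =
  fan_root v base b (next_tri v g) (apex v (next_tri v g)).
Proof.
move=> m1 lt; rewrite subrK /fan_root !eqxx; split => //.
rewrite !ifF; try by move: (apex v _); clear; I3.
by rewrite next_triK.
Qed.

Lemma half_glue_root x y : half_glue x y ->
  root x = root (y.1, y.2 + 1) /\ root (x.1, x.2 + 1) = root y.
Proof.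
case: x y => [t a] [u c] /or3P[].
- case: t u => [i|//] [j|//] /and3P[/= /eqP ij /eqP -> /eqP ->].
  have ei : entry w j = newc w j + 1 by rewrite ij newcE subrK.
  rewrite /root /= ij !strip_root_cross /cross -?ij.
  + split; congr (inl (strip_root _ _ _)); apply/eqP; rewrite ?ij;
    by move: (entry _ _) (exit _ _); clear; I3.
  + by rewrite ij newcE; move: (entry _ _); clear; I3.
  + by rewrite ij newcE; move: (entry _ _); clear; I3.
- move=> h; have [v E] := fan_glue_some h; have [m1 _] := end_okE fp_ok E.
  case/(fan_glueP _ _ _ E m1): h => g [lt /= h1 -> h2 ->].
  rewrite !(root_p _ E h1) !(root_p _ E h2); exact: fan_root_glue.
- move=> h; have [v E] := fan_glue_some h; have [m1 _] := end_okE fq_ok E.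
  case/(fan_glueP _ _ _ E m1): h => g [lt /= h1 -> h2 ->].
  rewrite !(root_q _ E h1) !(root_q _ E h2); exact: fan_root_glue.
Qed.

Lemma meet_corners_root (x y : tri * 'I_3) :
  meet_corners (P := P) x y -> root x = root y.
Proof.
have H (u z : tri * 'I_3) : pglue (p := P) u z ->
    root u = root (z.1, z.2 + 1) /\ root (u.1, u.2 + 1) = root z.
  by rewrite pglueE => /orP[/half_glue_root // | /half_glue_root[-> ->]].
case: x y => [t a] [u c]; case/orP => /H[/=]; first by rewrite subrK.
by move=> _ /=; rewrite subrK.
Qed.

Lemma meet_corners_sym : symmetric (meet_corners (P := P)).
Proof. by move=> x y; rewrite /meet_corners orbC pglue_sym [X in _ || X]pglue_sym. Qed.

Local Notation linked := (connect (meet_corners (P := P))).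

Lemma linked_sym (x y : tri * 'I_3) : linked x y = linked y x.
Proof. exact: (sym_connect_sym meet_corners_sym). Qed.

Lemma glue_linked (t u : tri) (a c : 'I_3) : pglue (p := P) (t, a) (u, c) ->
  linked (t, a) (u, c + 1) /\ linked (t, a + 1) (u, c).
Proof.
move=> h; have h1 : pglue (p := P) (t, a) (u, c + 1 - 1) by rewrite addrK.
have h2 : pglue (p := P) (t, a + 1 - 1) (u, c) by rewrite addrK.
by split; apply: connect1; apply/orP; [left; exact: h1 | right; exact: h2].
Qed.

(** Turning around the puncture links every apex to that of triangle 0 and every other corner to a
    corner [apex v g - 1], which is canonical or, for the first and last diagonals, linked to
    triangle 0. *)
Lemma fan_linked (T : nat -> tri) v (C : tri * 'I_3 -> Prop) :
  (1 < valency v)%N ->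
  (forall g, (g < valency v)%N ->
     pglue (p := P) (T g, apex v g - 1)
           (T (next_tri v g), apex v (next_tri v g))) ->
  (forall c, exists2 z, linked (T 0%N, c) z & C z) ->
  (forall g, (0 < g < (valency v).-1)%N -> C (T g, apex v g - 1)) ->
  forall i c, (i < valency v)%N -> exists2 z, linked (T i, c) z & C z.
Proof.
move=> m1 hg h0 hC i c lt.
have step g : (g < valency v)%N ->
    linked (T g, apex v g - 1) (T (next_tri v g), apex v (next_tri v g) + 1) /\
    linked (T g, apex v g) (T (next_tri v g), apex v (next_tri v g)).
  by move=> /hg/glue_linked[h1 h2]; split=> //; rewrite subrK in h2.
have nE g : (g.+1 < valency v)%N -> next_tri v g = g.+1.
  by move=> h; rewrite /next_tri ltn_eqF.
have after g : (g < valency v)%N ->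
    exists2 z, linked (T g, apex v g - 1) z & C z.
  move=> ltg; have [->|g0] := posnP g; first exact: h0.
  have [gm|ge] := ltnP g.+1 (valency v).
    by exists (T g, apex v g - 1); [exact: connect0 | apply: hC; lia].
  have [+ _] := step g ltg; rewrite /next_tri ifT; last by lia.
  move=> h; have [z hz Cz] := h0 (apex v 0 + 1).
  by exists z => //; exact: connect_trans hz.
have : [|| c == apex v i, c == apex v i + 1 | c == apex v i - 1].
  by move: (apex v i); clear; I3.
case/or3P => /eqP ->; last exact: after.
  suff h : linked (T i, apex v i) (T 0%N, apex v 0).
    have [z hz Cz] := h0 (apex v 0); exists z => //; exact: connect_trans hz.
  elim: i lt => // i IH lt; apply: connect_trans (IH (ltnW lt)).
  by rewrite linked_sym; have [_] := step i (ltnW lt); rewrite nE.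
case: i lt => // i lt.
have [z hz Cz] := after i (ltnW lt); exists z => //; apply: connect_trans hz.
by rewrite linked_sym; have [+ _] := step i (ltnW lt); rewrite nE.
Qed.

Definition p_tri (k : nat) : tri :=
  if k is j.+1 then (if insub j is Some i then inr (inl i) else inl ord_max)
  else inl ord_max.

Definition q_tri (k : nat) : tri :=
  if k is j.+1 then (if insub j is Some i then inr (inr i) else inl ord0)
  else inl ord0.

Lemma p_fan_tri_p k : (k <= extra fp)%N -> p_fan_tri (p_tri k) k.
Proof.
case: k => [|k] lt /=; first by rewrite !eqxx.
by rewrite insubT /=.
Qed.

Lemma q_fan_tri_q k : (k <= extra fq)%N -> q_fan_tri (q_tri k) k.
Proof.
case: k => [|k] lt //=.
by rewrite insubT /=.
Qed.

Lemma p_tri_glue v g : fp = Some v -> (1 < valency v)%N -> (g < valency v)%N ->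
  pglue (p := P) (p_tri g, apex v g - 1)
    (p_tri (next_tri v g), apex v (next_tri v g)).
Proof.
move=> E m1 lt; rewrite pglueE; apply/orP; left; apply/or3P; apply: Or32.
have xE : extra fp = (valency v).-1 by rewrite E.
apply/(fan_glueP _ _ _ E m1); exists g; split => //=.
  by apply: p_fan_tri_p; rewrite xE; lia.
by apply: p_fan_tri_p; rewrite xE; have := next_tri_lt m1 lt; lia.
Qed.

Lemma q_tri_glue v g : fq = Some v -> (1 < valency v)%N -> (g < valency v)%N ->
  pglue (p := P) (q_tri g, apex v g - 1)
    (q_tri (next_tri v g), apex v (next_tri v g)).
Proof.
move=> E m1 lt; rewrite pglueE; apply/orP; left; apply/or3P; apply: Or33.
have xE : extra fq = (valency v).-1 by rewrite E.
apply/(fan_glueP _ _ _ E m1); exists g; split => //=.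
  by apply: q_fan_tri_q; rewrite xE; lia.
by apply: q_fan_tri_q; rewrite xE; have := next_tri_lt m1 lt; lia.
Qed.

Lemma strip_tri_glue (i j : 'I_n.+1) : j = i.+1 :> nat ->
  pglue (p := P) (inl i, exit w i) (inl j, entry w j).
Proof.
move=> ij; rewrite pglueE; apply/orP; left; apply/or3P; apply: Or31.
by rewrite /strip_glue /= ij !eqxx.
Qed.

(** One corner per vertex: in the strip the corner of smallest triangle index, and for an outer end
    beyond the strip the copy in the fan triangle preceding its diagonal. *)
Definition canonical_corner (z : tri * 'I_3) : Prop :=
  match z.1 with
  | inl i => strip_root w i z.2 = (i : nat, z.2)
  | inr (inl j) => root z = inr (true, j.+1)
  | inr (inr j) => root z = inr (false, j.+1)
  end.

Lemma canonical_corner_inj y z : canonical_corner y -> canonical_corner z ->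
  root y = root z -> y = z.
Proof.
case: y z => [t a] [u c].
have H b b' : t = u -> root (t, b) = root (u, b') -> (t, b) = (u, b').
  by move=> <- /(@root_inj t) ->.
case: t u H => [i|[j|j]] [i'|[j'|j']] H; rewrite /canonical_corner /=.
- move=> e e' r; apply: H => //.
  by move: r; rewrite /root /= e e' => -[/val_inj -> _].
- by move=> _ ->.
- by move=> _ ->.
- by move=> ->.
- move=> e e' r; apply: H => //.
  by move: r; rewrite e e' => -[/val_inj ->].
- by move=> -> ->.
- by move=> ->.
- by move=> -> ->.
move=> e e' r; apply: H => //.
by move: r; rewrite e e' => -[/val_inj ->].
Qed.

Lemma linked_canonical (x : tri * 'I_3) :
  exists2 z, linked x z & canonical_corner z.
Proof.
have strip (i : 'I_n.+1) k : exists2 z, linked (inl i, k) z & canonical_corner z.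
  case: i => i; elim: i k => [|i IH] k lt.
    by exists (inl (Ordinal lt), k) => //; exact: connect0.
  have [e|ne] := eqVneq k (newc w i.+1).
    exists (inl (Ordinal lt), k); first exact: connect0.
    exact: strip_root_new (ltn0Sn i) e.
  have [z hz Cz] := IH (cross w i k) (ltnW lt); exists z => //.
  apply: connect_trans hz; rewrite linked_sym.
  have [h1 h2] := glue_linked (@strip_tri_glue (Ordinal (ltnW lt)) (Ordinal lt) erefl).
  have : (k == entry w i.+1) || (k == entry w i.+1 + 1).
    by move: ne; rewrite newcE; move: (entry _ _); clear; I3.
  case/orP => /eqP ->; rewrite /cross.
    rewrite (_ : _ + _ + _ - _ = exit w i + 1) //; apply/eqP.
    by move: (entry _ _) (exit _ _); clear; I3.
  rewrite (_ : _ + _ + _ - _ = exit w i) //; apply/eqP.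
  by move: (entry _ _) (exit _ _); clear; I3.
case: x => [[i|[j|j]] k]; first exact: strip.
- have [v [E m1 lt]] := extraP fp_ok (ltn_ord j).
  have -> : inr (inl j) = p_tri j.+1 by rewrite /= valK.
  apply: (fan_linked (v := v)) => //.
  + by move=> g lg; exact: p_tri_glue.
  + by move=> c; exact: strip.
  move=> [//|g] hg; have lg : (g < extra fp)%N by rewrite E /=; lia.
  have r : root (p_tri g.+1, apex v g.+1 - 1) = inr (true, g.+1).
    rewrite (root_p _ E (p_fan_tri_p lg)) /fan_root /gap_label !ifF //; try lia.
      by move: (apex v _); clear; I3.
    by move: (apex v _); clear; I3.
  by move: r; rewrite /= insubT.
have [v [E m1 lt]] := extraP fq_ok (ltn_ord j).
have -> : inr (inr j) = q_tri j.+1 by rewrite /= valK.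
apply: (fan_linked (v := v)) => //.
+ by move=> g lg; exact: q_tri_glue.
+ by move=> c; exact: strip.
move=> [//|g] hg; have lg : (g < extra fq)%N by rewrite E /=; lia.
have r : root (q_tri g.+1, apex v g.+1 - 1) = inr (false, g.+1).
  rewrite (root_q _ E (q_fan_tri_q lg)) /fan_root /gap_label !ifF //; try lia.
    by move: (apex v _); clear; I3.
  by move: (apex v _); clear; I3.
by move: r; rewrite /= insubT.
Qed.

Lemma vertexE (x y : tri * 'I_3) :
  (y \in vertex (P := P) x) = (root x == root y).
Proof.
rewrite inE; apply/idP/eqP; first exact: (connect_invariant meet_corners_root).
move=> xy; have [s xs cs] := linked_canonical x; have [t yt ct] := linked_canonical y.
have st : s = t.
  apply: canonical_corner_inj => //.
  rewrite -(connect_invariant meet_corners_root xs) xy.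
  exact: (connect_invariant meet_corners_root yt).
by apply: connect_trans xs _; rewrite st linked_sym.
Qed.

Definition plain_end (x : tri * 'I_3) : bool :=
  match x.1 with
  | inl i => (~~ fq && (i == 0%N :> nat) && (x.2 == oldc w 0)) ||
             (~~ fp && (i == n :> nat) && (x.2 == newc w n))
  | inr _ => false
  end.

Lemma strip_root_first i k : (i <= n)%N -> strip_root w i k = (0%N, oldc w 0) ->
  i = 0%N /\ k = oldc w 0.
Proof.
case: i => [|i] le e; first by case: e.
by have := @strip_root_old w 0 i.+1 k; rewrite ltn0Sn le e eqxx => /(_ isT).
Qed.

Lemma strip_root_last i k : (i <= n)%N -> strip_root w i k = (n, newc w n) ->
  i = n /\ k = newc w n.
Proof.
move=> le e; have ei : i = n.
  by apply/eqP; rewrite eqn_leq le /=; have := strip_root_le w i k; rewrite e.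
split=> //; move: e; rewrite ei -(strip_root_n w_ok); exact: strip_root_inj.
Qed.

Lemma fan_root_base v base b i k r :
  fan_root v base b i k = inl r -> exists k', r = base k'.
Proof.
rewrite /fan_root /gap_label.
by do 2?case: ifP => _; do 2?case: ifP => _; (try case) => // <-; eexists.
Qed.

Lemma root_first (x : tri * 'I_3) : ~~ fq -> root x = inl (0%N, oldc w 0) ->
  x = (inl ord0, oldc w 0).
Proof.
move=> fq0; case: x => [[i|[j|j]] k]; rewrite /root /=.
- case=> /strip_root_first[|+ ->]; first by rewrite -ltnS.
  by move=> i0; congr (inl _, _); apply: val_inj.
- have [v [E m1 lt]] := extraP fp_ok (ltn_ord j).
  rewrite (end_rootE _ _ _ _ E) => /fan_root_base[k' /esym/strip_root_first[] //].
  by move=> e; move: n0; rewrite e.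
by have [v [E _ _]] := extraP fq_ok (ltn_ord j); rewrite E in fq0.
Qed.

Lemma root_last (x : tri * 'I_3) : ~~ fp -> root x = inl (n, newc w n) ->
  x = (inl ord_max, newc w n).
Proof.
move=> fp0; case: x => [[i|[j|j]] k]; rewrite /root /=.
- case=> /strip_root_last[|+ ->]; first by rewrite -ltnS.
  by move=> i0; congr (inl _, _); apply: val_inj.
- by have [v [E _ _]] := extraP fp_ok (ltn_ord j); rewrite E in fp0.
have [v [E m1 lt]] := extraP fq_ok (ltn_ord j).
rewrite (end_rootE _ _ _ _ E) => /fan_root_base[k' [e _]].
by move: n0; rewrite e.
Qed.

Lemma plain_end_cases (x : tri * 'I_3) : plain_end x ->
  (~~ fq /\ x = (inl ord0, oldc w 0)) \/ (~~ fp /\ x = (inl ord_max, newc w n)).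
Proof.
case: x => [[i|//] k]; rewrite /plain_end /=.
case/orP=> /andP[/andP[f /eqP e] /eqP ->]; [left|right];
by split=> //; congr (inl _, _); apply: val_inj.
Qed.

Lemma plain_end_root (x y : tri * 'I_3) : plain_end x -> root x = root y -> y = x.
Proof.
case/plain_end_cases => -[f ->] /esym.
  by move=> h; rewrite (root_first f h).
rewrite {2}/root /= strip_root_n // => h; exact: root_last.
Qed.

Lemma diagonal_inl (i : 'I_n.+1) s : Defs.diagonal (P := P) (inl i, s) ->
  [|| (i < n)%N && (s == exit w i), (0 < i)%N && (s == entry w i),
      fp && (i == n :> nat) | fq && (i == 0%N :> nat)].
Proof.
case/existsP => -[u c]; rewrite pglueE.
case/orP => /or3P[].
- case: u => // j; rewrite /strip_glue /= => /and3P[/eqP ij -> _].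
  by have := ltn_ord j; rewrite ij ltnS => ->.
- move=> h; have [v E] := fan_glue_some h; have [m1 _] := end_okE fp_ok E.
  case/(fan_glueP _ _ _ E m1): h => g [_ /= /andP[-> _] _ _ _].
  by rewrite E /= !orbT.
- move=> h; have [v E] := fan_glue_some h; have [m1 _] := end_okE fq_ok E.
  case/(fan_glueP _ _ _ E m1): h => g [_ /= /andP[-> _] _ _ _].
  by rewrite E /= !orbT.
- case: u => // j; rewrite /strip_glue /= => /and3P[/eqP -> _ ->].
  by rewrite !orbT.
- move=> h; have [v E] := fan_glue_some h; have [m1 _] := end_okE fp_ok E.
  case/(fan_glueP _ _ _ E m1): h => g [_ /= _ _ /andP[-> _] _].
  by rewrite E /= !orbT.
move=> h; have [v E] := fan_glue_some h; have [m1 _] := end_okE fq_ok E.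
case/(fan_glueP _ _ _ E m1): h => g [_ /= _ _ /andP[-> _] _].
by rewrite E /= !orbT.
Qed.

Lemma glue_diagonal (x y : tri * 'I_3) : pglue (p := P) x y ->
  Defs.diagonal (P := P) x /\ Defs.diagonal (P := P) y.
Proof.
by move=> h; split; apply/existsP; [exists y | exists x; rewrite pglue_sym].
Qed.

Lemma fan_corner_diagonal (T : nat -> tri) v g c : (1 < valency v)%N ->
  (forall g, (g < valency v)%N ->
     pglue (p := P) (T g, apex v g - 1)
           (T (next_tri v g), apex v (next_tri v g))) ->
  (g < valency v)%N ->
  Defs.diagonal (P := P) (T g, c) || Defs.diagonal (P := P) (T g, c - 1).
Proof.
move=> m1 hg lt; have [d1 _] := glue_diagonal (hg g lt).
have [_ d2] := glue_diagonal (hg _ (prev_tri_lt m1 lt)).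
rewrite prev_triK // in d2.
have : [|| c == apex v g, c == apex v g + 1 | c == apex v g - 1].
  by move: (apex v g); clear; I3.
by case/or3P => /eqP ->; rewrite ?d1 ?d2 ?addrK ?d2 ?orbT.
Qed.

(** At a plain end the end triangle has a single glued side, and the end of the arc is opposite to
    it; no other triangle meets that vertex. *)
Lemma on_diagonalE (x : tri * 'I_3) : on_diagonal (P := P) x = ~~ plain_end x.
Proof.
apply/existsP/idP.
  case=> y /andP[]; rewrite vertexE => /eqP xy; apply: contraTN => px.
  rewrite (plain_end_root px xy) negb_or.
  have n0' : (n == 0%N) = false by rewrite eqn0Ngt n0.
  case/plain_end_cases: px => -[f -> /=].
    apply/andP; split; apply/negP => /diagonal_inl /=;
    rewrite n0 (negPf f) [0%N == n]eq_sym n0' /= andbF !orbF oldcE //.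
      by move: (exit w 0); clear; I3.
    by move: (exit w 0); clear; I3.
  have nE : newc w n = entry w n - 1 by rewrite /newc n0'.
  apply/andP; split; apply/negP => /diagonal_inl /=;
  rewrite n0' ltnn n0 (negPf f) /= andbF !orbF nE.
    by move: (entry w n); clear; I3.
  by move: (entry w n); clear; I3.
move=> px; exists x; rewrite vertexE eqxx /=.
case: x px => [[i|[j|j]] k] px; last first.
- have [v [E m1 lt]] := extraP fq_ok (ltn_ord j).
  have -> : inr (inr j) = q_tri j.+1 by rewrite /= valK.
  by apply: (fan_corner_diagonal (v := v)) => // g lg; exact: q_tri_glue.
- have [v [E m1 lt]] := extraP fp_ok (ltn_ord j).
  have -> : inr (inl j) = p_tri j.+1 by rewrite /= valK.
  by apply: (fan_corner_diagonal (v := v)) => // g lg; exact: p_tri_glue.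
rewrite /=; have le : (i <= n)%N by rewrite -ltnS.
have out : (i < n)%N -> k != oldc w i ->
    Defs.diagonal (P := P) (inl i, k) || Defs.diagonal (P := P) (inl i, k - 1).
  move=> lt ko; have lt' : (i.+1 < n.+1)%N by [].
  have [d _] := glue_diagonal (@strip_tri_glue i (Ordinal lt') erefl).
  have : (k == exit w i) || (k == exit w i + 1).
    by move: ko; rewrite oldcE //; move: (exit _ _); clear; I3.
  by case/orP => /eqP ->; rewrite ?addrK d ?orbT.
have inn : (0 < i)%N -> k != newc w i ->
    Defs.diagonal (P := P) (inl i, k) || Defs.diagonal (P := P) (inl i, k - 1).
  move=> i0 kn; have lt' : (i.-1 < n.+1)%N by lia.
  have [_ d] := glue_diagonal (@strip_tri_glue (Ordinal lt') i (esym (prednK i0))).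
  have : (k == entry w i) || (k == entry w i + 1).
    by move: kn; rewrite /newc eqn0Ngt i0; move: (entry _ _); clear; I3.
  by case/orP => /eqP ->; rewrite ?addrK d ?orbT.
have [i0|i0] := posnP i.
  have [ko|] := eqVneq k (oldc w i); last by apply: out; rewrite i0.
  have : exists v, fq = Some v.
    move: px; rewrite /plain_end /= i0 eqxx /= ko i0 eqxx andbT.
    by case: fq => [v|//] _; exists v.
  case=> v E; have [m1 _] := end_okE fq_ok E.
  have -> : inl i = q_tri 0 by congr inl; apply: val_inj.
  apply: (fan_corner_diagonal (v := v)) => //; last exact: ltnW.
  by move=> g lg; exact: q_tri_glue.
have [kn|] := eqVneq k (newc w i); last exact: inn.
have [lt|ge] := ltnP i n.
  by apply: out => //; rewrite kn eq_sym oldc_newc.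
have ei : i = n :> nat by apply/eqP; rewrite eqn_leq le.
have : exists v, fp = Some v.
  move: px; rewrite /plain_end /= ei eqxx /= kn ei eqxx !andbT.
  by case: fp => [v|]; [exists v | rewrite orbT].
case=> v E; have [m1 _] := end_okE fp_ok E.
have -> : inl i = p_tri 0 by congr inl; apply: val_inj.
apply: (fan_corner_diagonal (v := v)) => //; last exact: ltnW.
by move=> g lg; exact: p_tri_glue.
Qed.

Lemma diagonal_vertexP (v : {set tri * 'I_3}) :
  reflect (exists2 x, ~~ plain_end x & v = vertex (P := P) x)
          (v \in diagonal_vertices P).
Proof.
apply: (iffP imsetP) => -[x]; first by rewrite inE on_diagonalE; exists x.
by move=> h ->; exists x; rewrite // inE on_diagonalE.
Qed.

(** * Counting the matchings of angles *)

Definition corner_count_at (c : tri -> 'I_3) (l : label) : nat :=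
  (\sum_(t : tri) (root (t, c t) == l))%N.

Definition corner_matching (c : tri -> 'I_3) : bool :=
  [forall x : tri * 'I_3, plain_end x || (corner_count_at c (root x) == 1%N)].

Definition corner_set (c : tri -> 'I_3) : {set ptri P * 'I_3} :=
  [set x : tri * 'I_3 | x.2 == c x.1].

Lemma card_corner_set (c : tri -> 'I_3) (p : pred (tri * 'I_3)) :
  #|[set x in corner_set c | p x]| = (\sum_(t : tri) p (t, c t))%N.
Proof.
have -> : corner_set c = [set (t, c t) | t in [set: tri]].
  apply/setP => -[t k]; rewrite inE; apply/eqP/imsetP => [/= ->|[u _ [-> ->]]] //.
  by exists t; rewrite ?inE.
by apply: card_graph_sel => t u [].
Qed.

Lemma angle_matchingP (A : {set ptri P * 'I_3}) :
  reflect (exists2 c : {ffun tri -> 'I_3}, corner_matching c & A = corner_set c)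
          (angle_matching A).
Proof.
have vE c x : #|[set y in corner_set c | y \in vertex (P := P) x]| =
    corner_count_at c (root x).
  rewrite (card_corner_set c (fun y => y \in vertex (P := P) x)).
  by apply: eq_bigr => t _; rewrite vertexE eq_sym.
apply: (iffP andP) => [[/forall_inP hv /forallP ht]|[c hc ->]]; last first.
  split; last first.
    apply/forallP => t; rewrite (card_corner_set c (fun x => x.1 == t)) /=.
    by rewrite (bigD1 t) //= eqxx big1 ?addn0 // => u /negPf ->.
  apply/forall_inP => v /diagonal_vertexP[x px ->]; rewrite vE.
  by have := forallP hc x; rewrite (negPf px).
have ex t : exists k, (t, k) \in A.
  have := ht t; rewrite -(inj_eq succn_inj) => /eqP[] e.
  have : (0 < #|[set x in A | x.1 == t]|)%N by rewrite e.
  case/card_gt0P => -[u k]; rewrite inE /= => /andP[h /eqP <-].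
  by exists k.
pose c := [ffun t : tri => xchoose (ex t)].
have AE : A = corner_set c.
  apply/setP => -[t k]; rewrite inE /= ffunE.
  have ct := xchooseP (ex t); apply/idP/eqP => [h|-> //].
  have /cards1P[y yE] := ht t.
  have : (t, k) \in [set x in A | x.1 == t] by rewrite inE h /= eqxx.
  have : (t, xchoose (ex t)) \in [set x in A | x.1 == t] by rewrite inE ct /= eqxx.
  by rewrite yE !inE => /eqP <- /eqP[].
exists c => //; apply/forallP => x; have [//|px] /= := boolP (plain_end x).
by rewrite -vE -AE; apply: hv; apply/diagonal_vertexP; exists x.
Qed.

Lemma card_angle_matchings :
  #|[set A : {set ptri P * 'I_3} | angle_matching A]| =
  #|[set c : {ffun tri -> 'I_3} | corner_matching c]|.
Proof.
rewrite -(card_in_imset (f := fun c : {ffun tri -> 'I_3} => corner_set c)).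
  apply: eq_card => A; rewrite inE; apply/angle_matchingP/imsetP => -[c].
    by move=> h ->; exists c; rewrite ?inE.
  by rewrite inE => h ->; exists c.
move=> c c' _ _ /setP e; apply/ffunP => t.
by have := e (t, c t); rewrite !inE /= eqxx => /esym/eqP.
Qed.

Definition p_corner (c : tri -> 'I_3) (k : nat) : 'I_3 := c (p_tri k).
Definition q_corner (c : tri -> 'I_3) (k : nat) : 'I_3 := c (q_tri k).
Definition strip_corner (c : tri -> 'I_3) (i : nat) : 'I_3 := c (inl (inord i)).

(** Triangles n and 0 are counted as triangle 0 of the fan at p and at q; they are different
    triangles because n > 0. *)
Lemma corner_count_split c l : (corner_count_at c l =
  \sum_(1 <= i < n) (inl (strip_root w i (strip_corner c i)) == l) +
  end_count fp (strip_root w n) true (p_corner c) l +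
  end_count fq q_base false (q_corner c) l)%N.
Proof.
rewrite /corner_count_at big_sumType big_sumType /=.
have -> : (\sum_(i : 'I_n.+1) (root (inl i, c (inl i)) == l) =
  (root (inl ord0, c (inl ord0)) == l) +
  \sum_(1 <= i < n) (inl (strip_root w i (strip_corner c i)) == l) +
  (root (inl ord_max, c (inl ord_max)) == l))%N.
  pose F i : nat := (inl (strip_root w i (strip_corner c i)) == l :> label).
  transitivity (\sum_(i < n.+1) F i)%N.
    by apply: eq_bigr => i _; rewrite /F /strip_corner inord_val.
  rewrite -(big_mkord xpredT F) big_nat_recr //= big_ltn // /F /strip_corner.
  congr (_ + _ + _)%N.
    by rewrite /root /= (_ : inord 0 = ord0) //; apply: val_inj; rewrite /= inordK.
  by rewrite /root /= (_ : inord n = ord_max) //; apply: val_inj; rewrite /= inordK.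
rewrite /end_count !big_ord_recl /= !(end_root0 _ _ _ fp_ok, end_root0 _ _ _ fq_ok).
have -> : (\sum_(i < extra fp) (end_root fp (strip_root w n) true (bump 0 i)
     (p_corner c (bump 0 i)) == l) =
   \sum_(j : 'I_(extra fp)) (root (inr (inl j), c (inr (inl j))) == l))%N.
  by apply: eq_bigr => j _; rewrite /p_corner /= valK.
have -> : (\sum_(i < extra fq) (end_root fq q_base false (bump 0 i)
     (q_corner c (bump 0 i)) == l) =
   \sum_(j : 'I_(extra fq)) (root (inr (inr j), c (inr (inr j))) == l))%N.
  by apply: eq_bigr => j _; rewrite /q_corner /= valK.
rewrite /root /p_corner /q_corner /=.
set a := (_ == l : nat); set s := bigop _ _ _; set d := (_ == l : nat).
set e := bigop _ _ _; set h := bigop _ _ _; lia.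
Qed.

Lemma strip_count_split q r : (strip_count w q n r =
  \sum_(1 <= i < n) (strip_root w i (q i) == r) +
  (strip_root w n (q n) == r) + (q_base (q 0) == r))%N.
Proof.
rewrite /strip_count -(big_mkord xpredT (fun i => (strip_root w i (q i) == r) : nat)).
by rewrite big_nat_recr //= big_ltn //= -addnA addnC.
Qed.

Lemma root_inl x r : root x = inl r ->
  exists i k, (i <= n)%N /\ r = strip_root w i k.
Proof.
case: x => [[i|[j|j]] k]; rewrite /root /=.
- by move=> [<-]; exists i, k; rewrite -ltnS.
- have [v [E m1 lt]] := extraP fp_ok (ltn_ord j).
  by rewrite (end_rootE _ _ _ _ E) => /fan_root_base[k' ->]; exists n, k'.
have [v [E m1 lt]] := extraP fq_ok (ltn_ord j).
by rewrite (end_rootE _ _ _ _ E) => /fan_root_base[k' ->]; exists 0%N, k'.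
Qed.

Lemma fan_root_inr v base b i k z : (1 < valency v)%N -> (i < valency v)%N ->
  fan_root v base b i k = inr z ->
  exists2 g, z = (b, g) & (0 < g < (valency v).-1)%N.
Proof.
move=> m1 lt; rewrite /fan_root; case: eqP => // _.
have H g : (g < valency v)%N -> gap_label v base b g = inr z ->
  exists2 g, z = (b, g) & (0 < g < (valency v).-1)%N.
  move=> ltg; rewrite /gap_label; case: eqP => // g0; case: eqP => // gm.
  by case=> <-; exists g => //; lia.
by case: eqP => _; apply: H => //; exact: prev_tri_lt.
Qed.

Lemma end_root_inl o base b i k r :
  end_root o base b i k = inl r -> exists k', r = base k'.
Proof.
by case: o => [v /fan_root_base //|] [<-]; exists k.
Qed.

Lemma end_root_inr c o base b i k z : end_ok c o -> (i <= extra o)%N ->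
  end_root o base b i k = inr z -> z.1 = b.
Proof.
case: o => [v|//] [m1 _] /= le /(fan_root_inr m1)[|g -> //]; lia.
Qed.

Lemma root_inr x z : root x = inr z ->
  exists v g, [/\ (if z.1 then fp else fq) = Some v, z = (z.1, g)
    & (0 < g < (valency v).-1)%N].
Proof.
case: x => [[i|[j|j]] k]; rewrite /root //=.
- have [v [E m1 lt]] := extraP fp_ok (ltn_ord j).
  by rewrite (end_rootE _ _ _ _ E) => /(fan_root_inr m1 lt)[g -> hg]; exists v, g.
have [v [E m1 lt]] := extraP fq_ok (ltn_ord j).
by rewrite (end_rootE _ _ _ _ E) => /(fan_root_inr m1 lt)[g -> hg]; exists v, g.
Qed.

(** q is what remains of c when each end fan is collapsed to the triangle it shares with the
    strip. *)
Definition fills (c : tri -> 'I_3) (q : nat -> 'I_3) : Prop :=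
  [/\ filling fp (p_corner c) (q n), filling fq (q_corner c) (q 0%N) &
    forall i, (0 < i < n)%N -> strip_corner c i = q i].

Lemma fills_count_inl c q r : fills c q ->
  (corner_count_at c (inl r) =
   strip_count w q n r + (fp && (r == (n, newc w n))) +
   (fq && (r == (0, oldc w 0))))%N.
Proof.
case=> hp hq hi; rewrite corner_count_split strip_count_split.
rewrite (end_count_filling _ _ _ fp_ok hp) (end_count_filling _ _ _ fq_ok hq).
rewrite (eq_big_nat _ _ (F2 := fun i => (strip_root w i (q i) == r : nat))); last first.
  by move=> i h; rewrite hi.
set S := bigop _ _ _; rewrite !(inj_eq (@inl_inj _ _)).
have -> : (if fp is Some v then (inl (strip_root w n (apex v 0)) == inl r :> label) +
    \sum_(1 <= i < (valency v).-1) (inr (true, i) == inl r :> label) else 0)%N =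
    (fp && (r == (n, newc w n))) :> nat.
  case E : fp => [v|//]; have [_ ->] := end_okE fp_ok E.
  by rewrite big1 // addn0 strip_root_n // (inj_eq (@inl_inj _ _)) eq_sym.
have -> : (if fq is Some v then (inl (q_base (apex v 0)) == inl r :> label) +
    \sum_(1 <= i < (valency v).-1) (inr (false, i) == inl r :> label) else 0)%N =
    (fq && (r == (0%N, oldc w 0))) :> nat.
  case E : fq => [v|//]; have [_ ->] := end_okE fq_ok E.
  by rewrite big1 // addn0 (inj_eq (@inl_inj _ _)) eq_sym.
set a := (strip_root w n _ == _ : nat); set b := (q_base _ == _ : nat).
by set d := (fp && _ : nat); set e := (fq && _ : nat); lia.
Qed.

Lemma fills_count_inr c q v b g : fills c q ->
  (if b then fp else fq) = Some v -> (0 < g < (valency v).-1)%N ->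
  corner_count_at c (inr (b, g)) = 1%N.
Proof.
case=> hp hq hi; rewrite corner_count_split => E hg.
rewrite (end_count_filling _ _ _ fp_ok hp) (end_count_filling _ _ _ fq_ok hq).
rewrite big1 // !add0n.
have delta (b' : bool) m : (\sum_(1 <= i < m)
    (inr (b', i) == inr (b, g) :> label) = (b' == b) && (1 <= g < m))%N.
  case: (b' =P b) => [->|ne] /=.
    rewrite -sum_nat_delta.
    by apply: eq_bigr => i _; rewrite (inj_eq (@inr_inj _ _)) xpair_eqE eqxx.
  by apply: big1 => i _; apply/eqP; rewrite eqb0; apply/eqP => -[].
case: b E delta => E delta; rewrite E delta eqxx add0n hg.
  by case: fq => // v'; rewrite delta.
by case: fp => // v'; rewrite delta.
Qed.

(** At a puncture where the arc is notched, and at the outer ends beyond the strip, only triangles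
    of one fan contribute. These equations alone yield the angle that replaces the fan; the
    remaining ones are then those of the strip, treated in [local_strip_count]. *)
Lemma corner_matchingP c : corner_matching c <->
  exists2 q, local_matching w q & fills c q.
Proof.
split=> [/forallP h|[q lq cq]]; last first.
  apply/forallP => x; apply/orP; have [px|px] := boolP (plain_end x); [by left|right].
  have [z1 z2] := local_strip_count_ends w_ok lq.
  case xr : (root x) => [r|[b g]]; last first.
    have [v [g' [E [eg] hg]]] := root_inr xr.
    by rewrite /= -eg in hg E *; apply/eqP; exact: (fills_count_inr cq E hg).
  rewrite (fills_count_inl _ cq).
  have [r0|r0] := eqVneq r (0%N, oldc w 0).
    have fqT : fq.
      apply: contraNT px => f; have := @root_first x f; rewrite xr r0.
      by move=> /(_ erefl) ->; rewrite /plain_end /= f !eqxx.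
    rewrite r0 z1 fqT xpair_eqE (_ : (0%N == n) = false) ?andbF //.
    by apply/eqP => e; move: n0; rewrite -e.
  have [rn|rn] := eqVneq r (n, newc w n).
    have fpT : fp.
      apply: contraNT px => f; have := @root_last x f; rewrite xr rn.
      by move=> /(_ erefl) ->; rewrite /plain_end /= f !eqxx orbT.
    by rewrite rn z2 fpT andbF.
  have [i [k [le e]]] := root_inl xr.
  rewrite !andbF !addn0; apply/eqP/((local_strip_count w_ok q).1 lq).
  by split => //; exists i, k.
have hp_first : fp -> end_count fp (strip_root w n) true (p_corner c)
    (inl (strip_root w n (newc w n))) = 1%N.
  move=> f; have := h (inl ord_max, newc w n).
  rewrite /plain_end /= (_ : (n == 0%N) = false); last by rewrite eqn0Ngt n0.
  rewrite andbF f /=.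
  rewrite /root /= strip_root_n // corner_count_split.
  rewrite big_nat_cond big1 ?add0n; last first.
    move=> i; rewrite andbT => /andP[_ lt]; apply/eqP; rewrite eqb0.
    apply/negP => /eqP[] e; have := strip_root_le w i (strip_corner c i).
    by rewrite e /= leqNgt lt.
  rewrite [X in (_ + X)%N]big1 ?addn0; first by move/eqP.
  move=> i _; apply/eqP; rewrite eqb0; apply/negP => /eqP.
  by case/end_root_inl => k' [e _]; move: n0; rewrite e.
have hq_first : fq -> end_count fq q_base false (q_corner c)
    (inl (q_base (oldc w 0))) = 1%N.
  move=> f; have := h (inl ord0, oldc w 0).
  rewrite /plain_end /= (_ : (0%N == n) = false); last first.
    by rewrite eq_sym eqn0Ngt n0.
  rewrite andbF f /=.
  rewrite /root /= corner_count_split.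
  rewrite big_nat_cond big1 ?add0n; last first.
    move=> i; rewrite andbT => /andP[i0 lt]; apply/eqP; rewrite eqb0.
    apply/negP => /eqP[] /strip_root_first[]; first exact: ltnW.
    by move=> e; rewrite e in i0.
  rewrite [X in (X + _)%N]big1 ?add0n; first by move/eqP.
  move=> i _; apply/eqP; rewrite eqb0; apply/negP => /eqP.
  have first k : strip_root w n k <> (0%N, oldc w 0).
    by move/strip_root_first => /(_ (leqnn n))[e]; move: n0; rewrite e.
  by case/end_root_inl => k' /esym/first.
have hp_mid v i : fp = Some v -> (0 < i < (valency v).-1)%N ->
    end_count fp (strip_root w n) true (p_corner c) (inr (true, i)) = 1%N.
  move=> E hi; have [m1 _] := end_okE fp_ok E.
  have := h (p_tri i, apex v i - 1).
  case: i hi => [//|i] hi; have li : (i < extra fp)%N by rewrite E /=; lia.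
  rewrite (root_p _ E (p_fan_tri_p li)) /fan_root /gap_label !ifF; try lia;
    last 2 first.
  - by move: (apex v _); clear; I3.
  - by move: (apex v _); clear; I3.
  rewrite /plain_end /= insubT /= corner_count_split big1 // add0n.
  rewrite [X in (_ + X)%N]big1 ?addn0; first by move/eqP.
  move=> k _; apply/eqP; rewrite eqb0; apply/negP => /eqP.
  by move/(end_root_inr fq_ok); rewrite -ltnS => /(_ (ltn_ord k)).
have hq_mid v i : fq = Some v -> (0 < i < (valency v).-1)%N ->
    end_count fq q_base false (q_corner c) (inr (false, i)) = 1%N.
  move=> E hi; have [m1 _] := end_okE fq_ok E.
  have := h (q_tri i, apex v i - 1).
  case: i hi => [//|i] hi; have li : (i < extra fq)%N by rewrite E /=; lia.
  rewrite (root_q _ E (q_fan_tri_q li)) /fan_root /gap_label !ifF; try lia;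
    last 2 first.
  - by move: (apex v _); clear; I3.
  - by move: (apex v _); clear; I3.
  rewrite /plain_end /= insubT /= corner_count_split big1 // add0n.
  rewrite [X in (X + _)%N]big1 ?add0n; first by move/eqP.
  move=> k _; apply/eqP; rewrite eqb0; apply/negP => /eqP.
  by move/(end_root_inr fp_ok); rewrite -ltnS => /(_ (ltn_ord k)).
have q_inj : injective q_base by move=> a a' [].
have [qn hqn] := filling_exists fp_ok (@strip_root_inj w n) hp_first hp_mid.
have [q0 hq0] := filling_exists fq_ok q_inj hq_first hq_mid.
pose q i := if i == n then qn else if i == 0%N then q0 else strip_corner c i.
have cq : fills c q.
  split; rewrite /q ?eqxx //.
    by rewrite (_ : (0%N == n) = false) //; rewrite eq_sym eqn0Ngt n0.
  by move=> i /andP[i0 lt]; rewrite (ltn_eqF lt) eqn0Ngt i0.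
exists q => //; apply/(local_strip_count w_ok) => r [r0 rn [i [k [le e]]]].
have lt : (i < n.+1)%N by [].
have := h (inl (Ordinal lt), k).
have [px|px] := boolP (plain_end _).
  case/plain_end_cases: px => -[_ [ei ek]] _.
    by move: r0; rewrite e ei ek /= eqxx.
  by move: rn; rewrite e ei ek strip_root_n // eqxx.
rewrite /= /root /= -e (fills_count_inl _ cq) (negPf r0) (negPf rn) !andbF !addn0.
by move/eqP.
Qed.

Definition fillsb (c : tri -> 'I_3) (q : nat -> 'I_3) : bool :=
  [&& fillingb fp (p_corner c) (q n), fillingb fq (q_corner c) (q 0%N) &
    [forall i : 'I_n.+1, (0 < i < n)%N ==> (c (inl i) == q i)]].

Lemma fillsP c q : reflect (fills c q) (fillsb c q).
Proof.
apply: (iffP and3P) => -[/(fillingP _ _ fp_ok) h1 /(fillingP _ _ fq_ok) h2 h3];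
  split => //.
  move=> i hi; have lt : (i < n.+1)%N by case/andP: hi => _ /ltnW.
  have /implyP/(_ hi)/eqP := forallP h3 (Ordinal lt).
  rewrite /strip_corner (_ : inord i = Ordinal lt) //.
  by apply: val_inj; rewrite /= inordK.
by apply/forallP => i; apply/implyP => /h3; rewrite /strip_corner inord_val => ->.
Qed.

Lemma eq_fills c q q' : (forall i, (i <= n)%N -> q i = q' i) ->
  fills c q -> fills c q'.
Proof.
move=> e [h1 h2 h3]; split; rewrite -?e // => i hi.
by rewrite -e ?h3 //; case/andP: hi => _ /ltnW.
Qed.

Lemma fills_inj c q q' : fills c q -> fills c q' ->
  forall i, (i <= n)%N -> q i = q' i.
Proof.
move=> [h1 h2 h3] [h4 h5 h6] i le.
have [->|i0] := posnP i; first exact: filling_inj h2 h5.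
have [ei|ne] := eqVneq i n; first by rewrite ei; exact: filling_inj h1 h4.
by rewrite -h3 -?h6 // i0 ltn_neqAle ne.
Qed.

Lemma card_fills q : local_matching w q ->
  #|[set c : {ffun tri -> 'I_3} | fillsb c q]| = (end_size fp * end_size fq)%N.
Proof.
move=> /local_matchingP[q0 qn _].
rewrite -(card_fillings fp_ok qn) -(card_fillings fq_ok q0) -cardsX.
pose F (g : {ffun 'I_(extra fp).+1 -> 'I_3} * {ffun 'I_(extra fq).+1 -> 'I_3}) :
    {ffun tri -> 'I_3} :=
  [ffun t : tri => match t return 'I_3 with
    | inl i => if i == n :> nat then extend g.1 0
               else if i == 0%N :> nat then extend g.2 0 else q i
    | inr (inl j) => extend g.1 j.+1
    | inr (inr j) => extend g.2 j.+1
    end].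
have Fp g i : (i <= extra fp)%N -> p_corner (F g) i = extend g.1 i.
  rewrite /p_corner /F; case: i => [|i] lt /=; first by rewrite ffunE eqxx.
  by rewrite insubT ffunE.
have Fq g i : (i <= extra fq)%N -> q_corner (F g) i = extend g.2 i.
  rewrite /q_corner /F; case: i => [|i] lt /=.
    by rewrite ffunE /= eq_sym eqn0Ngt n0.
  by rewrite insubT ffunE.
rewrite -(card_in_imset (f := F)); last first.
  move=> [g1 g2] [h1 h2] _ _ e; congr pair; apply: eq_extend => i; rewrite ltnS => le.
    by rewrite -(Fp (g1, g2)) // e Fp.
  by rewrite -(Fq (g1, g2)) // e Fq.
apply: eq_card => c; rewrite !inE; apply/fillsP/imsetP.
  move=> [h1 h2 h3].
  pose g := ([ffun i : 'I_(extra fp).+1 => p_corner c i],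
             [ffun i : 'I_(extra fq).+1 => q_corner c i]).
  have g1 i : (i <= extra fp)%N -> extend g.1 i = p_corner c i.
    by move=> le; rewrite (extend_ffun (p_corner c)).
  have g2 i : (i <= extra fq)%N -> extend g.2 i = q_corner c i.
    by move=> le; rewrite (extend_ffun (q_corner c)).
  exists g.
    rewrite !inE; apply/andP; split.
      by apply/(fillingP _ _ fp_ok); apply: (eq_filling fp_ok _ h1) => i le; rewrite g1.
    by apply/(fillingP _ _ fq_ok); apply: (eq_filling fq_ok _ h2) => i le; rewrite g2.
  apply/ffunP => t; rewrite ffunE.
  case: t => [i|[j|j]].
  - case: eqP => [ei|ni].
      by rewrite g1 // /p_corner /=; congr (c (inl _)); apply: val_inj.
    case: eqP => [ei|ni'].
      by rewrite g2 // /q_corner /=; congr (c (inl _)); apply: val_inj.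
    rewrite -h3 /strip_corner ?inord_val //; have := ltn_ord i; lia.
  - by rewrite g1 // /p_corner /= valK.
  by rewrite g2 // /q_corner /= valK.
case=> g; rewrite !inE => /andP[/(fillingP _ _ fp_ok) h1 /(fillingP _ _ fq_ok) h2 ->].
split.
- by apply: (eq_filling fp_ok _ h1) => i le; rewrite Fp.
- by apply: (eq_filling fq_ok _ h2) => i le; rewrite Fq.
move=> i /andP[i0 lt]; rewrite /strip_corner ffunE inordK ?ltnS ?(ltnW lt) //.
by rewrite (ltn_eqF lt) eqn0Ngt i0.
Qed.

Lemma card_corner_matchings :
  #|[set c : {ffun tri -> 'I_3} | corner_matching c]| =
  (#|local_matchings w| * (end_size fp * end_size fq))%N.
Proof.
apply: (card_double_count (R := fun (c : {ffun tri -> 'I_3}) q => fillsb c (extend q)))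
  => [c|q]; rewrite inE.
  case/corner_matchingP => q lq cq; apply/eqP/cards1P.
  have qE i : (i <= n)%N -> extend [ffun i : 'I_n.+1 => q i] i = q i.
    by move=> le; rewrite extend_ffun.
  exists [ffun i : 'I_n.+1 => q i]; apply/setP => q'; rewrite !inE.
  apply/andP/eqP => [[_ /fillsP cq']|->].
    apply: eq_extend => i; rewrite ltnS => le; rewrite qE //.
    exact: fills_inj cq' cq _ le.
  rewrite (eq_local_matching qE); split=> //; apply/fillsP.
  by apply: eq_fills cq => i le; rewrite qE.
move=> lq; rewrite -(card_fills lq); apply: eq_card => c; rewrite !inE.
apply: andb_idl => /fillsP h; apply/corner_matchingP; by exists (extend q).
Qed.

Lemma card_angle_matchings_local :
  #|[set A : {set ptri P * 'I_3} | angle_matching A]| =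
  (#|local_matchings w| * (end_size fp * end_size fq))%N.
Proof. by rewrite card_angle_matchings card_corner_matchings. Qed.

Lemma corner_not_plain c t : corner_matching c -> ~~ plain_end (t, c t).
Proof.
case/corner_matchingP => q /local_matchingP[q0 qn _] [hp hq _].
apply/negP => /plain_end_cases[] [f [tE cE]]; move: cE; rewrite tE => cE.
  case: fq hq f => // hq _; move: q0; rewrite -hq /q_corner /= cE eqxx //.
case: fp hp f => // hp _; move: qn; rewrite -hp /p_corner /= cE eqxx //.
Qed.

(** * Matchings of the bipartite graph *)

Definition bipartite_set (c : tri -> 'I_3) : {set gedge (bipartite_graph P)} :=
  [set (vertex (P := P) (t, c t), t) | t in [set: tri]].

Lemma vertex_inj x y : vertex (P := P) x = vertex (P := P) y -> root x = root y.
Proof.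
move=> e; have : y \in vertex (P := P) x by rewrite e vertexE.
by rewrite vertexE => /eqP.
Qed.

Lemma eq_vertex x y : (vertex (P := P) x == vertex (P := P) y) = (root x == root y).
Proof.
apply/eqP/eqP => [/vertex_inj //|e].
by apply/setP => z; rewrite !vertexE e.
Qed.

Lemma bipartite_matchingP (E : {set gedge (bipartite_graph P)}) :
  reflect (exists2 c : {ffun tri -> 'I_3}, corner_matching c & E = bipartite_set c)
          (perfect_matching E).
Proof.
have fI (c : tri -> 'I_3) : injective (fun t => (vertex (P := P) (t, c t), t)).
  by move=> t u [].
have vE (c : tri -> 'I_3) x :
    #|[set e in bipartite_set c | e.1 == vertex (P := P) x]| =
    corner_count_at c (root x).
  rewrite (card_graph_sel (fun e => e.1 == vertex (P := P) x) (fI c)).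
  by apply: eq_bigr => t _; rewrite eq_vertex.
have tE (c : tri -> 'I_3) t : #|[set e in bipartite_set c | e.2 == t]| = 1%N.
  rewrite (card_graph_sel (fun e => e.2 == t) (fI c)).
  by rewrite (bigD1 t) //= eqxx big1 ?addn0 // => u /negPf ->.
apply: (iffP andP) => [[sE /forall_inP hE]|[c hc ->]]; last first.
  split.
    apply/subsetP => _ /imsetP[t _ ->]; rewrite inE /=; apply/andP; split.
      by apply/diagonal_vertexP; exists (t, c t) => //; exact: corner_not_plain.
    by apply/existsP; exists (c t); rewrite vertexE.
  apply/forall_inP => -[v|t] /=; rewrite inE => h; last by rewrite tE.
  have /diagonal_vertexP[x px ->] := h; rewrite vE.
  by have := forallP hc x; rewrite (negPf px).
have tv t : inr t \in verts (bipartite_graph P) by rewrite inE.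
have ex t : exists k, (vertex (P := P) (t, k), t) \in E.
  have /cards1P[[v u] eE] := hE (inr t) (tv t).
  have : (v, u) \in [set e in E | incident (g := bipartite_graph P) e (inr t)].
    by rewrite eE inE.
  rewrite inE /= => /andP[vE' /eqP ut]; rewrite -{}ut.
  have := subsetP sE _ vE'; rewrite inE /= => /andP[/diagonal_vertexP[x _ vx]].
  case/existsP => k kv; exists k; move: kv; rewrite vx vertexE -eq_vertex => /eqP <-.
  by rewrite -vx.
pose c := [ffun t : tri => xchoose (ex t)].
have ct t : (vertex (P := P) (t, c t), t) \in E.
  by rewrite ffunE; exact: (xchooseP (ex t)).
have EE : E = bipartite_set c.
  apply/setP => -[v t]; apply/idP/imsetP => [h|[u _ [-> ->]]]; last exact: ct.
  exists t => //; congr pair.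
  have /cards1P[e eE] := hE (inr t) (tv t).
  have h1 : (v, t) \in [set e in E | incident (g := bipartite_graph P) e (inr t)].
    by rewrite inE h /=.
  have h2 : (vertex (P := P) (t, c t), t) \in
      [set e in E | incident (g := bipartite_graph P) e (inr t)].
    by rewrite inE ct /=.
  by move: h1 h2; rewrite eE !inE => /eqP <- /eqP[].
exists c => //; apply/forallP => x; have [//|px] /= := boolP (plain_end x).
have xv : inl (vertex (P := P) x) \in verts (bipartite_graph P).
  by rewrite inE; apply/diagonal_vertexP; exists x.
by rewrite -vE -EE; exact: hE xv.
Qed.

Lemma card_bipartite_matchings :
  #|[set E : {set gedge (bipartite_graph P)} | perfect_matching E]| =
  #|[set A : {set ptri P * 'I_3} | angle_matching A]|.
Proof.
rewrite card_angle_matchings.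
rewrite -(card_in_imset (f := fun c : {ffun tri -> 'I_3} => bipartite_set c)).
  apply: eq_card => E; rewrite inE; apply/bipartite_matchingP/imsetP => -[c].
    by move=> h ->; exists c; rewrite ?inE.
  by rewrite inE => h ->; exists c.
move=> c c' _ _ /setP e; apply/ffunP => t.
have : (vertex (P := P) (t, c t), t) \in bipartite_set c' by rewrite -e imset_f.
case/imsetP => u _ [+ tu]; rewrite -tu => /vertex_inj; exact: root_inj.
Qed.
End Polygon.

(** * Minimal cuts *)

Section Cuts.
Variable P : polygon.

(** The arrow from side k - 1 to side k of a triangle turns around their common corner k. *)
Definition cut_arrow (x : ptri P * 'I_3) : polygon_arrow P := inl (x.1, x.2 - 1).

Lemma cut_arrow_inj : injective cut_arrow.
Proof.
move=> [t k] [u l] /eqP; rewrite (inj_eq (@inl_inj _ _)) xpair_eqE /=.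
by rewrite (inj_eq (addIr _)) => /andP[/eqP -> /eqP ->].
Qed.

Lemma card_cut_arrow (A : {set ptri P * 'I_3}) (Z : {set polygon_arrow P}) :
  #|(cut_arrow @: A) :&: Z| = #|[set x in A | cut_arrow x \in Z]|.
Proof.
rewrite -(card_imset _ cut_arrow_inj); apply: eq_card => a.
rewrite inE; apply/andP/imsetP => [[/imsetP[x xA ->] xZ]|[x]].
  by exists x; rewrite // inE xA.
by rewrite inE => /andP[xA xZ] ->; rewrite imset_f.
Qed.

Lemma card_cut_triangle (A : {set ptri P * 'I_3}) t :
  #|(cut_arrow @: A) :&: triangle_cycle t| = #|[set x in A | x.1 == t]|.
Proof. by rewrite card_cut_arrow; apply: eq_card => x; rewrite !inE. Qed.

Lemma card_cut_vertex (A : {set ptri P * 'I_3}) v :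
  #|(cut_arrow @: A) :&: exterior_cycle v| = #|[set x in A | x \in v]|.
Proof.
rewrite card_cut_arrow; apply: eq_card => -[t k].
by rewrite !inE /= subrK.
Qed.

Lemma card_by_triangle (A : {set ptri P * 'I_3}) :
  (forall t, #|[set x in A | x.1 == t]| = 1%N) -> #|A| = #|ptri P|.
Proof.
move=> h; rewrite -sum1_card (partition_big (fun x => x.1) xpredT) //=.
rewrite -[RHS]sum1_card; apply: eq_bigr => t _; rewrite -[RHS](h t) -sum1_card.
by apply: eq_bigl => x; rewrite inE.
Qed.

Lemma minimal_cutP (C : {set polygon_arrow P}) :
  reflect (exists2 A, angle_matching A & C = cut_arrow @: A) (minimal_cut C).
Proof.
have potE (A : {set ptri P * 'I_3}) :
    all (fun z => #|(cut_arrow @: A) :&: z.2| == 1%N) (potential (polygon_qp P)) =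
    angle_matching A.
  rewrite all_cat [X in X && _]all_map [X in _ && X]all_map andbC; congr (_ && _).
    apply/allP/forall_inP => h v hv.
      by have := h v; rewrite mem_enum /= card_cut_vertex; apply.
    by rewrite /= card_cut_vertex; apply: h; rewrite mem_enum in hv.
  apply/allP/forallP => h t.
    by have := h t; rewrite mem_enum /= card_cut_triangle; apply.
  by move=> _; rewrite /= card_cut_triangle; exact: h.
apply: (iffP andP) => [[/andP[sC allC] /eqP cC]|[A hA ->]]; last first.
  split.
    rewrite /is_cut; apply/andP; split; last by rewrite potE.
    by apply/subsetP => _ /imsetP[x _ ->]; rewrite inE.
  rewrite (card_imset _ cut_arrow_inj); apply/eqP/card_by_triangle => t.
  by case/andP: hA => _ /forallP/(_ t)/eqP.
pose A := cut_arrow @^-1: C.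
have AC : cut_arrow @: A \subset C by apply/subsetP => _ /imsetP[x + ->]; rewrite inE.
have tA t : #|[set x in A | x.1 == t]| = 1%N.
  have /allP/(_ (1, triangle_cycle t)) := allC.
  rewrite mem_cat map_f ?mem_enum // => /(_ isT)/eqP e.
  rewrite -[RHS]e -card_cut_triangle; apply: eq_card => -[[u k]|[x y]]; last first.
    by rewrite !inE !andbF.
  rewrite !inE; congr (_ && _); apply/imsetP/idP => [[x + ->]|h].
    by rewrite inE.
  by exists (u, k + 1); rewrite ?inE /cut_arrow /= addrK.
have CE : C = cut_arrow @: A.
  apply/esym/eqP; rewrite eqEcard AC (card_imset _ cut_arrow_inj).
  by rewrite (card_by_triangle tA) cC leqnn.
by exists A => //; rewrite -potE -CE.
Qed.

Lemma card_minimal_cuts :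
  #|[set C : {set polygon_arrow P} | minimal_cut C]| =
  #|[set A : {set ptri P * 'I_3} | angle_matching A]|.
Proof.
rewrite -(card_imset _ (imset_inj cut_arrow_inj)).
apply: eq_card => C; rewrite inE; apply/minimal_cutP/imsetP => -[A].
  by move=> h ->; exists A; rewrite ?inE.
by rewrite inE => h ->; exists A.
Qed.
End Cuts.

(** * Comparison of the four sets *)

Lemma in_bijection_card (T U : finType) (A : pred T) (B : pred U) :
  #|[set x | A x]| = #|[set y | B y]| -> in_bijection {x | A x} {y | B y}.
Proof.
rewrite !cardsE => e.
have {}e : #|{: {x | A x}}| = #|{: {y | B y}}| by rewrite !card_sig.
exists (fun x => enum_val (cast_ord e (enum_rank x))).
exists (fun y => enum_val (cast_ord (esym e) (enum_rank y))) => x.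
  by rewrite enum_valK cast_ordK enum_rankK.
by rewrite enum_valK cast_ordKV enum_rankK.
Qed.

Lemma polygon_bijections (w : strip) (fq fp : option fan) :
  nonreturning w -> end_ok (newc w (len w)) fp -> end_ok (oldc w 0) fq ->
  let P := arc_polygon w fq fp in
  [/\ in_bijection {A : {set ptri P * 'I_3} | angle_matching A}
                   (snake_matchings w fq fp),
      in_bijection (snake_matchings w fq fp)
                   {E : {set gedge (bipartite_graph P)} | perfect_matching E}
    & in_bijection {E : {set gedge (bipartite_graph P)} | perfect_matching E}
                   {C : {set polygon_arrow P} | minimal_cut C}].
Proof.
move=> w_ok p_ok q_ok P.
have AE : #|[set A : {set ptri P * 'I_3} | angle_matching A]| =
    (#|local_matchings w| * (end_size fp * end_size fq))%N.
  exact: card_angle_matchings_local.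
have BE : #|[set E : {set gedge (bipartite_graph P)} | perfect_matching E]| =
    (#|local_matchings w| * (end_size fp * end_size fq))%N.
  by rewrite card_bipartite_matchings.
have CE : #|[set C : {set polygon_arrow P} | minimal_cut C]| =
    (#|local_matchings w| * (end_size fp * end_size fq))%N.
  by rewrite card_minimal_cuts.
have both (T U : finType) (a : pred T) (b : pred U) :
    #|[set x | a x]| = (#|local_matchings w| * (end_size fp * end_size fq))%N ->
    #|[set x | b x]| = (#|local_matchings w| * (end_size fp * end_size fq))%N ->
    in_bijection {x | a x} {x | b x}.
  by move=> ea eb; apply: in_bijection_card; rewrite ea eb.
(* [snake_matchings] is a type defined by cases; in each of them it is a subtype of a finite type,
   to which counting applies. *)
have snake_card : (exists (T : finType) (a : pred T),
    snake_matchings w fq fp = {x | a x} /\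
    #|[set x | a x]| = (#|local_matchings w| * (end_size fp * end_size fq))%N).
  move: {P AE BE CE both} p_ok q_ok; case: fq fp => [q|] [p|] /= p_ok q_ok.
  - do 2 eexists; split; first reflexivity.
    apply: card_symmetric_pairs => //; exact: fan_ok_rev q_ok.1 q_ok.2.
  - do 2 eexists; split; first reflexivity.
    rewrite mul1n -card_local_matchings_rev //.
    apply: card_symmetric_matchings; first exact: nonreturning_rev.
    exact: fan_ok_rev q_ok.1 q_ok.2.
  - do 2 eexists; split; first reflexivity.
    by rewrite muln1; exact: card_symmetric_matchings.
  do 2 eexists; split; first reflexivity.
  by rewrite !muln1; exact: card_snake_matchings.
have [T [a [-> eS]]] := snake_card.
by split; exact: both.
Qed.

(** * Arcs in the surface *)

Section Geometry.
Variable R : realType.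
Local Open Scope complex_scope.

Lemma Re_segment (z w : plane R) (t : R) :
  complex.Re (segment z w t) = (1 - t) * complex.Re z + t * complex.Re w.
Proof. by case: z w => a b [c d]; rewrite /segment /= !mul0r !subr0. Qed.

Lemma Im_segment (z w : plane R) (t : R) :
  complex.Im (segment z w t) = (1 - t) * complex.Im z + t * complex.Im w.
Proof. by case: z w => a b [c d]; rewrite /segment /= !mul0r !addr0. Qed.

(* The affine function which vanishes on the line of side k and is positive in
   the open triangle. *)
Definition side_form (k : 'I_3) (z : plane R) : R :=
  nth 0 [:: complex.Im z; 1 - complex.Re z - complex.Im z; complex.Re z] k.

Lemma side_form_segment k z w t :
  side_form k (segment z w t) = (1 - t) * side_form k z + t * side_form k w.
Proof.
rewrite /side_form Re_segment Im_segment; case: k => [[|[|[|]]]] //= _.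
by ring.
Qed.

Lemma side_form_gt0 k z : open_triangle z -> 0 < side_form k z.
Proof.
case=> h0 h1 h2; rewrite /side_form; case: k => [[|[|[|]]]] //= _.
by rewrite -addrA -opprD subr_gt0.
Qed.

Lemma side_form_corner k (s : 'I_3) :
  (k == s) || (k == s + 1) -> side_form s (corner R k) = 0.
Proof.
rewrite /side_form /corner.
by case: k s => [[|[|[|]]]] //= ? [[|[|[|]]]] //= ? _; rewrite ?subr0 ?subrr.
Qed.

Lemma side_form_open_side k z : open_side k z -> side_form k z = 0.
Proof.
case=> t _ <-; rewrite /side_point side_form_segment.
by rewrite !side_form_corner ?eqxx ?orbT // !mulr0 addr0.
Qed.

(** The affine function of side k would vanish at the midpoint of the chord, which is interior to
    the triangle. *)
Lemma chord_not_in_side k z w : side_form k z = 0 -> side_form k w = 0 ->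
  (forall s, 0 <= s -> s <= 1 -> 0 < s -> s < 1 -> open_triangle (segment z w s)) ->
  False.
Proof.
move=> hz hw h; have lt : 2%:R^-1 < 1 :> R by lra.
have gt : 0 < 2%:R^-1 :> R by lra.
have := side_form_gt0 k (h _ (ltW gt) (ltW lt) gt lt).
by rewrite side_form_segment hz hw !mulr0 addr0 ltxx.
Qed.

Lemma normc_ge_Im (z : R[i]) : `|complex.Im z|%:C <= `|z|.
Proof.
case: z => a b; rewrite normc_def lecR /= -sqrtr_sqr ler_wsqrtr //.
by rewrite lerDr sqr_ge0.
Qed.
End Geometry.

Section Topology.
Variables (R : realType) (X : marked_surface R).
Local Open Scope complex_scope.
Local Open Scope classical_set_scope.

(** A point off the boundary has a chart with nonzero imaginary part there, and by continuity the
    imaginary part stays nonzero nearby. *)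
Lemma closed_bd : closed (bd X).
Proof.
have [charts cover _] := surf_riemann X.
rewrite -openC openE => x; rewrite /bd /boundary /= => /existsNP[a].
move=> /not_implyP[aX] /not_implyP[ax] /eqP im.
have [aopen acont _ _] := charts a aX.
have := acont; rewrite continuous_open_subspace // => /(_ x (mem_set ax)) cx.
have e0 : 0 < `|complex.Im (Defs.coord a x)|%:C.
  by rewrite ltcR normr_gt0.
have near_x : \forall y \near x, dom a y /\
    `|(Defs.coord a x : R[i]) - Defs.coord a y| < `|complex.Im (Defs.coord a x)|%:C.
  apply: filterI; first exact: open_nbhs_nbhs.
  have /cvgrPdist_lt := cx; exact.
apply: filterS near_x => y [ay lty] /(_ a aX ay) imy.
have := le_lt_trans (normc_ge_Im _) lty.
by rewrite raddfB /= imy subr0 ltxx.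
Qed.

Variables (T : set (tagged_curve X)) (K : dissection T).

Lemma closed_triangle_side k (t : R) : 0 <= t <= 1 ->
  closed_triangle (side_point k t).
Proof.
case/andP=> t0 t1; rewrite /closed_triangle /= /side_point.
rewrite !Re_segment !Im_segment /corner.
by case: k => [[|[|[|]]]] //= ?; split; lra.
Qed.

Lemma side_point_near (k : 'I_3) (e : R[i]) : 0 < e ->
  exists t : R, 0 < t < 1 /\ ball (corner R (k + 1) : plane R) e (side_point k t).
Proof.
case: e => r i; rewrite ltcE /= => /andP[/eqP -> r0].
pose d : R[i] := corner R (k + 1) - corner R k.
pose m := Num.sqrt (complex.Re d ^+ 2 + complex.Im d ^+ 2).
have m0 : 0 <= m by exact: sqrtr_ge0.
(* With m the length of the side, this choice gives both s < 1 and s * m < r. *)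
pose s := r / (r + m + 1).
have den : 0 < r + m + 1 by lra.
have s0 : 0 < s by rewrite divr_gt0.
have s1 : s < 1 by rewrite ltr_pdivrMr // mul1r; lra.
exists (1 - s); split; first by apply/andP; split; lra.
rewrite -ball_normE /= /side_point /segment.
have -> : corner R (k + 1) -
    ((1 - (1 - s))%:C * corner R k + (1 - s)%:C * corner R (k + 1))
    = s%:C * d :> R[i].
  rewrite (_ : 1 - (1 - s) = s); last by ring.
  by rewrite rmorphB /= rmorph1 /d; ring.
rewrite normrM ger0_norm ?ler0c ?(ltW s0) // normc_def -/m.
have -> : s%:C * m%:C = (s * m)%:C by rewrite -rmorphM.
rewrite ltcR /s mulrAC ltr_pdivrMr // ltr_pM2l //; lra.
Qed.

(** The corner is a limit of points of the open side, and the boundary is closed. *)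
Lemma corner_in_bd f k : open_trace (side_curve (d := K) (f, k)) `<=` bd X ->
  bd X (param f (corner R (k + 1))).
Proof.
move=> sub; apply: closed_bd => B nB.
have cf : closed_triangle (corner R (k + 1)).
  have := @closed_triangle_side k 1; rewrite ler01 lexx => /(_ isT).
  by rewrite /side_point /segment subrr mul0r add0r mul1r.
have := @param_continuous _ _ _ K f.
move=> /subspace_continuousP/(_ _ cf) /(_ _ nB).
rewrite /within /= => /nbhs_ballP[e /= e0 he].
have [t [/andP[t0 t1] bt]] := side_point_near k e0.
exists (param f (side_point k t)); split.
  by apply: sub; exists t => //=; rewrite in_itv /= t0 t1.
by apply: he => //; apply: closed_triangle_side; rewrite !ltW.
Qed.

Lemma turn_neq f k : ~ bd X (param f (corner R k)) ->
  ~ (exists2 a, T a & one_notched_at a (param f (corner R k))) ->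
  turn (K := K) (f, k) != (f, k).
Proof.
move=> nbd nnot; apply/eqP; rewrite /turn /=.
(* [turn] fixes a corner also by default, when the side is not glued; then the side is in the
   boundary. Otherwise the triangle is glued to itself. *)
case gE : (Defs.glue (d := K) (f, k - 1)) => [y|] /= => [e|_].
  apply: nnot; exists (TaggedCurve (side_curve (d := K) (f, k - 1)) (tags false true)).
    by apply: self_folded; rewrite subrK -e.
  split=> //; exists true; split => //=.
  by rewrite /side_curve /= /side_point /segment subrr mul0r add0r mul1r subrK.
have [sub _] := side_boundary gE.
apply: nbd; rewrite -[k](subrK 1); apply: corner_in_bd.
by move=> x /sub[].
Qed.

Lemma valency_gt1 x : turn (K := K) x != x -> (1 < valency (fan_at x))%N.
Proof.
move=> ne; apply/card_gt1P; exists x, (turn (K := K) x).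
by split; [exact: connect0 | exact: fconnect1 | rewrite eq_sym].
Qed.

Variables (c : R -> X) (w : route (face K)).
Hypothesis cw : follows c w.

(** Each failure would place both ends of some chord on one side of its triangle, against
    [chord_not_in_side]. *)
Lemma follows_nonreturning :
  [/\ (0 < len w)%N,
      forall i, (0 < i < len w)%N -> entry w i != exit w i,
      start w = exit w 0 - 1 & stop w = entry w (len w) - 1].
Proof.
have [t [z [z' [_ [zs zt] zz _ chord]]]] := cw.
have ch i k : (i <= len w)%N ->
    side_form k (z i) = 0 -> side_form k (z' i) = 0 -> False.
  move=> le h1 h2; apply: (chord_not_in_side h1 h2) => s s0 s1 s0' s1'.
  by have [_] := chord i s le s0 s1; exact.
have opp (a b : 'I_3) : a != b -> a != b + 1 -> a = b - 1.
  move=> h1 h2; apply/eqP; move: h1 h2.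
  by case: a b => [[|[|[|]]]] //= ? [[|[|[|]]]].
have n0 : (0 < len w)%N.
  rewrite lt0n; apply/eqP => n0; rewrite n0 in zt.
  (* Any two corners of a triangle lie on a common side, so an arc crossing nothing would be a chord
     inside that side. *)
  have [k /andP[k1 k2]] : exists k : 'I_3, ((start w == k) || (start w == k + 1)) &&
      ((stop w == k) || (stop w == k + 1)).
    move: (start w) (stop w) => a b.
    have [->|ab] := eqVneq a b; first by exists b; rewrite eqxx.
    have [ba|ba] := eqVneq b (a + 1); first by exists a; rewrite ba !eqxx orbT.
    exists b; rewrite eqxx /= andbT; apply/orP; right; move: ab ba.
    by case: a b => [[|[|[|]]]] //= ? [[|[|[|]]]].
  by apply: (ch 0%N k); rewrite // ?zs ?zt side_form_corner.
split=> //.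
- move=> [//|i] /andP[_ lt]; apply/eqP => e.
  have [_ h2 _] := zz i (ltnW lt); have [h1 _ _] := zz i.+1 lt.
  apply: (ch i.+1 (entry w i.+1)); first exact: ltnW.
    exact: side_form_open_side.
  by apply: side_form_open_side; rewrite e.
- have [h1 _ _] := zz 0%N n0.
  apply: opp; apply/eqP => e; apply: (ch 0%N (exit w 0)) => //;
  by [rewrite zs side_form_corner // e eqxx ?orbT | exact: side_form_open_side].
have lt : ((len w).-1 < len w)%N by lia.
have [_ h2 _] := zz _ lt; rewrite prednK // in h2.
apply: opp; apply/eqP => e; apply: (ch (len w) (entry w (len w))) => //;
by [rewrite zt side_form_corner // e eqxx ?orbT | exact: side_form_open_side].
Qed.

Lemma follows_ends :
  c 0 = param (tri w 0) (corner R (start w)) /\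
  c 1 = param (tri w (len w)) (corner R (stop w)).
Proof.
have [t [z [z' [[t0 tn] [zs zt] zz lt chord]]]] := cw.
split.
  have [+ _] := chord 0%N 0 (leq0n _) (lexx _) ler01.
  by rewrite t0 mul0r addr0 => ->; rewrite /segment subr0 mul0r addr0 mul1r zs.
have [+ _] := chord (len w) 1 (leqnn _) ler01 (lexx _).
rewrite mul1r addrC subrK tn => ->.
by rewrite /segment subrr mul0r add0r mul1r zt.
Qed.
End Topology.

Theorem theorem1p4 (R : realType) (X : marked_surface R)
    (T : set (tagged_curve X)) (delta : tagged_curve X)
    (hT : tagged_triangulation T) (hA1 : plain_or_one_notched T)
    (hdelta : is_tagged_arc delta) (hnotin : ~ T (plain (under delta)))
    (hA2 : no_common_notch T delta)
    (K : dissection T) (gamma : R -> X) (w : route (face K))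
    (hgamma : isotopic (under delta) gamma) (hw : follows gamma w) :
  let fq := start_fan w (notched delta false) in
  let fp := stop_fan w (notched delta true) in
  let P := arc_polygon w fq fp in
  [/\ in_bijection {A : {set ptri P * 'I_3} | angle_matching A}
                   (snake_matchings w fq fp),
      in_bijection (snake_matchings w fq fp)
                   {E : {set gedge (bipartite_graph P)} | perfect_matching E}
    & in_bijection {E : {set gedge (bipartite_graph P)} | perfect_matching E}
                   {C : {set polygon_arrow P} | minimal_cut C}].
Proof.
have [n0 nr startE stopE] := follows_nonreturning hw.
have w_ok : nonreturning w by [].
have [_ _ not_bd _ _] := hdelta.
(* Isotopies keep the endpoints fixed, so the conditions on the notches of [delta] apply at the ends
   of [gamma]. *)
have end_gamma e : end_of delta e = end_of gamma e.
  have [H [_ _ H1 Hs]] := hgamma; have [_ e0 e1] := Hs 1 ler01 (lexx _).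
  by case: e; rewrite /= -?e0 -?e1 H1 ?ler01 ?lexx.
have fan_valency e x : notched delta e ->
    end_of gamma e = param x.1 (corner R x.2) -> (1 < valency (fan_at (K := K) x))%N.
  move=> de ex; apply: valency_gt1; case: x ex => f k /= ex.
  apply: turn_neq; rewrite -ex -end_gamma; first exact: not_bd.
  by case=> a Ta /(hA2 _ _ Ta); apply; exists e.
have [gamma0 gamma1] := follows_ends hw.
apply: polygon_bijections => //; rewrite /start_fan /stop_fan; case: ifP => //= h.
  split; first exact: (fan_valency true (tri w (len w), stop w) h gamma1).
  by rewrite /= stopE /newc eqn0Ngt n0.
split; first exact: (fan_valency false (tri w 0, start w) h gamma0).
by rewrite /= startE oldcE.
Qed.
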